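(* (1) If $\le_T^{RS}\neq\le_T^{p}$, then $\mathrm{P}\neq\mathrm{NP}$. (2) If $\le_T^{RS}=\le_T^{p}$, then $\mathrm{P}=\mathrm{NP}\cap\mathrm{coNP}$. (Reducibilities are identified with the sets of pairs $(A,B)$ they relate.)
   Context: $\le_T^p$ is polynomial-time Turing reducibility. An NPTM is a nondeterministic oracle Turing machine $N$ each of whose computation paths ends in one of three outcomes $\mathbf{acc}$, $\mathbf{rej}$, $\mathbf{?}$, such that there is a polynomial $p$ with: for every oracle $D$ and every input $x$, every computation path of $N^D(x)$ has length at most $p(|x|)$. For an oracle $D$ and input $x$, let $out_{N^D}(x)$ be the set of outcomes occurring on some path of $N^D(x)$; $L(N^D)=\{x:\mathbf{acc}\in out_{N^D}(x)\}$. $N^D(x)$ is underproductive if $\{\mathbf{acc},\mathbf{rej}\}\not\subseteq out_{N^D}(x)$, and overproductive if $out_{N^D}(x)\neq\{\mathbf{?}\}$. $N$ is robustly underproductive (overproductive) if $N^D(x)$ is underproductive (overproductive) for every oracle $D$ and every $x$. $A\le_T^{RS}B$ if there is an NPTM $N$ that is robustly overproductive and robustly underproductive with $A=L(N^B)$. *)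

(* Defs.v *)
From HB Require Import structures.
From mathcomp Require Import all_boot all_algebra.
From mathcomp Require Import boolp classical_sets.

Set Implicit Arguments.
Unset Strict Implicit.
Unset Printing Implicit Defensive.

Local Open Scope classical_set_scope.

Definition word := seq bool.
Definition language := set word.

Variant outcome := Acc | Rej | Quest.

Variant direction := GoLeft | Stay | GoRight.

(* A tape alphabet contains the blank [None], the two input bits           *)
(* [Some (inl b)], and finitely many auxiliary symbols [Some (inr s)].     *)
Definition symbol (S : Type) : Type := option (bool + S).

(* A two-way infinite tape, as a zipper around the head: the cells to the  *)
(* left and to the right of the head are listed nearest first, and all     *)
(* cells that are not listed are blank.                                    *)
Record tape (S : Type) := Tape {
  left_cells : seq (symbol S);
  scanned : symbol S;
  right_cells : seq (symbol S) }.

Definition tape_of_word (S : Type) (w : word) : tape S :=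
  if w is b :: w' then
    Tape [::] (Some (inl b)) [seq Some (inl b') | b' <- w']
  else Tape [::] None [::].

Fixpoint leading_bits (S : Type) (s : seq (symbol S)) : word :=
  if s is Some (inl b) :: s' then b :: leading_bits s' else [::].

(* The word written on a tape starts under the head and extends to the     *)
(* right up to the first non-bit, so that                                  *)
(* [word_of_tape (tape_of_word S w) = w].                                  *)
Definition word_of_tape (S : Type) (t : tape S) : word :=
  leading_bits (scanned t :: right_cells t).

Definition write (S : Type) (a : symbol S) (t : tape S) : tape S :=
  Tape (left_cells t) a (right_cells t).

Definition move (S : Type) (d : direction) (t : tape S) : tape S :=
  match d with
  | GoLeft => Tape (behead (left_cells t)) (head None (left_cells t))
                   (scanned t :: right_cells t)
  | Stay => t
  | GoRight => Tape (scanned t :: left_cells t) (head None (right_cells t))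
                    (behead (right_cells t))
  end.

(* What a machine with states Q, auxiliary symbols S, nondeterministic     *)
(* choices C and k tapes does in a given state:                            *)
(* - [Halt o]: stop with outcome o;                                        *)
(* - [Query q1 q0]: ask the oracle about the word on the query tape and    *)
(*   enter q1 if it belongs to the oracle, q0 otherwise;                   *)
(* - [Step delta]: guess some i in C, then apply the transition function   *)
(*   delta i to the scanned symbols, which gives the next state and, for   *)
(*   each tape, the symbol to write and the direction of the head.         *)
Variant instruction (Q S C : Type) (k : nat) :=
  | Halt of outcome
  | Query of Q & Q
  | Step of (C -> {ffun 'I_k -> symbol S} ->
             Q * {ffun 'I_k -> symbol S * direction}).
Arguments Halt {Q S C k}.
Arguments Query {Q S C k}.
Arguments Step {Q S C k}.

(* Nondeterministic oracle Turing machines. The set of choices is nonempty *)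
(* (it contains [choice0]), so computations only stop at [Halt].           *)
(* Tape [ord0] is the input tape and tape [ord_max] is the query tape.     *)
Record machine := Machine {
  state : finType;
  aux : finType;
  choices : finType;
  choice0 : choices;
  worktapes : nat;
  start : state;
  program : state -> instruction state aux choices worktapes.+2 }.

Record config (N : machine) := Config {
  cstate : state N;
  ctapes : {ffun 'I_(worktapes N).+2 -> tape (aux N)} }.

Definition init (N : machine) (x : word) : config N :=
  Config (start N)
    [ffun i => tape_of_word (aux N) (if i == ord0 then x else [::])].

Definition step (N : machine) (D : language) (c c' : config N) : Prop :=
  match program (cstate c) with
  | Halt _ => False
  | Query q1 q0 =>
      c' = Config (if `[< D (word_of_tape (ctapes c ord_max)) >] then q1
                   else q0)
                  (ctapes c)
  | Step delta =>
      exists i : choices N,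
        let: (q, act) := delta i [ffun j => scanned (ctapes c j)] in
        c' = Config q
               [ffun j => move (act j).2 (write (act j).1 (ctapes c j))]
  end.

(* [path_to D x n c]: some (partial) computation path of N^D(x) reaches c  *)
(* after n steps.                                                          *)
Inductive path_to (N : machine) (D : language) (x : word) :
    nat -> config N -> Prop :=
  | path_init : path_to D x 0 (init N x)
  | path_step n c c' :
      path_to D x n c -> step D c c' -> path_to D x n.+1 c'.

Definition out (N : machine) (D : language) (x : word) : set outcome :=
  [set o | exists (n : nat) (c : config N),
             path_to D x n c /\ program (cstate c) = Halt o].

Definition lang (N : machine) (D : language) : language :=
  [set x | out N D x Acc].

(* Bounding the partial paths also excludes infinite ones, hence every     *)
(* computation path ends at some [Halt].                                   *)
Definition polytime (N : machine) : Prop :=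
  exists p : {poly nat}, forall (D : language) (x : word) n (c : config N),
    path_to D x n c -> n <= p.[size x]%R.

Definition underproductive (N : machine) (D : language) (x : word) : Prop :=
  ~ ([set Acc; Rej] `<=` out N D x).

Definition overproductive (N : machine) (D : language) (x : word) : Prop :=
  out N D x <> [set Quest].

Definition robustly_underproductive (N : machine) : Prop :=
  forall D x, underproductive N D x.

Definition robustly_overproductive (N : machine) : Prop :=
  forall D x, overproductive N D x.

Definition deterministic (N : machine) : Prop := #|choices N| = 1.

Definition oracle_free (N : machine) : Prop :=
  forall q q1 q0, @program N q <> Query q1 q0.

(* Ordinary machines, which only accept or reject. *)
Definition two_outcome (N : machine) : Prop :=
  forall q, @program N q <> Halt Quest.

Definition classP : set language :=
  [set A | exists M : machine,
     [/\ polytime M, two_outcome M, oracle_free M, deterministic M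
       & A = lang M set0]].

Definition classNP : set language :=
  [set A | exists N : machine,
     [/\ polytime N, two_outcome N, oracle_free N & A = lang N set0]].

Definition class_coNP : set language := [set A | classNP (~` A)].

Definition le_pT : set (language * language) :=
  [set AB | exists M : machine,
     [/\ polytime M, two_outcome M, deterministic M & AB.1 = lang M AB.2]].

Definition le_RS : set (language * language) :=
  [set AB | exists N : machine,
     [/\ polytime N, robustly_overproductive N, robustly_underproductive N
       & AB.1 = lang N AB.2]].

(* Main.v *)
Require Import Defs.
From mathcomp Require Import all_boot all_algebra.
From mathcomp Require Import boolp classical_sets.
From mathcomp Require Import zify.
Local Open Scope classical_set_scope.

(* If P = NP, a robust machine N is simulated deterministically in rounds,  *)
(* with alternating targets acc and rej. Given the true answers K to the    *)
(* queries made so far, a round searches for some path of N that ends in    *)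
(* the target and whose oracle answers do not contradict K or each other.   *)
(* Whether a partial path extends to such a path is an NP question, so the  *)
(* path is found step by step by a decider for it, and the true answers to  *)
(* its queries are then added to K. If there is no path, the target is not  *)
(* the outcome of N^B(x). While the target differs from the outcome, each   *)
(* round answers a new query of a fixed true path R of N^B(x): otherwise    *)
(* R and the path that was found would be paths under a common oracle, and  *)
(* N would not be underproductive. So there are polynomially many rounds.   *)
(* Conversely, given NP machines for A and for its complement, the machine  *)
(* that guesses which of the two to run, and answers ? if that one rejects, *)
(* reduces A to the empty oracle.                                           *)

Set Implicit Arguments.
Unset Strict Implicit.
Unset Printing Implicit Defensive.

(** * A language of stack programs *)

(** Part (1) is proved by contraposition, as [P_eq_NP_RS_eq_T]. The inclusion [le_pT_RS] holds
    because a deterministic machine that never answers ? has exactly one outcome. For the converse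
    inclusion let N be robust and let B be the oracle. [ok] expresses that some path of N with the
    target outcome is consistent with a given finite list of answers and a given list of first
    choices. Every consistent path is a genuine path of N under some oracle ([traced_answer]), so
    the time bound of N, which is uniform in the oracle, applies to it, and [ok] is an NP question
    ([guess_language]). If P = NP it has a deterministic decider M, and M guides a prefix search for
    such a path.

    Two facts make the search decide N^B(x). A path under B is consistent with true answers
    ([ok_real]), so a negative test excludes the target, and robust overproductivity leaves only the
    other outcome. If a path with the wrong target is found, its oracle and B can be glued into one
    oracle under which N both accepts and rejects, unless the search met a query of the fixed true
    path whose answer was not yet known ([measure_lt]). The true answer to that query is then
    recorded, so the potential in [wp_rounds] bounds the number of rounds by a polynomial.

    Part (2) is [RS_eq_T_P_eq]. The machine for [both] guesses which of the NP machines for A and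
    for its complement to run. Exactly one of them accepts, so the outcomes contain exactly one of
    acc and rej, whatever the oracle. The hypothesis then gives a deterministic reduction of A to
    the empty set, whose queries can be eliminated by [transform].

    Since reductions are multitape Turing machines, all constructions are written as stack programs,
    one stack per tape. [wp] is their time-bounded semantics, [det] collects the rules for
    deterministic fragments, and [compile] yields a machine with the same time bound and the same
    outcomes. *)

Variant stack_op (A : Type) := Keep | Pop | Put of A | Push of A.
Arguments Keep {A}.
Arguments Pop {A}.

Definition stack_app A (o : stack_op A) (l : seq A) : seq A :=
  match o with
  | Keep => l
  | Pop => behead l
  | Put a => a :: behead l
  | Push a => a :: l
  end.

Section Language.
Variables (I S C : finType) (inp qry : I).
Local Notation cell := (bool + S)%type.

Definition regs := I -> seq cell.
Definition tops (s : regs) : {ffun I -> symbol S} := [ffun i => ohead (s i)].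

Inductive cmd :=
  | Stop of outcome
  | Ops of (I -> stack_op cell)
  | Seq of cmd & cmd
  | Case of ({ffun I -> symbol S} -> cmd)
  | Choose of (C -> cmd)
  | While of ({ffun I -> symbol S} -> bool) & cmd
  | Ask of cmd & cmd.

Definition Skip := Ops (fun=> Keep).

Definition lead (l : seq cell) : word := leading_bits [seq Some a | a <- l].

(* In [wp D o c k s T phi], the outcome o is fixed and k describes what      *)
(* follows c: [k s' U psi] says that the computations after c, started from  *)
(* s', have at most U steps, and that o is reachable iff psi. Then wp says   *)
(* the same of c followed by k, started from s.                              *)
Definition trans := regs -> nat -> Prop -> Prop.

(** The encoding is impredicative because the loop clause applies the recursive function [wp] to the
    predicate being defined, which an inductive declaration would not accept as strictly
    positive. *)
Definition lfp (F : trans -> trans) : trans :=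
  fun s T phi => forall P : trans,
    (forall s T phi, F P s T phi -> P s T phi) -> P s T phi.

Fixpoint wp (D : language) (o : outcome) (c : cmd) (k : trans) {struct c} :
    trans :=
  match c with
  | Stop o' => fun s T phi => phi = (o' = o)
  | Ops f => fun s T phi =>
      exists2 U, U.+1 < T & k (fun i => stack_app (f i) (s i)) U phi
  | Seq c1 c2 => wp D o c1 (wp D o c2 k)
  | Case f => fun s T phi =>
      exists2 U, U < T & wp D o (f (tops s)) k s U phi
  | Choose f => fun s T phi =>
      exists2 U, U < T & exists2 psi : C -> Prop,
        (forall i, wp D o (f i) k s U (psi i)) & phi = exists i, psi i
  | While b c => lfp (fun P s T phi => exists2 U, U < T &
      if b (tops s) then wp D o c P s U phi else k s U phi)
  | Ask c1 c0 => fun s T phi => exists2 U, U < T &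
      if `[< D (lead (s qry)) >] then wp D o c1 k s U phi
      else wp D o c0 k s U phi
  end.

(** Monotonicity in the continuation is what makes the [lfp] of a loop satisfy its unfolding
    equation; [wp_While] is one direction of it. *)
Lemma wp_mono D o c (k k' : trans) :
  (forall s T phi, k s T phi -> k' s T phi) ->
  forall s T phi, wp D o c k s T phi -> wp D o c k' s T phi.
Proof.
elim: c k k' => //= [f|c1 IH1 c2 IH2|f IH|f IH|b c IH|c1 IH1 c2 IH2] k k' kk'
  s T phi.
- by case=> U ? /kk' ?; exists U.
- by apply: IH1 => *; apply: IH2; eauto.
- by case=> U ? /IH h; exists U; auto.
- by case=> U ? [psi h ->]; exists U => //; exists psi => // i; apply: IH (h i).
- move=> h P HP; apply: (h P) => {h}{}s {}T {}phi [U UT].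
  by case: ifP => hb hk; apply: HP; exists U; rewrite ?hb //; apply: kk'.
- by case=> U ?; case: ifP => hD; [move/IH1|move/IH2] => h; exists U;
    rewrite ?hD; auto.
Qed.

Lemma wp_While D o b c (k : trans) s T phi U : U < T ->
  (if b (tops s) then wp D o c (wp D o (While b c) k) s U phi
   else k s U phi) -> wp D o (While b c) k s T phi.
Proof.
move=> UT h P HP; apply: (HP); exists U => //.
case: ifP h => // _; apply: wp_mono => s' T' phi'; exact.
Qed.

Lemma wp_le D o c (k : trans) s T T' phi :
  T <= T' -> wp D o c k s T phi -> wp D o c k s T' phi.
Proof.
elim: c k s T T' phi => //= [f|c1 IH1 c2 IH2|f IH|f IH|b c IH|c1 IH1 c2 IH2] k
  s T T' phi TT'.
- by case=> U UT h; exists U => //; apply: leq_trans TT'.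
- exact: IH1.
- by case=> U UT h; exists U => //; apply: leq_trans TT'.
- by case=> U UT h; exists U => //; apply: leq_trans TT'.
(* The other direction of the unfolding: the least fixed point lies in its own unfolding, whose
   first comparison [U < T] leaves room for a larger bound. *)
- move=> h; suff : exists2 U, U < T & if b (tops s) then
      wp D o c (wp D o (While b c) k) s U phi else k s U phi.
    by case=> U UT h'; apply: wp_While h'; apply: leq_trans TT'.
  apply: (h (fun s T phi => exists2 U, U < T & if b (tops s) then
      wp D o c (wp D o (While b c) k) s U phi else k s U phi)) => {h T' TT'} {}s
        {}T {}phi [U UT h]; exists U => //.
  case: ifP h => // _; apply: wp_mono => s' V phi' [V' VV'].
  exact: wp_While.
- by case=> U UT h; exists U => //; apply: leq_trans TT'.
Qed.

Lemma wp_Choose D o f (k : trans) s T phi (Phi : C -> Prop) :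
  (forall i, wp D o (f i) k s T (Phi i)) -> (phi <-> exists i, Phi i) ->
  wp D o (Choose f) k s T.+1 phi.
Proof. by move=> h /propext e; exists T => //; exists Phi. Qed.

Lemma wp_Stop D o o' (k : trans) s T : wp D o (Stop o') k s T (o' = o).
Proof. by []. Qed.

Lemma wp_Seq D o c1 c2 (k : trans) s T phi :
  wp D o c1 (wp D o c2 k) s T phi -> wp D o (Seq c1 c2) k s T phi.
Proof. by []. Qed.

Lemma wp_Case D o f (k : trans) s T phi :
  wp D o (f (tops s)) k s T phi -> wp D o (Case f) k s T.+1 phi.
Proof. by move=> h; exists T. Qed.

Lemma wp_Ask D o c1 c0 (k : trans) s T phi :
  (if `[< D (lead (s qry)) >] then wp D o c1 k s T phi
   else wp D o c0 k s T phi) -> wp D o (Ask c1 c0) k s T.+1 phi.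
Proof. by move=> h; exists T. Qed.

(* A record, so that unification does not look through the quantifiers. *)
Record det D o c s n s' : Prop := Det {
  wp_det : forall (k : trans) T phi, k s' T phi -> wp D o c k s (n + T) phi }.

Lemma det_le D o c s n n' s' : n <= n' -> det D o c s n s' -> det D o c s n' s'.
Proof.
by move=> nn' [h]; split=> k T phi /h; apply: wp_le; rewrite leq_add2r.
Qed.

Lemma det_Ops D o f s :
  det D o (Ops f) s 2 (fun i => stack_app (f i) (s i)).
Proof. by split=> k T phi h; exists T. Qed.

Lemma det_Skip D o s : det D o Skip s 2 s.
Proof. by split=> k T phi h; exists T. Qed.

Lemma det_Seq D o c1 c2 s1 s2 s3 n1 n2 :
  det D o c1 s1 n1 s2 -> det D o c2 s2 n2 s3 ->
  det D o (Seq c1 c2) s1 (n1 + n2) s3.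
Proof. by move=> [h1] [h2]; split=> k T phi /h2/h1; rewrite addnA. Qed.

Lemma det_Case D o f s n s' :
  det D o (f (tops s)) s n s' -> det D o (Case f) s n.+1 s'.
Proof. by move=> [h]; split=> k T phi /h; exists (n + T). Qed.

Lemma det_Ask D o c1 c0 s n s' :
  (if `[< D (lead (s qry)) >] then det D o c1 s n s' else det D o c0 s n s') ->
  det D o (Ask c1 c0) s n.+1 s'.
Proof.
move=> h; split=> k T phi kT; rewrite addSn; apply: wp_Ask.
by case: ifP h => _ [h]; apply: h.
Qed.

Lemma det_WhileF D o (b : _ -> bool) c s :
  b (tops s) = false -> det D o (While b c) s 1 s.
Proof.
by move=> hb; split=> k T phi h; apply: (@wp_While _ _ _ _ _ _ _ _ T);
  rewrite ?hb.
Qed.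

Lemma det_WhileT D o (b : _ -> bool) c s s1 s2 n1 n2 : b (tops s) ->
  det D o c s n1 s1 -> det D o (While b c) s1 n2 s2 ->
  det D o (While b c) s (n1 + n2).+1 s2.
Proof.
move=> hb [h1] [h2]; split=> k T phi /h2/h1 h.
apply: (wp_While (U := n1 + (n2 + T))); first by rewrite addSn addnA.
by rewrite hb.
Qed.

(** * Compilation of stack programs to Turing machines *)

Section Compile.
Variables (m : nat) (idx : I -> 'I_m.+2) (reg : 'I_m.+2 -> I).
Hypotheses (idxK : cancel idx reg) (idx_qry : idx qry = ord_max).

(** [Ops] has two positions because it takes two machine steps. Positions inside [Case] and [Choose]
    remember the value read or guessed, since it determines which command is being executed. *)
Fixpoint pos (c : cmd) : finType :=
  match c with
  | Stop _ => unit
  | Ops _ => bool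
  | Seq c1 c2 => (pos c1 + pos c2)%type
  | Case f => option {t : {ffun I -> symbol S} & pos (f t)}
  | Choose f => option {i : C & pos (f i)}
  | While _ c => option (pos c)
  | Ask c1 c0 => option (pos c1 + pos c0)
  end.

Fixpoint entry (c : cmd) : pos c :=
  match c with
  | Stop _ => tt
  | Ops _ => true
  | Seq c1 c2 => inl (entry c1)
  | Case _ | Choose _ | While _ _ | Ask _ _ => None
  end.

Local Notation action := {ffun 'I_m.+2 -> symbol S * direction}.

Definition still (a : {ffun 'I_m.+2 -> symbol S}) : action :=
  [ffun j => (a j, Stay)].

(* A push takes two steps: move to the left, then write. *)
Definition before (f : I -> stack_op cell) (a : {ffun 'I_m.+2 -> symbol S}) :
    action :=
  [ffun j => match f (reg j) with
             | Keep => (a j, Stay)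
             | Pop => (a j, GoRight)
             | Put b => (Some b, Stay)
             | Push _ => (a j, GoLeft)
             end].
Definition after (f : I -> stack_op cell) (a : {ffun 'I_m.+2 -> symbol S}) :
    action :=
  [ffun j => if f (reg j) is Push b then (Some b, Stay) else (a j, Stay)].

Definition retop (a : {ffun 'I_m.+2 -> symbol S}) : {ffun I -> symbol S} :=
  [ffun i => a (idx i)].

(** The code is parametrised by an embedding [e] of the positions into the states of the whole
    machine and by an exit state [x], so that subprograms are placed without renumbering. *)
Fixpoint emit (c : cmd) (Q : Type) : (pos c -> Q) -> Q -> pos c ->
    instruction Q S C m.+2 :=
  match c return (pos c -> Q) -> Q -> pos c -> instruction Q S C m.+2 with
  | Stop o => fun e x _ => Halt o
  | Ops f => fun e x b =>
      if b then Step (fun _ a => (e false, before f a))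
      else Step (fun _ a => (x, after f a))
  | Seq c1 c2 => fun e x q =>
      match q with
      | inl q => emit (fun q => e (inl q)) (e (inr (entry c2))) q
      | inr q => emit (fun q => e (inr q)) x q
      end
  | Case f => fun e x q =>
      match q with
      | None => Step (fun _ a =>
          (e (Some (existT _ (retop a) (entry (f (retop a))))), still a))
      | Some (existT t q) => emit (fun q => e (Some (existT _ t q))) x q
      end
  | Choose f => fun e x q =>
      match q with
      | None => Step (fun i a => (e (Some (existT _ i (entry (f i)))), still a))
      | Some (existT i q) => emit (fun q => e (Some (existT _ i q))) x q
      end
  | While b c => fun e x q =>
      match q with
      | None => Step (fun _ a =>
          (if b (retop a) then e (Some (entry c)) else x, still a))
      | Some q => emit (fun q => e (Some q)) (e None) q
      end
  | Ask c1 c0 => fun e x q =>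
      match q with
      | None => Query (e (Some (inl (entry c1)))) (e (Some (inr (entry c0))))
      | Some (inl q) => emit (fun q => e (Some (inl q))) x q
      | Some (inr q) => emit (fun q => e (Some (inr q))) x q
      end
  end.

Section Soundness.
Variables (Q : finType) (q0 : Q) (i0 : C)
  (P : Q -> instruction Q S C m.+2) (D : language) (o : outcome).
Let M := @Machine Q S C i0 m q0 P.

(** The counterpart of [wp] on the machine. The propositions [psi] are attached to successor
    configurations, not to choices, as different choices may lead to the same configuration. *)
Inductive good : config M -> nat -> Prop -> Prop :=
  | good_halt c T o' : program (cstate c) = Halt o' -> good c T (o' = o)
  | good_step c T psi :
      (forall o', program (cstate c) <> Halt o') ->
      (forall c', step D c c' -> good c' T (psi c')) ->
      good c T.+1 (exists2 c', step D c c' & psi c').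

Lemma good_le c T T' phi : T <= T' -> good c T phi -> good c T' phi.
Proof.
move=> TT' h; elim: h T' TT' => {c T phi} [c T o' hc|c T psi hc _ IH] [|T'] //
  TT'.
- exact: good_halt.
- exact: good_halt.
- by apply: good_step => // c' /IH; apply.
Qed.

(** The proposition only depends on the configuration. This is needed for [Choose], where the
    propositions are indexed by choices and must agree whenever the successors do. *)
Lemma good_inj c T U phi phi' : good c T phi -> good c U phi' -> phi = phi'.
Proof.
move=> h; elim: h U phi' => {c T phi} [c T o' hc|c T psi hc h IH] U phi' g.
- case: g hc => {c phi'} [c V o'' -> [->]|c V psi hc _] //.
  by move/hc.
- case: g hc h IH => {c phi'} [c V o'' hc hc'|c V psi' _ h' _ h IH].
    by have := hc' _ hc.
  apply/propext; split=> -[c' st p]; exists c' => //.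
    by rewrite -(IH _ st _ _ (h' _ st)).
  by rewrite (IH _ st _ _ (h' _ st)).
Qed.

Lemma good_step1 c c1 T phi : (forall o', program (cstate c) <> Halt o') ->
  (forall c', step D c c' <-> c' = c1) -> good c1 T phi -> good c T.+1 phi.
Proof.
move=> hc h g.
have -> : phi = exists2 c', step D c c' & phi.
  by apply/propext; split=> [p|[]//]; exists c1 => //; apply/h.
by apply: good_step => // c' /h ->.
Qed.

Inductive path_from (c : config M) : nat -> config M -> Prop :=
  | path_from0 : path_from c 0 c
  | path_fromS n d d' : path_from c n d -> step D d d' -> path_from c n.+1 d'.

Lemma path_from_cons c c' n d :
  step D c c' -> path_from c' n d -> path_from c n.+1 d.
Proof.
move=> st; elim=> [|{}n {}d d' _ h]; last exact: path_fromS h.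
exact: path_fromS (path_from0 c) st.
Qed.

Lemma path_from_inv c n d : path_from c n d ->
  n = 0 /\ d = c \/
  exists c' k, [/\ n = k.+1, step D c c' & path_from c' k d].
Proof.
elim=> [|{}n {}d d' _ [[-> ->] st|[c' [k [-> st p]]] st']]; first by left.
- by right; exists d', 0; split=> //; apply: path_from0.
- by right; exists c', k.+1; split=> //; apply: path_fromS st'.
Qed.

Lemma path_to_from x n d : path_to D x n d <-> path_from (init M x) n d.
Proof.
split; elim=> [|*].
- exact: path_from0.
- by apply: path_fromS; eauto.
- exact: path_init.
- by apply: path_step; eauto.
Qed.

Lemma good_paths c T phi : good c T phi ->
  (forall n d, path_from c n d -> n <= T) /\
  ((exists n d, path_from c n d /\ program (cstate d) = Halt o) <-> phi).
Proof.
elim=> {c T phi} [c T o' hc|c T psi hc _ IH].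
  have stuck c' : ~ step D c c' by rewrite /step hc.
  split=> [n d|].
    by case/path_from_inv=> [[-> //]|[c' [k [_ /stuck]]]].
  split=> [[n [d [/path_from_inv[[_ ->]|[c' [k [_ /stuck]]]] //]]]|<-].
    by rewrite hc => -[].
  by exists 0, c; split=> //; apply: path_from0.
split=> [n d|].
  case/path_from_inv=> [[-> //]|[c' [k [-> st]]]].
  by case: (IH _ st) => h _ /h.
split=> [[n [d [/path_from_inv[[_ ->]|[c' [k [_ st p]]]] hd]]]|[c' st /(proj2
  (IH _ st))[n [d [p hd]]]]].
- by case: (hc o).
- by exists c' => //; apply/(proj2 (IH _ st)); exists k, d.
- by exists n.+1, d; split=> //; apply: path_from_cons p.
Qed.

(* The top of a stack is the scanned cell of its tape, and the other cells   *)
(* of the stack are to the right of it; what is on the left is irrelevant.   *)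
Definition rep (c : config M) (s : regs) := forall i j,
  nth None (scanned (ctapes c (idx i)) :: right_cells (ctapes c (idx i))) j =
  nth None [seq Some a | a <- s i] j.

Definition at_state (q : Q) : trans := fun s T phi =>
  forall c : config M, cstate c = q -> rep c s -> good c T phi.

Lemma rep_tops (c : config M) s : rep c s ->
  retop [ffun j => scanned (ctapes c j)] = tops s.
Proof.
move=> r; apply/ffunP => i; rewrite !ffunE; have := r i 0 => /= ->.
by case: (s i).
Qed.

Lemma rep_eq (c c' : config M) s :
  (forall j, ctapes c j = ctapes c' j) -> rep c s -> rep c' s.
Proof. by move=> e r i j; rewrite -e. Qed.

Lemma leading_bits_nth (l l' : seq (symbol S)) :
  (forall j, nth None l j = nth None l' j) -> leading_bits l = leading_bits l'.
Proof.
elim: l l' => [|a l IH] [|a' l'] //= h.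
- by have := h 0 => /= <-.
- by have := h 0 => /= ->.
- have := h 0 => /= ->; case: a' h => // -[] // b h.
  by rewrite (IH l') // => j; have := h j.+1.
Qed.

Lemma rep_word (c : config M) s : rep c s ->
  word_of_tape (ctapes c ord_max) = lead (s qry).
Proof.
move=> r; apply: leading_bits_nth => j.
by rewrite -idx_qry r.
Qed.

Definition sub_at (c : cmd) (e : pos c -> Q) (x : Q) :=
  forall q, P (e q) = emit e x q.

Lemma at_state1 q q' s s' U T phi act : U < T ->
  (forall a, exists2 delta, P q = Step delta &
     forall i, delta i a = (q' a, act a)) ->
  (forall c : config M, rep c s ->
     rep (Config (N := M) (q' [ffun j => scanned (ctapes c j)])
       [ffun j => move (act [ffun j => scanned (ctapes c j)] j).2
          (write (act [ffun j => scanned (ctapes c j)] j).1 (ctapes c j))]) s')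
            ->
  (forall c : config M, rep c s ->
     at_state (q' [ffun j => scanned (ctapes c j)]) s' U phi) ->
  at_state q s T phi.
Proof.
move=> UT hP hrep hat c cq r; apply: (good_le UT).
have [delta e1 e2] := hP [ffun j => scanned (ctapes c j)].
apply: good_step1 (hat _ r _ _ (hrep _ r)) => //.
- by move=> o' /=; rewrite cq e1.
- move=> c'; rewrite /step /= cq e1; split=> [[i]|->]; last exists i0;
    by rewrite e2.
Qed.

Lemma rep_still (c : config M) s q : rep c s ->
  rep (Config (N := M) q
       [ffun j => move (still [ffun j => scanned (ctapes c j)] j).2
          (write (still [ffun j => scanned (ctapes c j)] j).1 (ctapes c j))]) s.
Proof.
by apply: rep_eq => j; rewrite !ffunE /=; case: (ctapes c j).
Qed.

(** Induction on the command, for all embeddings and exit states. The continuation of [wp] becomes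
    the statement that the exit state is good; for a loop, goodness of its entry state is the
    prefixed point to which the definition of [lfp] is applied. *)
Lemma emit_sound c (e : pos c -> Q) x : sub_at e x ->
  forall s T phi, wp D o c (at_state x) s T phi -> at_state (e (entry c)) s T
    phi.
Proof.
elim: c e x => /= [o'|f|c1 IH1 c2 IH2|f IH|f IH|b c IH|c1 IH1 c2 IH2] e x hs s T
  phi.
- by move=> -> c cq r; apply: good_halt; rewrite /= cq hs.
- case=> U UT h.
  move=> c cq r; apply: (good_le UT).
  apply: (good_step1 (c1 := Config (N := M) (e false)
       [ffun j => move (before f [ffun j => scanned (ctapes c j)] j).2
          (write (before f [ffun j => scanned (ctapes c j)] j).1 (ctapes c
            j))])).
  + by move=> o' /=; rewrite cq hs.
  + by move=> c'; rewrite /step /= cq hs /=; split=> [[]|->] //; exists i0.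
  set c1 := Config _ _.
  apply: (good_step1 (c1 := Config (N := M) x
       [ffun j => move (after f [ffun j => scanned (ctapes c1 j)] j).2
          (write (after f [ffun j => scanned (ctapes c1 j)] j).1 (ctapes c1
            j))])).
  + by move=> o' /=; rewrite hs.
  + by move=> c'; rewrite /step /= hs /=; split=> [[]|->] //; exists i0.
  apply: h => // i j; have := r i; rewrite !ffunE !idxK.
  case: (f i) => [||a|a] /= {}r.
  + exact: r.
  (* Popping an empty stack moves the head over blanks, which still represent the empty stack. *)
  + have := r j.+1; case: (s i) => [|? ?] /=; case: (right_cells _) => [|? ?];
      by case: j {r} => //= ?; rewrite ?nth_nil.
  + case: j => // j; have := r j.+1 => /= ->.
    by case: (s i) {r} => //=; rewrite nth_nil.
  + by case: j => // j; apply: r.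
- move=> h; apply: (IH1 (fun q => e (inl q)) (e (inr (entry c2)))).
    by move=> q; rewrite hs.
  apply: wp_mono h => s' T' phi'.
  by apply: (IH2 (fun q => e (inr q))) => q; rewrite hs.
- case=> U UT h.
  apply: (at_state1 (s' := s) (U := U) UT
    (q' := fun a => e (Some (existT _ (retop a) (entry (f (retop a))))))
    (act := still)).
  + by move=> a; rewrite hs /=; eexists; first reflexivity.
  + by move=> c; apply: rep_still.
  + move=> c r; rewrite (rep_tops r).
    apply: (IH _ (fun q => e (Some (existT _ (tops s) q)))) h => q.
    by rewrite hs.
- case=> U UT [psi h ->] c cq r.
  apply: (good_le UT).
  pose c1 i := Config (N := M) (e (Some (existT _ i (entry (f i)))))
       [ffun j => move (still [ffun j => scanned (ctapes c j)] j).2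
          (write (still [ffun j => scanned (ctapes c j)] j).1 (ctapes c j))].
  have hst c' : step D c c' <-> exists i, c' = c1 i.
    by rewrite /step /= cq hs /=; split=> -[i ->]; exists i.
  have g i : good (c1 i) U (psi i).
    have hi : sub_at (fun q => e (Some (existT _ i q))) x by move=> q;
      rewrite hs.
    by apply: (IH i _ _ hi _ _ _ (h i)) => //; apply: rep_still.
  have -> : (exists i, psi i) =
      exists2 c', step D c c' & exists2 i, c' = c1 i & psi i.
    apply/propext; split=> [[i p]|[c' _ [i _ p]]]; last by exists i.
    by exists (c1 i); [apply/hst; exists i|exists i].
  apply: good_step => [o' /=|c' /hst[i ->]]; first by rewrite cq hs.
  suff -> : (exists2 i', c1 i = c1 i' & psi i') = psi i by [].
  apply/propext; split=> [[i' ii' p]|]; last by exists i.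
  by rewrite (good_inj (g i) (U := U) (phi' := psi i')) // ii'.
- move=> h; apply: (h (at_state (e None))) => {h}{}s {}T {}phi [U UT h].
  apply: (at_state1 (s' := s) (U := U) UT (q' := fun a => if b (retop a) then e
    (Some (entry c)) else x)
    (act := still)).
  + by move=> a; rewrite hs /=; eexists; first reflexivity.
  + by move=> c'; apply: rep_still.
  + move=> c' r; rewrite (rep_tops r).
    case: ifP h => // _.
    by apply: (IH (fun q => e (Some q))) => q; rewrite hs.
- case=> U UT h c cq r; apply: (good_le UT).
  apply: (good_step1 (c1 := Config (N := M) (if `[< D (lead (s qry)) >]
     then e (Some (inl (entry c1))) else e (Some (inr (entry c2)))) (ctapes
       c))).
  + by move=> o' /=; rewrite cq hs.
  + by move=> c'; rewrite /step /= cq hs /= (rep_word r).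
  case: ifP h => hD h.
  + by apply: (IH1 (fun q => e (Some (inl q)))) h _ _ _ => // q; rewrite hs.
  + by apply: (IH2 (fun q => e (Some (inr q)))) h _ _ _ => // q; rewrite hs.
Qed.

End Soundness.

End Compile.

(** The registers are listed with the input first and the query register last, as the machine model
    reserves tapes [ord0] and [ord_max] for them. *)
Lemma tape_index : inp != qry ->
  exists m (idx : I -> 'I_m.+2) (reg : 'I_m.+2 -> I),
    [/\ cancel idx reg, idx inp = ord0 & idx qry = ord_max].
Proof.
move=> iq; pose l := [seq i <- enum I | (i != inp) && (i != qry)].
pose s := inp :: rcons l qry; pose m := size l.
have szs : size s = m.+2 by rewrite /= size_rcons.
have ms i : i \in s.
  rewrite inE mem_rcons inE mem_filter mem_enum andbT.
  by case: eqP; case: eqP.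
exists m, (fun i => inord (index i s)), (fun j => nth inp s j); split.
- by move=> i; rewrite inordK ?nth_index // -szs index_mem.
- by apply/ord_inj; rewrite inordK /= eqxx.
- apply/ord_inj; rewrite inordK -?szs ?index_mem //=.
  rewrite (negbTE iq) -cats1 index_cat mem_filter eqxx andbF /= eqxx addn0.
  by [].
Qed.

Definition init_regs (x : word) : regs :=
  fun i => if i == inp then [seq inl b | b <- x] else [::].

(** The exit state halts with [Rej], which is the continuation in the premise: a program that runs
    off its end rejects. *)
Theorem compile (i0 : C) c : inp != qry ->
  exists2 N : machine, #|choices N| = #|C| &
    forall D x o T phi,
      wp D o c (fun _ _ phi => phi = (Rej = o)) (init_regs x) T phi ->
      (forall n (d : config N), path_to D x n d -> n <= T) /\
      (out N D x o <-> phi).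
Proof.
move=> /tape_index[m [idx [reg [idxK ii iq]]]].
pose P (q : option (pos c)) : instruction (option (pos c)) S C m.+2 :=
  if q is Some q then emit idx reg some None q else Halt Rej.
exists (Machine i0 (Some (entry c)) P) => // D x o T phi.
set N := Machine _ _ _ => h.
have g : good (i0 := i0) (q0 := Some (entry c)) (P := P) D o (init N x) T phi.
  apply: (emit_sound idxK iq (x := None) (e := some)) (init N x) _ _ => //.
    apply: wp_mono h => s U psi -> d dN _; apply: good_halt.
    by rewrite /= dN.
  move=> i j; rewrite !ffunE -ii (can_eq idxK) /init_regs.
  case: eqP => _; last by rewrite /= nth_nil; case: j => //= j; rewrite nth_nil.
  by case: x {h} => [|b x] /=; [case: j => //= j;
    rewrite nth_nil|rewrite -map_comp].
case: (good_paths g) => gT gphi; split=> [n d /path_to_from/gT //|].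
rewrite -gphi; split=> -[n [d [p hd]]]; exists n, d; split=> //;
  exact/path_to_from.
Qed.

End Language.

Arguments wp : simpl never.

(** * Moving words between stacks and clearing stacks *)

Section Loops.
Variables (I S C : finType) (qry : I) (D : language) (o : outcome).
Local Notation cell := (bool + S)%type.
Local Notation det := (@det I S C qry D o).
Local Notation cmd := (@cmd I S C).
Local Notation regs := (@regs I S).

(** One operation pushes at most one symbol per register, so a block takes [n] operations, its last
    symbol first; registers with shorter blocks wait with [Keep]. *)
Fixpoint pushn (u : I -> seq cell) (n : nat) : cmd :=
  if n is n'.+1 then
    Seq (Ops C (fun r => if drop n' (u r) is a :: _ then Push a else Keep))
        (pushn u n')
  else Skip I S C.

Lemma det_pushn u n s :
  det (pushn u n) s (2 * n + 2) (fun r => take n (u r) ++ s r).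
Proof.
elim: n s => [|n IH] s /=.
  have <- : s = (fun r => take 0 (u r) ++ s r).
    by apply/funext => r; rewrite take0.
  exact: det_Skip.
rewrite mulnS -addnA; apply: det_Seq (det_Ops _ _ _ _ _ _) _.
suff <- : (fun r => take n (u r) ++
    stack_app (if drop n (u r) is a :: _ then Push a else Keep) (s r)) =
  (fun r => take n.+1 (u r) ++ s r) by exact: IH.
apply/funext => r.
elim: (u r) n {IH} => [|a l IH] [|n] //=; first by rewrite take0.
by rewrite IH.
Qed.

(** A transfer reverses the order of the blocks, so a transfer to a scratch register and back
    restores a word, and can leave copies elsewhere in either order. The bound [n] on the blocks
    makes the loop body a fixed command. *)
Definition xfer src (g : cell -> bool) (f : cell -> I -> seq cell) n : cmd :=
  While (fun t => if t src is Some a then g a else false)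
    (Case (fun t => if t src is Some a then
       Seq (Ops C (fun r => if r == src then Pop else Keep)) (pushn (f a) n)
     else Skip I S C)).

Lemma det_xfer src g f n s p l :
  (forall a r, size (f a r) <= n) -> (forall a, f a src = [::]) ->
  s src = p ++ l -> all g p -> (if l is a :: _ then ~~ g a else true) ->
  det (xfer src g f n) s (size p * (2 * n + 6) + 1)
    (fun r => if r == src then l else flatten (rev [seq f a r | a <- p]) ++ s
      r).
Proof.
move=> fn fs; elim: p s => [|a p IH] s /= es.
  move=> _ hl; rewrite mul0n add0n.
  have -> : (fun r => if r == src then l else s r) = s.
    by apply/funext => r; case: eqP => [->|].
  by apply: det_WhileF; rewrite ffunE es; case: l hl {es} => //= a l /negbTE.
case/andP=> ga gp hl.
pose s1 : regs := fun r => take n (f a r) ++ (if r == src then behead (s r) else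
  s r).
have es1 : s1 src = p ++ l by rewrite /s1 fs eqxx es.
have -> : (fun r => if r == src then l
    else flatten (rev (f a r :: [seq f a r | a <- p])) ++ s r) =
  (fun r => if r == src then l else flatten (rev [seq f a r | a <- p]) ++ s1 r).
  apply/funext => r; case: eqP => // /eqP /negbTE rs.
  by rewrite /s1 rs rev_cons flatten_rcons take_oversize // catA.
apply: (@det_le _ _ _ _ _ _ _ _
  ((2 + (2 * n + 2)).+1 + (size p * (2 * n + 6) + 1)).+1); first by lia.
apply: det_WhileT (IH _ es1 gp hl); first by rewrite ffunE es.
apply: det_Case; rewrite ffunE es /=.
apply: det_Seq (det_Ops _ _ _ _ _ _) _.
have -> : s1 = fun r => take n (f a r) ++
    stack_app (if r == src then Pop else Keep) (s r).
  by apply/funext => r; rewrite /s1; case: ifP.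
exact: det_pushn.
Qed.

Lemma det_Ops_to f s s' : (forall r, s' r = stack_app (f r) (s r)) ->
  det (Ops C f) s 2 s'.
Proof. by move=> /funext ->; apply: det_Ops. Qed.

Lemma det_xfer_to src g f n s p l s' m :
  (forall a r, size (f a r) <= n) -> (forall a, f a src = [::]) ->
  s src = p ++ l -> all g p -> (if l is a :: _ then ~~ g a else true) ->
  s' src = l ->
  (forall r, r != src -> s' r = flatten (rev [seq f a r | a <- p]) ++ s r) ->
  size p * (2 * n + 6) + 1 <= m -> det (xfer src g f n) s m s'.
Proof.
move=> fn fs es gp gl e1 e2 le; apply: det_le le _.
have -> : s' = (fun r => if r == src then l
    else flatten (rev [seq f a r | a <- p]) ++ s r).
  by apply/funext => r; case: ifP => [/eqP -> //|/negbT/e2].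
exact: det_xfer.
Qed.

Lemma flatten_rev1 (T1 T2 : Type) (f : T1 -> T2) l :
  flatten (rev [seq [:: f a] | a <- l]) = rev (map f l).
Proof. by rewrite -!map_rev; elim: (rev l) => //= a r ->. Qed.

Lemma flatten_rev0 (T1 T2 : Type) (l : seq T1) :
  flatten (rev [seq [::] | a <- l]) = [::] :> seq T2.
Proof. by rewrite -map_rev; elim: (rev l). Qed.

Definition clear (P : pred I) : cmd :=
  While (fun t => [exists r, P r && isSome (t r)])
    (Ops C (fun r => if P r then Pop else Keep)).

Lemma det_clear (P : pred I) s n : (forall r, P r -> size (s r) <= n) ->
  det (clear P) s (3 * n + 1) (fun r => if P r then [::] else s r).
Proof.
have stop s0 : [exists r, P r && isSome (tops s0 r)] = false ->
    det (clear P) s0 1 (fun r => if P r then [::] else s0 r).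
  move=> h; have -> : (fun r => if P r then [::] else s0 r) = s0.
    apply/funext => r; case: ifP => // Pr.
    move: h => /negbT; rewrite negb_exists => /forallP/(_ r).
    by rewrite Pr ffunE; case: (s0 r).
  exact: det_WhileF.
elim: n s => [|n IH] s hs.
  apply: stop; apply/negbTE/existsPn => r; rewrite negb_and ffunE.
  by case: (boolP (P r)) => //= /hs; case: (s r).
case: (boolP [exists r, P r && isSome (tops s r)]) => [h|/negbTE/stop].
  have -> : 3 * n.+1 + 1 = (2 + (3 * n + 1)).+1 by rewrite mulnS -addnA.
  apply: det_WhileT h (det_Ops _ _ _ _ _ _) _.
  have -> : (fun r => if P r then [::] else s r) = fun r => if P r then [::]
      else stack_app (if P r then Pop else Keep) (s r).
    by apply/funext => r; case: ifP.
  by apply: IH => r Pr; rewrite Pr /=; move: (hs r Pr); case: (s r).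
by apply: det_le; rewrite addn1.
Qed.

End Loops.

Arguments det_xfer_to {I S C qry D o src g f n s} p l {s' m}.

(** * Simulating a machine by a stack program *)

Definition goto (N : machine) (q : state N) (c : config N) : config N :=
  Config q (ctapes c).

Definition stepf (N : machine) (D : language) (i : choices N) (c : config N) :
    config N :=
  match program (cstate c) with
  | Halt _ => c
  | Query q1 q0 =>
      goto (if `[< D (word_of_tape (ctapes c ord_max)) >] then q1 else q0) c
  | Step delta =>
      let qa := delta i [ffun j => scanned (ctapes c j)] in
      Config qa.1
        [ffun j => move (qa.2 j).2 (write (qa.2 j).1 (ctapes c j))]
  end.

Definition halts (N : machine) (c : config N) : option outcome :=
  if program (cstate c) is Halt o then Some o else None.

(* A simulated machine uses one register for its state (which is kept as a *)
(* symbol), and two stacks per tape.                                       *)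
Definition mreg (N : machine) : finType :=
  option ('I_(worktapes N).+2 + 'I_(worktapes N).+2).

Record embedding (N : machine) (I S : finType) := Embedding {
  rho : mreg N -> I;
  unrho : I -> option (mreg N);
  st : state N -> bool + S;
  unst : bool + S -> option (state N);
  sy : symbol (aux N) -> bool + S;
  unsy : bool + S -> symbol (aux N);
  rhoK : forall m, unrho (rho m) = Some m;
  unrhoK : forall r m, unrho r = Some m -> rho m = r;
  stK : forall q, unst (st q) = Some q;
  syK : cancel sy unsy }.

Section Simulation.
Variables (I S C : finType) (qry : I) (D : language) (o : outcome).
Variables (N : machine) (E : embedding N I S).
Local Notation cell := (bool + S)%type.
Local Notation det := (@det I S C qry D o).
Local Notation cmd := (@cmd I S C).
Local Notation regs := (@regs I S).
Local Notation view := {ffun I -> symbol S}.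

Definition content (c : config N) (m : mreg N) : seq cell :=
  match m with
  | None => [:: st E (cstate c)]
  | Some (inl j) => [seq sy E a | a <- left_cells (ctapes c j)]
  | Some (inr j) =>
      [seq sy E a | a <- scanned (ctapes c j) :: right_cells (ctapes c j)]
  end.

Definition ov (s : regs) (c : config N) : regs :=
  fun r => if unrho E r is Some m then content c m else s r.

Definition cur (t : view) : option (state N) :=
  obind (unst E) (t (rho E None)).

Definition peek (t : view) (m : mreg N) : symbol (aux N) :=
  if t (rho E m) is Some a then unsy E a else None.

(** The scanned cell is the top of the right stack of its tape, so this stack must not stay empty:
    beyond its last cell an explicit encoded blank is supplied. *)
Definition norm : cmd :=
  Case (fun t => Ops C (fun r =>
    if unrho E r is Some (Some (inr _)) then
      if t r is None then Push (sy E None) else Keep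
    else Keep)).

Definition simstep (i : choices N) : cmd :=
  Case (fun t =>
    match omap (@program N) (cur t) with
    | Some (Step delta) =>
        let qa := delta i [ffun j => peek t (Some (inr j))] in
        Seq (Ops C (fun r =>
          match unrho E r with
          | Some None => Put (st E qa.1)
          | Some (Some (inr j)) => Put (sy E (qa.2 j).1)
          | _ => Keep
          end))
        (Seq (Ops C (fun r =>
          match unrho E r with
          | Some (Some (inl j)) =>
              match (qa.2 j).2 with
              | GoLeft => Pop
              | Stay => Keep
              | GoRight => Push (sy E (qa.2 j).1)
              end
          | Some (Some (inr j)) =>
              match (qa.2 j).2 with
              | GoLeft => Push (sy E (peek t (Some (inl j))))
              | Stay => Keep
              | GoRight => Pop
              end
          | _ => Keep
          end))
        norm)
    | _ => Skip I S C
    end).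

Lemma cur_ov s c : cur (tops (ov s c)) = Some (cstate c).
Proof. by rewrite /cur ffunE /ov rhoK /= stK. Qed.

Lemma peekr_ov s c j :
  peek (tops (ov s c)) (Some (inr j)) = scanned (ctapes c j).
Proof. by rewrite /peek ffunE /ov rhoK /= syK. Qed.

Lemma peekl_ov s c j :
  peek (tops (ov s c)) (Some (inl j)) = head None (left_cells (ctapes c j)).
Proof.
by rewrite /peek ffunE /ov rhoK /=; case: (left_cells _) => //= a l;
  rewrite syK.
Qed.

Lemma det_norm s s' :
  (forall r, s' r = if unrho E r is Some (Some (inr _)) then
     if s r is [::] then [:: sy E None] else s r else s r) ->
  det norm s 3 s'.
Proof.
move=> h; apply: det_Case.
suff -> : s' = fun r => stack_app
    (if unrho E r is Some (Some (inr _)) then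
      if tops s r is None then Push (sy E None) else Keep
    else Keep) (s r) by exact: det_Ops.
apply/funext => r; rewrite h ffunE.
by case: (unrho E r) => [[[]|]|] //; case: (s r).
Qed.

Lemma det_simstep i s c delta : program (cstate c) = Step delta ->
  det (simstep i) (ov s c) 8 (ov s (stepf D i c)).
Proof.
move=> hc; apply: det_Case; rewrite cur_ov /= hc.
set v := [ffun j => _]; set qa := delta i v.
(* Of the 8 steps one reads the state and the scanned symbols, two write, two move, and three are
   spent on [norm]. *)
rewrite -[7]/(2 + (2 + 3)).
apply: det_Seq (det_Ops _ _ _ _ _ _) (det_Seq (det_Ops _ _ _ _ _ _) _).
apply: det_norm => r.
have vE : v = [ffun j => scanned (ctapes c j)].
  by apply/ffunP => j; rewrite !ffunE peekr_ov.
rewrite /ov; case e: (unrho E r) => [[[j|j]|]|] //=;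
  rewrite /stepf hc -vE -/qa //=.
- rewrite ffunE; case: (qa.2 j).2 => //=.
  by rewrite -behead_map.
- rewrite ffunE; case: (qa.2 j).2 => //=.
    by rewrite peekl_ov.
  by case: (right_cells _).
Qed.

Definition setst (q : state N) : cmd :=
  Ops C (fun r => if unrho E r is Some None then Put (st E q) else Keep).

Lemma det_setst q s c : det (setst q) (ov s c) 2 (ov s (goto q c)).
Proof.
suff -> : ov s (goto q c) = fun r => stack_app
  (if unrho E r is Some None then Put (st E q) else Keep) (ov s c r).
  exact: det_Ops.
by apply/funext => r; rewrite /ov; case: (unrho E r) => [[[]|]|].
Qed.

Definition start_sim : cmd := Seq (setst (start N)) norm.

Definition blank (s : regs) x := forall m, s (rho E m) =
  if m == Some (inr ord0) then [seq sy E (Some (inl b)) | b <- x] else [::].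

Lemma det_start_sim s x :
  blank s x -> det start_sim s 5 (ov s (init N x)).
Proof.
move=> hs; rewrite -[5]/(2 + 3).
apply: det_Seq (det_Ops _ _ _ _ _ _) _; apply: det_norm => r.
rewrite /ov; case e: (unrho E r) => [[[j|j]|]|] //=;
  rewrite -(unrhoK e) hs //= !ffunE; last first.
  rewrite -[Some (inr j) == _]/(j == ord0).
  case: (j == ord0) => //=.
  by case: x {hs} => //= b x; rewrite -map_comp.
by case: ifP => //; case: x {hs}.
Qed.

Definition live (t : view) : bool :=
  if omap (@program N) (cur t) is Some (Halt _) then false else true.

Lemma live_ov s c : live (tops (ov s c)) = ~~ isSome (halts c).
Proof. by rewrite /live cur_ov /halts /=; case: (program _). Qed.

Lemma det_run i s c n : oracle_free N -> isSome (halts (iter n (stepf D i) c))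
  ->
  det (While live (simstep i)) (ov s c) (9 * n + 1)
    (ov s (iter n (stepf D i) c)).
Proof.
move=> hN; elim: n c => [|n IH] c hn.
  by apply: det_WhileF; rewrite live_ov hn.
case hc: (isSome (halts c)).
  have fixc m : iter m (stepf D i) c = c.
    elim: m => //= m ->; move: hc; rewrite /halts /stepf.
    by case: (program _).
  rewrite fixc; apply: (@det_le _ _ _ _ _ _ _ _ 1); first by lia.
  by apply: det_WhileF; rewrite live_ov hc.
apply: (@det_le _ _ _ _ _ _ _ _ (8 + (9 * n + 1)).+1); first by lia.
rewrite iterSr in hn *.
apply: det_WhileT (IH _ hn); first by rewrite live_ov hc.
move: hc; rewrite /halts; case e: (program _) => [|q1 q0|delta] // _.
- by case: (hN _ _ _ e).
- exact: det_simstep e.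
Qed.

End Simulation.

(** * Runs, polynomial bounds and outcomes *)

Definition polyb (f : nat -> nat) := exists p : {poly nat}, forall n,
  f n <= p.[n]%R.

Lemma horner_leq (p : {poly nat}) m n : m <= n -> p.[m]%R <= p.[n]%R.
Proof.
move=> mn; rewrite !horner_coef; apply: leq_sum => i _.
apply: leq_mul => //; elim: (nat_of_ord i) => // k IH.
by rewrite !GRing.exprS; apply: leq_mul.
Qed.

Lemma polyb_le f g : (forall n, f n <= g n) -> polyb g -> polyb f.
Proof. by move=> fg [p gp]; exists p => n; apply: leq_trans (gp n). Qed.

Lemma polyb_horner (p : {poly nat}) : polyb (fun n => p.[n]%R).
Proof. by exists p. Qed.

Lemma polyb_const c : polyb (fun=> c).
Proof. by exists (c%:P)%R => n; rewrite hornerC. Qed.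

Lemma polyb_id : polyb id.
Proof. by exists 'X%R => n; rewrite hornerX. Qed.

Lemma polyb_add f g : polyb f -> polyb g -> polyb (fun n => f n + g n).
Proof.
by move=> [p fp] [q gq]; exists (p + q)%R => n; rewrite hornerD; apply: leq_add.
Qed.

Lemma polyb_mul f g : polyb f -> polyb g -> polyb (fun n => f n * g n).
Proof.
by move=> [p fp] [q gq]; exists (p * q)%R => n; rewrite hornerM; apply: leq_mul.
Qed.

Lemma polyb_comp f g : polyb f -> polyb g -> polyb (fun n => f (g n)).
Proof.
move=> [p fp] [q gq]; exists (p \Po q)%R => n; rewrite horner_comp.
by apply: leq_trans (fp _) (horner_leq _ (gq n)).
Qed.

Section Runs.
Variable N : machine.
Implicit Types (D : language) (x : word) (c : config N) (g : seq (choices N)).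

(** Paths are indexed by choice strings. Query steps consume a choice without looking at it and
    halted configurations are fixed, so that every string determines a run. *)
Definition run D g c : config N := foldl (fun c i => stepf D i c) c g.

Lemma run_rcons D g i c : run D (rcons g i) c = stepf D i (run D g c).
Proof. by rewrite /run -cats1 foldl_cat. Qed.

Lemma run_cat D g g' c : run D (g ++ g') c = run D g' (run D g c).
Proof. exact: foldl_cat. Qed.

Lemma halts_step D c c' : step D c c' -> halts c = None.
Proof. by rewrite /step /halts; case: (program _). Qed.

Lemma step_stepf D c c' : step D c c' -> exists i, c' = stepf D i c.
Proof.
rewrite /step /stepf; case: (program _) => [o|q1 q0|delta] //.
  by move=> ->; exists (choice0 N); rewrite /goto; case: asboolP.
by case=> i; case e: (delta _ _) => [q act] ->; exists i; rewrite e.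
Qed.

Lemma stepf_step D c i : halts c = None -> step D c (stepf D i c).
Proof.
rewrite /step /stepf /halts; case: (program _) => [o|q1 q0|delta] // _.
by exists i; case: (delta _ _).
Qed.

Lemma stepf_halts D c i : isSome (halts c) -> stepf D i c = c.
Proof. by rewrite /stepf /halts; case: (program _). Qed.

Lemma run_halts D c g : isSome (halts c) -> run D g c = c.
Proof.
by move=> h; rewrite /run; elim: g => //= i g; rewrite stepf_halts.
Qed.

Lemma path_to_run D x n c : path_to D x n c ->
  exists2 g, size g = n & c = run D g (init N x).
Proof.
elim=> [|{}n {}c c' _ [g <- ->] /step_stepf[i ->]]; first by exists [::].
by exists (rcons g i); rewrite ?size_rcons ?run_rcons.
Qed.

Lemma run_path_to D x g : exists2 n, path_to D x n (run D g (init N x)) &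
  halts (run D g (init N x)) = None -> n = size g.
Proof.
elim/last_ind: g => [|g i [n p e]]; first by exists 0 => //; apply: path_init.
rewrite run_rcons; case h: (halts (run D g (init N x))) => [o|].
  by rewrite stepf_halts h //; exists n.
exists n.+1; first exact: path_step p (stepf_step _ _ h).
by rewrite e // size_rcons.
Qed.

Lemma out_run D x o :
  out N D x o <-> exists g, halts (run D g (init N x)) = Some o.
Proof.
split=> [[n [c [/path_to_run[g _ ->] hc]]]|[g hg]].
  by exists g; rewrite /halts hc.
have [n p _] := run_path_to D x g; exists n, (run D g (init N x)); split=> //.
by move: hg; rewrite /halts; case: (program _) => // ? [->].
Qed.

(** Strings may continue after the halt, so only the length of those that have not yet halted is
    bounded. *)
Lemma polytimeP : polytime N <-> exists2 f, polyb f &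
  forall D x g, halts (run D g (init N x)) = None -> size g <= f (size x).
Proof.
split=> [[p hp]|[f [p fp] hf]].
  exists (fun n => p.[n]%R); first exact: polyb_horner.
  by move=> D x g h; have [n /hp] := run_path_to D x g => ? /(_ h) <-.
exists (p + 1)%R => D x n c h; rewrite hornerD hornerC.
case: h => [|{}n {}c c' /path_to_run[g <- ->] /halts_step h] //.
rewrite -[(_ + 1)%R]/(_ + 1)%N addn1 ltnS.
exact: leq_trans (hf _ _ _ h) (fp _).
Qed.

Lemma polytime_out D x : polytime N -> exists o, out N D x o.
Proof.
case/polytimeP => f _ hf; pose g := nseq (f (size x)).+1 (choice0 N).
case h: (halts (run D g (init N x))) => [o|].
  by exists o; apply/out_run; exists g.
by have := hf _ _ _ h; rewrite size_nseq ltnn.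
Qed.

Lemma deterministic_choice : deterministic N -> forall i j : choices N, i = j.
Proof. by move=> hN i j; apply: (fintype_le1P _); rewrite hN. Qed.

(** Choice strings over a one-element type commute under concatenation. As halted configurations
    absorb further choices, [g ++ g'] and [g' ++ g] lead to the two halting configurations, which
    are therefore equal. *)
Lemma deterministic_out D x o o' :
  deterministic N -> out N D x o -> out N D x o' -> o = o'.
Proof.
move=> hN /out_run[g hg] /out_run[g' hg'].
have nseqE h : h = nseq (size h) (choice0 N).
  apply/all_pred1P/allP => i _ /=.
  by rewrite (deterministic_choice hN i (choice0 N)).
have e : g ++ g' = g' ++ g by rewrite (nseqE g) (nseqE g') -!nseqD addnC.
have fixed c h o1 : halts c = Some o1 -> run D h c = c.
  by move=> hc; apply: run_halts; rewrite hc.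
have := run_cat D g g' (init N x).
rewrite e run_cat (fixed _ _ _ hg) (fixed _ _ _ hg') => e'.
by move: hg; rewrite -e' hg' => -[].
Qed.

End Runs.

(** * Relabelling outcomes and removing the oracle *)

Section Transform.
Variables (h : outcome -> outcome) (b : bool) (N : machine).

(** If [b] holds, each query becomes a step that leaves the tapes alone and enters the state for a
    negative answer. The result behaves as with the empty oracle, and all paths keep their
    length. *)
Definition transform : machine :=
  Machine (choice0 N) (start N) (fun q =>
    match program q with
    | Halt o => Halt (h o)
    | Query q1 q0 =>
        if b then Step (fun _ a => (q0, [ffun j => (a j, Stay)]))
        else Query q1 q0
    | Step delta => Step delta
    end).

Definition tconfig (c : config N) : config transform :=
  Config (N := transform) (cstate c) (ctapes c).

Let oracle (D : language) := if b then set0 else D.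

Lemma transform_stepf D i c :
  stepf (N := transform) D i (tconfig c) = tconfig (stepf (N := N) (oracle D) i
    c).
Proof.
rewrite /stepf /tconfig /oracle /=.
case: (program (cstate c)) => [o|q1 q0|delta] //=; case: (b) => //=.
rewrite /goto /= asboolF //; congr Config.
by apply/ffunP => j; rewrite !ffunE /=; case: (ctapes c j).
Qed.

Lemma transform_run D g x : run (N := transform) D g (init transform x) =
  tconfig (run (N := N) (oracle D) g (init N x)).
Proof.
rewrite /run -[init transform x]/(tconfig (init N x)).
elim: g (init N x) => //= i g IH c.
by rewrite transform_stepf IH.
Qed.

Lemma transform_halts c : halts (tconfig c) = omap h (halts c).
Proof.
rewrite /halts /=; case: (program _) => //=; by case: (b).
Qed.

Lemma transform_out D x o :
  out transform D x o <-> exists2 o', out N (oracle D) x o' & h o' = o.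
Proof.
rewrite out_run; split=> [[g]|[o' /out_run[g hg] <-]].
  rewrite transform_run transform_halts.
  case e: (halts _) => [o'|] // [<-].
  by exists o' => //; apply/out_run; exists g.
by exists g; rewrite transform_run transform_halts hg.
Qed.

Lemma transform_polytime : polytime N -> polytime transform.
Proof.
case/polytimeP => f fp hf; apply/polytimeP; exists f => // D x g.
rewrite transform_run transform_halts => hg; apply: (hf (oracle D)).
by case: (halts _) hg.
Qed.

Lemma transform_two_outcome : (forall o, h o <> Quest) -> two_outcome transform.
Proof.
move=> hh q /=; case: (@program N q) => [o|q1 q0|delta]; [|by case: (b)|by []].
by case=> /hh.
Qed.

Lemma transform_oracle_free : b || `[< oracle_free N >] ->
  oracle_free transform.
Proof.
move=> bN q q1 q0 /=; case e: (@program N q) => [o|q1' q0'|delta] //.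
by case: (b) bN => //= /asboolP/(_ _ _ _ e).
Qed.

End Transform.

Definition noquest (o : outcome) := if o is Acc then Acc else Rej.
Definition flip (o : outcome) := if o is Acc then Rej else Acc.

(** * Paths consistent with a list of answers *)

Section Guess.
Variable N : machine.
Implicit Types (K : seq (word * bool)) (g : seq (choices N)) (c : config N).

Definition wd c : word := word_of_tape (ctapes c ord_max).

Definition branch c (a : bool) : config N :=
  if program (cstate c) is Query q1 q0 then goto (if a then q1 else q0) c else
    c.

(* Some computation from c reaches the outcome t, makes the choices in g  *)
(* first, and gets oracle answers that contradict neither K nor each other. *)
(* Every step consumes a choice of g, and query steps ignore it.            *)
Inductive ok (t : outcome) : seq (word * bool) -> seq (choices N) -> config N ->
  Prop :=
  | ok_halt K g c : program (cstate c) = Halt t -> ok t K g c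
  | ok_step K g c delta i : program (cstate c) = Step delta -> head i g = i ->
      ok t K (behead g) (stepf set0 i c) -> ok t K g c
  | ok_query K g c q1 q0 a : program (cstate c) = Query q1 q0 ->
      (wd c, ~~ a) \notin K ->
      ok t ((wd c, a) :: K) (behead g) (branch c a) -> ok t K g c.

Lemma okE t K g c : ok t K g c <->
  match program (cstate c) with
  | Halt o => o = t
  | Step _ => exists2 i, head i g = i & ok t K (behead g) (stepf set0 i c)
  | Query _ _ => exists2 a, (wd c, ~~ a) \notin K &
      ok t ((wd c, a) :: K) (behead g) (branch c a)
  end.
Proof.
split.
  case=> {K g c} [K g c|K g c delta i|K g c q1 q0 a] -> //; first by exists i.
  by exists a.
case e: (program _) => [o|q1 q0|delta].
- by move=> eo; apply: ok_halt; rewrite e eo.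
- by case=> a aK h; apply: ok_query e aK h.
- by case=> i ig h; apply: ok_step e ig h.
Qed.

Lemma ok_eq_mem t K K' g c : K =i K' -> ok t K g c -> ok t K' g c.
Proof.
move=> KK' h; elim: h K' KK' => {K g c} [K g c|K g c delta i|K g c q1 q0 a] e.
- by move=> K' _; apply: ok_halt.
- by move=> ig _ IH K' KK'; apply: ok_step e ig (IH _ KK').
- move=> aK _ IH K' KK'; apply: ok_query e _ (IH _ _); first by rewrite -KK'.
  by move=> z; rewrite !inE KK'.
Qed.

End Guess.

(** * Loading an input and simulating nondeterministically *)

Section Load.
Variables (I S C : finType) (qry : I) (D : language) (o : outcome).
Variables (N : machine) (E : embedding N I S) (inp tmp : I).
Hypotheses (inpE : unrho E inp = None) (tmpE : unrho E tmp = None).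
Hypothesis inp_tmp : inp != tmp.
Local Notation det := (@det I S C qry D o).

(** The input goes to the scratch register and back, and is written to the simulated input tape on
    the way back. It is thus preserved, and a later round can load it again. *)
Definition load : cmd I S C :=
  Seq (xfer C inp xpredT (fun a r => if r == tmp then [:: a] else [::]) 1)
  (Seq (xfer C tmp xpredT (fun a r =>
     if r == inp then [:: a] else
     if unrho E r == Some (Some (inr ord0)) then
       [:: sy E (if a is inl b then Some (inl b) else None)] else [::]) 1)
   (start_sim C E)).

Lemma det_load s x : s inp = [seq inl b | b <- x] -> s tmp = [::] ->
  (forall m, s (rho E m) = [::]) ->
  det load s (16 * size x + 7) (ov E s (init N x)).
Proof.
move=> sinp stmp sN.
have ti : (tmp == inp) = false by rewrite eq_sym (negbTE inp_tmp).
pose s1 : regs I S := fun r => if r == inp then [::] else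
  if r == tmp then rev [seq inl b | b <- x] else s r.
pose s2 : regs I S := fun r =>
  if unrho E r == Some (Some (inr ord0)) then [seq sy E (Some (inl b)) | b <- x]
  else s r.
rewrite (_ : 16 * _ + _ = (size x * 8 + 1) + ((size x * 8 + 1) + 5));
  last by lia.
apply: (det_Seq (s2 := s1)).
  apply: (det_xfer_to [seq inl b | b <- x] [::]);
    rewrite ?cats0 ?all_predT ?size_map //.
  - by move=> a r; case: ifP.
  - by move=> a; rewrite (negbTE inp_tmp).
  - by rewrite /s1 eqxx.
  - move=> r /negbTE ri; rewrite /s1 ri; case: eqP => [->|_].
      by rewrite flatten_rev1 stmp cats0 map_id.
    by rewrite flatten_rev0.
apply: (det_Seq (s2 := s2)).
  apply: (det_xfer_to [seq inl b | b <- rev x] [::]);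
    rewrite ?cats0 ?all_predT ?size_map ?size_rev //.
  - by move=> a r; case: ifP => // _; case: ifP.
  - by move=> a; rewrite ti tmpE.
  - by rewrite /s1 ti eqxx map_rev.
  - by rewrite /s2 tmpE.
  - move=> r /negbTE rt; rewrite /s2 /s1 rt.
    have [-> {r rt}|/eqP ri] := eqVneq r inp.
      by rewrite inpE /= flatten_rev1 map_id map_rev revK cats0.
    case: eqP => [e|_]; last by rewrite flatten_rev0.
    rewrite flatten_rev1 -map_comp map_rev revK.
    by rewrite -(unrhoK e) sN cats0.
have -> : ov E s (init N x) = ov E s2 (init N x).
  by apply/funext => r; rewrite /ov /s2; case: (unrho E r).
apply: det_start_sim => m.
rewrite /s2 rhoK (inj_eq (@Some_inj _)); case: ifP => // _; exact: sN.
Qed.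

End Load.

Section Nondeterministic.
Variables (I S C : finType) (qry : I) (D : language) (o : outcome).
Variables (N : machine) (E : embedding N I S) (f : C -> choices N).
Hypotheses (fsurj : forall i, exists j, f j = i) (hN : oracle_free N).

Lemma wp_nrun (k : trans I S) s c n T (Phi : config N -> Prop) :
  (forall g, size g = n -> isSome (halts (run D g c))) ->
  (forall c', isSome (halts c') -> k (ov E s c') T (Phi c')) ->
  wp qry D o (While (live E) (Choose (fun j => simstep C E (f j)))) k (ov E s c)
    (10 * n + 1 + T)
    (exists2 g, isSome (halts (run D g c)) & Phi (run D g c)).
Proof.
move=> hn hk; elim: n c hn => [|n IH] c hn.
  have hc := hn [::] erefl.
  apply: (wp_While (U := T)); first by lia.
  rewrite live_ov hc /=.
  suff -> : (exists2 g, isSome (halts (run D g c)) & Phi (run D g c)) = Phi c.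
    exact: hk.
  apply/propext; split=> [[g _]|]; first by rewrite run_halts.
  by exists [::].
case hc: (isSome (halts c)).
  apply: (wp_While (U := T)); first by lia.
  rewrite live_ov hc /=.
  suff -> : (exists2 g, isSome (halts (run D g c)) & Phi (run D g c)) = Phi c.
    exact: hk.
  apply/propext; split=> [[g _]|]; first by rewrite run_halts.
  by exists [::].
apply: (wp_While (U := (8 + (10 * n + 1 + T)).+1)); first by lia.
rewrite live_ov hc /=.
apply: (wp_Choose (Phi := fun j => exists2 g,
   isSome (halts (run D g (stepf D (f j) c))) & Phi (run D g (stepf D (f j)
     c)))).
  move=> j; case e: (program (cstate c)) => [o'|q1 q0|delta].
  - by move: hc; rewrite /halts e.
  - by case: (hN e).
  apply: (wp_det (det_simstep _ _ _ _ _ _ _ e)).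
  by apply: IH => g gn; have := hn (f j :: g); rewrite /= gn; apply.
split=> [[[|i g] /= h p]|[j [g h p]]].
- by rewrite hc in h.
- by have [j e] := fsurj i; exists j; exists g; rewrite e.
- by exists (f j :: g).
Qed.

Definition finish (h : outcome -> outcome) : cmd I S C :=
  Case (fun t => if omap (@program N) (cur E t) is Some (Halt o') then Stop I S
    C (h o')
                 else Stop I S C Quest).

Lemma wp_finish h (k : trans I S) s c T : isSome (halts c) ->
  wp qry D o (finish h) k (ov E s c) T.+1 (omap h (halts c) = Some o).
Proof.
rewrite /halts => hc; apply: wp_Case; rewrite cur_ov /=.
case: (program _) hc => //= o' _.
have -> : (Some (h o') = Some o) = (h o' = o).
  by apply/propext; split=> [[]|->].
exact: wp_Stop.
Qed.

End Nondeterministic.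

Arguments wp_nrun {I S C qry D o N E f} _ _ {k s c n T} Phi.

(** * When the reducibilities coincide *)

Lemma stepf_oracle_free N D i (c : config N) : oracle_free N ->
  stepf D i c = stepf set0 i c.
Proof.
move=> hN; rewrite /stepf; case e: (program _) => [|q1 q0|] //.
by case: (hN _ _ _ e).
Qed.

Lemma out_oracle_free N D x : oracle_free N -> out N D x = out N set0 x.
Proof.
move=> hN; have e g c : run D g c = run set0 g c :> config N.
  by elim: g c => //= i g IH c; rewrite IH (stepf_oracle_free D).
apply/seteqP; split=> o /out_run[g hg]; apply/out_run; exists g.
  by rewrite -e.
by rewrite e.
Qed.

(** A deterministic machine has exactly one outcome, so exchanging acceptance and rejection decides
    the complement. *)
Lemma classP_sub : classP `<=` classNP `&` class_coNP.
Proof.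
move=> A [M [pM tM oM dM ->]]; split; first by exists M.
exists (transform flip false M); split.
- exact: transform_polytime.
- by apply: transform_two_outcome; case.
- by apply: transform_oracle_free; apply/asboolP.
apply/seteqP; split=> x /=; rewrite /lang /=.
  move=> nx; apply/transform_out => /=; have [o ho] := polytime_out set0 x pM.
  by exists o => //; case: o ho => // ho; case: nx.
case/transform_out => o' /= ho e hA.
by move: e; rewrite (deterministic_out dM ho hA).
Qed.

Section Both.
Variables N1 N2 : machine.
Hypotheses (o1 : oracle_free N1) (o2 : oracle_free N2).

Definition both_reg : finType := (mreg N1 + mreg N2 + option bool)%type.
Definition both_sym : finType :=
  ((state N1 + option (bool + aux N1)) + (state N2 + option (bool + aux
    N2)))%type.
(** A stack program draws all its guesses from one type; the last component selects the machine to
    run. *)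
Definition both_choices : finType := (choices N1 * choices N2 * bool)%type.

Definition emb1 : embedding N1 both_reg both_sym.
Proof.
refine (@Embedding N1 both_reg both_sym
  (fun m => inl (inl m)) (fun r => if r is inl (inl m) then Some m else None)
  (fun q => inr (inl (inl q)))
  (fun a => if a is inr (inl (inl q)) then Some q else None)
  (fun a => inr (inl (inr a)))
  (fun a => if a is inr (inl (inr a)) then a else None) _ _ _ _) => //.
by move=> [[m'|]|] m // [->].
Defined.

Definition emb2 : embedding N2 both_reg both_sym.
Proof.
refine (@Embedding N2 both_reg both_sym
  (fun m => inl (inr m)) (fun r => if r is inl (inr m) then Some m else None)
  (fun q => inr (inr (inl q)))
  (fun a => if a is inr (inr (inl q)) then Some q else None)
  (fun a => inr (inr (inr a)))
  (fun a => if a is inr (inr (inr a)) then a else None) _ _ _ _) => //.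
by move=> [[|m']|] m // [->].
Defined.

Definition report_acc (o : outcome) := if o is Acc then Acc else Quest.
Definition report_rej (o : outcome) := if o is Acc then Rej else Quest.

Definition run_and_report (N : machine) (E : embedding N both_reg both_sym)
    (f : both_choices -> choices N) h : cmd both_reg both_sym both_choices :=
  Seq (load both_choices E (inr None) (inr (Some false)))
  (Seq (While (live E) (Choose (fun j => simstep both_choices E (f j))))
       (finish both_choices E h)).

Lemma wp_run_and_report (N : machine) (E : embedding N both_reg both_sym)
    (f : both_choices -> choices N) h D o k p x :
  oracle_free N -> (forall i, exists j, f j = i) ->
  unrho E (inr None) = None -> unrho E (inr (Some false)) = None ->
  (forall g, size g = p -> isSome (halts (run D g (init N x)))) ->
  wp (inr (Some true)) D o (run_and_report E f h) k
    (init_regs both_sym (inr None) x)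
    (16 * size x + 7 + (10 * p + 1 + 1))
    (exists2 o', out N D x o' & h o' = o).
Proof.
move=> hN hf u1 u2 hp; apply/wp_Seq/(wp_det (s' := ov E (init_regs both_sym (inr
  None) x) (init N x))).
  apply: det_load => // m; rewrite /init_regs; case: eqP => // e.
  by have := rhoK E m; rewrite e u1.
apply/wp_Seq.
have -> : (exists2 o', out N D x o' & h o' = o) =
    (exists2 g, isSome (halts (run D g (init N x))) &
       omap h (halts (run D g (init N x))) = Some o).
  apply/propext; split=> [[o' /out_run[g hg] ho']|[g]].
    by exists g; rewrite hg //= ho'.
  case hg: (halts _) => [o'|] //= _ [ho'].
  by exists o' => //; apply/out_run; exists g.
apply: (wp_nrun hf hN (fun c => omap h (halts c) = Some o)) => // c' hc'.
exact: wp_finish.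
Qed.

Definition both : cmd both_reg both_sym both_choices :=
  Choose (fun j => if j.2 then run_and_report emb1 (fun j => j.1.1) report_acc
                   else run_and_report emb2 (fun j => j.1.2) report_rej).

Lemma both_machine : polytime N1 -> polytime N2 -> exists N : machine,
  polytime N /\ forall D x o, out N D x o <->
    (exists2 o', out N1 set0 x o' & report_acc o' = o) \/
    (exists2 o', out N2 set0 x o' & report_rej o' = o).
Proof.
case/polytimeP=> f1 fp1 hf1 /polytimeP[f2 fp2 hf2].
have [||N _ hN] := @compile both_reg both_sym both_choices (inr None) (inr (Some
  true)) _ both.
- exact: (choice0 N1, choice0 N2, true).
- by [].
pose T n := (16 * n + 7 + (10 * (f1 n + f2 n).+1 + 1 + 1)).+1.
have key D x o : (forall n (d : config N), path_to D x n d -> n <= T (size x))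
  /\
    (out N D x o <-> (exists2 o', out N1 set0 x o' & report_acc o' = o) \/
      (exists2 o', out N2 set0 x o' & report_rej o' = o)).
  apply: hN; rewrite -(out_oracle_free D x o1) -(out_oracle_free D x o2).
  apply: (wp_Choose (Phi := fun j : both_choices =>
      if j.2 then exists2 o', out N1 D x o' & report_acc o' = o
      else exists2 o', out N2 D x o' & report_rej o' = o)).
    have fn (N0 : machine) (f : nat -> nat) p :
        (forall D x (g : seq (choices N0)),
           halts (run D g (init N0 x)) = None -> size g <= f (size x)) ->
        f (size x) < p ->
        forall g, size g = p -> isSome (halts (run D g (init N0 x))).
      move=> hf fp g gp; case e: (halts _) => //.
      by have := hf _ _ _ e; rewrite leqNgt gp fp.
    case=> [[i1 i2] []] /=; apply: wp_run_and_report => //.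
    - by move=> i; exists (i, i2, true).
    - by apply: fn hf1 _; lia.
    - by move=> i; exists (i1, i, true).
    - by apply: fn hf2 _; lia.
  split=> [[h|h]|[[[i1 i2] [] h]]]; [| |by left|by right].
  - by exists (choice0 N1, choice0 N2, true).
  - by exists (choice0 N1, choice0 N2, false).
exists N; split.
  have [p hp] : polyb T.
    apply: (polyb_le (g := fun n => 16 * n + (10 * (f1 n + f2 n) + 20))).
      by move=> n; rewrite /T; lia.
    apply: polyb_add; first by apply: polyb_mul polyb_id; apply: polyb_const.
    apply: polyb_add; last exact: polyb_const.
    by apply: polyb_mul; [apply: polyb_const|apply: polyb_add].
  exists p => D x n c hc; apply: leq_trans (hp _).
  exact: (proj1 (key D x Acc)) hc.
by move=> D x o; case: (key D x o).
Qed.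

End Both.

(** [accE] and [rejE] say that, under every oracle, the combined machine can accept iff x is in A
    and can reject iff it is not. Always one of the two happens and never both, which is
    robustness. *)
Theorem RS_eq_T_P_eq : le_RS = le_pT -> classP = classNP `&` class_coNP.
Proof.
move=> RT; apply/seteqP; split=> [|A]; first exact: classP_sub.
case=> -[N1 [p1 t1 o1 ->]] [N2 [p2 t2 o2 e2]].
have [N [pN outN]] := both_machine o1 o2 p1 p2.
have accE D x : out N D x Acc <-> out N1 set0 x Acc.
  rewrite outN; split=> [[[[] // h _]|[[] // _ []]]|h] //.
  by left; exists Acc.
have rejE D x : out N D x Rej <-> ~ out N1 set0 x Acc.
  have -> : (~ out N1 set0 x Acc) = out N2 set0 x Acc.
    exact: (congr1 (fun L : language => L x) e2).
  rewrite outN; split=> [[[[] // _ []]|[[] // h _]]|h] //.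
  by right; exists Acc.
have : (lang N1 set0, set0) \in le_RS.
  rewrite inE; exists N; split=> //=.
  - move=> D x e; have [h|h] := pselect (out N1 set0 x Acc).
      by have := proj2 (accE D x) h; rewrite e.
    by have := proj2 (rejE D x) h; rewrite e.
  - move=> D x h; apply: (proj1 (rejE D x)); first by apply: h; right.
    by apply/accE; apply: h; left.
  - by apply/seteqP; split=> x h; apply/(accE set0).
rewrite RT inE => -[M [pM tM dM /= ->]].
(* The reduction to the empty set still makes queries; answering all of them negatively turns it
   into an ordinary machine. *)
exists (transform noquest true M); split=> //.
- exact: transform_polytime.
- by apply: transform_two_outcome; case.
- exact: transform_oracle_free.
apply/seteqP; split=> x.
  by move=> h; apply/transform_out; exists Acc.
by case/transform_out => -[].
Qed.

(** * Deciding whether a guess can be completed *)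

Section Codes.
Variable Y : finType.

(** A unary index closed by [false]: the code is prefix-free, so concatenated codes can be read
    back. *)
Definition code_in (ys : seq Y) (y : Y) : word :=
  rcons (nseq (index y ys) true) false.

Definition codes (ys : seq Y) : word := flatten [seq code_in (enum Y) y | y <-
  ys].

End Codes.

Section Decode.
Variables (I S C Y : finType) (qry : I) (D : language) (o : outcome).
Variables (inp : I) (push : Y -> I -> seq (bool + S)).
Hypothesis push1 : forall y r, size (push y r) <= 1.
Local Notation det := (@det I S C qry D o).

Definition emit_sym (y : Y) : cmd I S C := Ops C (fun r =>
  if r == inp then Pop else if push y r is a :: _ then Push a else Keep).

Fixpoint decode1 (ys : seq Y) : cmd I S C :=
  if ys is y :: ys' then
    Case (fun t =>
      match t inp with
      | None => Skip I S C
      | Some (inl true) =>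
          Seq (Ops C (fun r => if r == inp then Pop else Keep)) (decode1 ys')
      | Some _ => emit_sym y
      end)
  else Skip I S C.

Definition opush (oy : option Y) r := if oy is Some y then push y r else [::].

Definition with_inp (s : regs I S) (w : word) (ext : I -> seq (bool + S)) :
    regs I S :=
  fun r => if r == inp then [seq inl b | b <- w] else ext r ++ s r.

Lemma det_decode1 ys (w : word) s : s inp = [seq inl b | b <- w] ->
  exists oy (w' : word), [/\ size w' + isSome oy <= size w,
    0 < size ys -> 0 < size w -> size w' < size w,
    det (decode1 ys) s (3 * size ys + 3) (with_inp s w' (opush oy)) &
    forall y (w'' : word), y \in ys -> w = code_in ys y ++ w'' -> oy = Some y /\
      w' = w''].
Proof.
have same w0 : s inp = [seq inl b | b <- w0] -> with_inp s w0 (opush None) = s.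
  by move=> e; apply/funext => r; rewrite /with_inp; case: eqP => // ->.
elim: ys w s same => [|y ys IH] w s same sw.
  exists None, w; split=> //; first by rewrite addn0.
  rewrite same //; apply: (@det_le _ _ _ _ _ _ _ _ 2) => //; exact: det_Skip.
case: w sw => [|[] w] sw.
- exists None, [::]; split=> //.
    rewrite same //; apply: (@det_le _ _ _ _ _ _ _ _ 3); first by lia.
    apply: det_Case; rewrite ffunE sw; exact: det_Skip.
  by move=> y' w'' _; rewrite /code_in; case: (index _ _).
- pose s1 : regs I S := fun r => if r == inp then behead (s r) else s r.
  have same1 w0 : s1 inp = [seq inl b | b <- w0] -> with_inp s1 w0 (opush None)
    = s1.
    by move=> e; apply/funext => r; rewrite /with_inp; case: eqP => // ->.
  have sw1 : s1 inp = [seq inl b | b <- w] by rewrite /s1 eqxx sw.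
  have [oy [w' [le _ dd hy]]] := IH w s1 same1 sw1.
  exists oy, w'; split=> /=; [by lia|by lia| |].
    rewrite (_ : 3 * _ + 3 = (2 + (3 * size ys + 3)).+1); last by lia.
    apply: det_Case; rewrite ffunE sw /=.
    have -> : with_inp s w' (opush oy) = with_inp s1 w' (opush oy).
      by apply/funext => r; rewrite /with_inp /s1; case: ifP.
    apply: det_Seq dd.
    have -> : s1 = fun r => stack_app (if r == inp then Pop else Keep) (s r).
      by apply/funext => r; rewrite /s1; case: ifP.
    exact: det_Ops.
  move=> y' w''; rewrite inE /code_in /=; case: eqP => [->|/eqP yy] //=.
    by rewrite eqxx.
  by rewrite eq_sym (negbTE yy) /= => y'ys [e]; apply: hy.
- exists (Some y), w; split=> /=; [by lia|by lia| |].
    apply: (@det_le _ _ _ _ _ _ _ _ 3); first by lia.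
    apply: det_Case; rewrite ffunE sw /=.
    have -> : with_inp s w (opush (Some y)) = fun r => stack_app
      (if r == inp then Pop else if push y r is a :: _ then Push a else Keep) (s
        r).
      apply/funext => r; rewrite /with_inp /=; case: eqP => [->|_];
        first by rewrite sw.
      by have := push1 y r; case: (push y r) => [|a []].
    exact: det_Ops.
  move=> y' w''; rewrite inE /code_in /= [y == y']eq_sym;
    case: eqP => [->|_] //=.
  by move=> _ [->].
Qed.

Definition decode : cmd I S C :=
  While (fun t => isSome (t inp)) (decode1 (enum Y)).

(** The guesser must be fast on all inputs, so the decoder also has to stop on words that are not
    codes; there it yields some list no longer than the word. *)
Lemma det_decode (w : word) s : 0 < size (enum Y) -> s inp = [seq inl b | b <-
  w] ->
  exists ys, [/\ size ys <= size w,
    det decode s ((3 * size (enum Y) + 4) * size w + 1)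
      (with_inp s [::] (fun r => flatten (rev [seq push y r | y <- ys]))) &
    forall ys', w = codes ys' -> ys = ys'].
Proof.
move=> Y0; move: {2}(size w) (leqnn (size w)) => n.
elim: n w s => [|n IH] w s wn sw.
  move: wn sw; case: w => // _ sw; exists [::]; split=> //.
    have -> : with_inp s [::] (fun r => flatten (rev [seq push y r | y <-
      [::]])) = s.
      by apply/funext => r; rewrite /with_inp; case: eqP => [->|].
    apply: (@det_le _ _ _ _ _ _ _ _ 1); first by lia.
    by apply: det_WhileF; rewrite ffunE sw.
  by case=> //= y ys; rewrite /codes /= /code_in; case: (index _ _).
case: w wn sw => [|b w] wn sw.
  by apply: IH.
have [oy [w' [le lt dd hy]]] := det_decode1 (enum Y) sw.
have {}lt : size w' < (size w).+1 by apply: lt.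
have w'n : size w' <= n by rewrite -ltnS (leq_trans lt).
set s1 := with_inp s w' (opush oy) in dd.
have sw1 : s1 inp = [seq inl b | b <- w'] by rewrite /s1 /with_inp eqxx.
have [ys [yw dd' hys]] := IH w' s1 w'n sw1.
exists (seq_of_opt oy ++ ys); split.
- rewrite size_cat; case: oy le {dd hy s1 sw1 dd'} => [y|] /= le.
    by rewrite add1n ltnS (leq_trans yw) // -ltnS -addn1.
  by rewrite (leq_trans yw) // ltnW.
- apply: (@det_le _ _ _ _ _ _ _ _
    ((3 * size (enum Y) + 3) + ((3 * size (enum Y) + 4) * size w' + 1)).+1).
    apply: (@leq_trans ((3 * size (enum Y) + 4) * (size w').+1 + 1)).
      by rewrite mulnS; lia.
    by rewrite leq_add2r leq_mul2l lt orbT.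
  apply: det_WhileT dd _; first by rewrite ffunE sw.
  suff <- : with_inp s1 [::] (fun r => flatten (rev [seq push y r | y <- ys])) =
    with_inp s [::] (fun r => flatten (rev [seq push y r | y <- seq_of_opt oy ++
      ys])) by [].
  apply/funext => r; rewrite /with_inp /s1 /with_inp; case: eqP => // _.
  rewrite map_cat rev_cat flatten_cat -catA; congr (_ ++ _).
  by case: oy {le hy s1 sw1 dd'} => [y|] //=; rewrite cats0.
- case=> [|y ys'] //; rewrite /codes /= => e.
  have [//|-> ew] := hy y _ _ e; first by rewrite mem_enum.
  by rewrite /= (hys ys') // ew.
Qed.

End Decode.

Definition is_bit S (a : symbol S) := if a is Some (inl _) then true else false.
Definition bit_of S (a : symbol S) := if a is Some (inl b) then b else false.

Lemma leading_bits_split S (l : seq (symbol S)) : exists l',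
  l = [seq Some (inl b) | b <- leading_bits l] ++ l' /\
  (if l' is a :: _ then ~~ is_bit a else true).
Proof.
elim: l => [|a l [l' [e h]]]; first by exists [::].
case: a => [[b|z]|].
- by exists l'; rewrite /= -e.
- by exists (Some (inr z) :: l).
- by exists (None :: l).
Qed.

Section CopyWord.
Variables (I S C : finType) (qry : I) (D : language) (o : outcome).
Variables (N : machine) (E : embedding N I S) (tmp : I).
Variables f1 f2 : bool -> I -> seq (bool + S).
Hypothesis tmpE : unrho E tmp = None.
Hypotheses (f1E : forall b r, unrho E r -> f1 b r = [::]).
Hypotheses (f2E : forall b r, unrho E r -> f2 b r = [::]).
Hypotheses (f1t : forall b, f1 b tmp = [::]) (f2t : forall b, f2 b tmp = [::]).
Hypotheses (f1s : forall b r, size (f1 b r) <= 1) (f2s : forall b r,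
  size (f2 b r) <= 1).
Local Notation det := (@det I S C qry D o).
Local Notation src := (rho E (Some (inr ord_max))).

(** The query word moves to the scratch register and back. [f1] acts on the way out and gives a
    reversed copy, [f2] acts on the way back and gives a copy in the original order. *)
Definition copy_word : cmd I S C :=
  Seq (xfer C src (fun a => is_bit (unsy E a))
         (fun a r => if r == tmp then [:: a] else f1 (bit_of (unsy E a)) r) 1)
      (xfer C tmp xpredT
         (fun a r => if r == src then [:: a] else f2 (bit_of (unsy E a)) r) 1).

Lemma det_copy_word s s' c : s tmp = [::] -> s' tmp = [::] ->
  (forall r, unrho E r = None -> r != tmp ->
     s' r = flatten [seq f2 b r | b <- wd c] ++
            flatten (rev [seq f1 b r | b <- wd c]) ++ s r) ->
  det copy_word (ov E s c) (16 * size (wd c) + 2) (ov E s' c).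
Proof.
move=> st s't s'E.
have src_tmp : (src == tmp) = false.
  by apply/negP => /eqP e; have := rhoK E (Some (inr ord_max)); rewrite e tmpE.
pose q : mreg N := Some (inr ord_max).
pose w := [seq sy E (Some (inl b)) | b <- wd c].
have [l [el hl]] := leading_bits_split
   (scanned (ctapes c ord_max) :: right_cells (ctapes c ord_max)).
rewrite -/(wd c) in el.
have src_c : content E c q = w ++ [seq sy E a | a <- l].
  rewrite -[LHS]/(map (sy E) (scanned (ctapes c ord_max) :: right_cells (ctapes
    c ord_max))).
  by rewrite el map_cat -map_comp.
pose s1 : regs I S := fun r => if unrho E r is Some m then
    if m == q then [seq sy E a | a <- l] else content E c m
  else if r == tmp then rev w else flatten (rev [seq f1 b r | b <- wd c]) ++ s
    r.
rewrite (_ : 16 * _ + 2 = (size (wd c) * 8 + 1) + (size (wd c) * 8 + 1));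
  last by lia.
have fbits (f : bool -> I -> seq (bool + S)) r v :
    [seq f (bit_of (unsy E a)) r | a <- [seq sy E (Some (inl b)) | b <- v]] =
    [seq f b r | b <- v].
  by rewrite -map_comp; apply: eq_map => b /=; rewrite syK.
apply: (det_Seq (s2 := s1)).
  apply: (det_xfer_to w [seq sy E a | a <- l]); rewrite ?size_map //.
  - by move=> a r; case: ifP.
  - by move=> a; rewrite src_tmp f1E // rhoK.
  - by rewrite /ov rhoK src_c.
  - by apply/allP => a /mapP[b _ ->]; rewrite syK.
  - by case: l hl {el src_c s1} => //= a l; rewrite syK.
  - by rewrite /s1 rhoK eqxx.
  move=> r rs; rewrite /s1 /ov; case e: (unrho E r) => [m|].
    have -> : (m == q) = false.
      by apply/negP => /eqP em; move: rs; rewrite -(unrhoK e) em eqxx.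
    have -> : (r == tmp) = false.
      by apply/negP => /eqP et; move: e; rewrite et tmpE.
    by rewrite fbits (eq_map (g := fun=> [::])) ?flatten_rev0 // => b;
      rewrite f1E ?e.
  case: eqP => [->|_]; last by rewrite fbits.
  by rewrite st flatten_rev1 map_id cats0.
apply: (det_xfer_to (rev w) [::]); rewrite ?size_rev ?size_map ?cats0 ?all_predT
  //.
- by move=> a r; case: ifP.
- by move=> a; rewrite eq_sym src_tmp f2t.
- by rewrite /s1 tmpE eqxx.
- by rewrite /ov tmpE.
move=> r rt; rewrite /s1 /ov; case e: (unrho E r) => [m|].
  have er := unrhoK e; have [em|em] := eqVneq m q.
    by rewrite -er em eqxx flatten_rev1 map_id revK src_c.
  have -> : (r == src) = false.
    apply/negP => /eqP ers; have := rhoK E q; rewrite -ers e => -[] /eqP.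
    by rewrite (negbTE em).
  rewrite -map_rev revK fbits (eq_map (g := fun=> [::])) => [|b];
    last by rewrite f2E ?e.
  by rewrite -[[seq [::] | _ <- _]]revK -map_rev flatten_rev0.
have -> : (r == src) = false.
  by apply/negP => /eqP ers; have := rhoK E q; rewrite -ers e.
by rewrite (negbTE rt) -map_rev revK fbits s'E.
Qed.

End CopyWord.

(** * Recorded answers, and replaying a recorded run *)

Section Parse.
Implicit Types (w u q : word) (ks : seq (bool + bool)).

(** [inl] marks a bit of a query and [inr] its answer, which also ends the entry; [w] collects the
    bits of the entry being read. *)
Fixpoint kparse w ks : seq (word * bool) :=
  match ks with
  | [::] => [::]
  | inl b :: ks => kparse (rcons w b) ks
  | inr a :: ks => (w, a) :: kparse [::] ks
  end.

Definition entry_syms (e : word * bool) : seq (bool + bool) :=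
  rcons [seq inl b | b <- e.1] (inr e.2).

Lemma kparse_entry w e ks :
  kparse w (entry_syms e ++ ks) = (w ++ e.1, e.2) :: kparse [::] ks.
Proof.
case: e => q a /=; rewrite /entry_syms /= cat_rcons.
by elim: q w => [|b q IH] w /=; rewrite ?cats0 // IH cat_rcons.
Qed.

Lemma kparse_entries es : kparse [::] (flatten [seq entry_syms e | e <- es]) =
  es.
Proof. by elim: es => //= -[q a] es IH; rewrite kparse_entry IH. Qed.

End Parse.

Section Traced.
Variables (N : machine) (x : word).
Implicit Types (D : language) (K : seq (word * bool)) (g : seq (choices N)).
Implicit Types (c : config N).

Lemma stepf_Step D D' i c delta :
  program (cstate c) = Step delta -> stepf D i c = stepf D' i c.
Proof. by rewrite /stepf => ->. Qed.

Lemma stepf_Query D i c q1 q0 : program (cstate c) = Query q1 q0 ->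
  stepf D i c = branch c `[< D (wd c) >].
Proof. by rewrite /stepf /branch => ->. Qed.

(* The run of N^D(x) along g leads to c without halting before, and K      *)
(* contains all its queries together with their answers.                   *)
Inductive traced D K : seq (choices N) -> config N -> Prop :=
  | traced_nil : traced D K [::] (init N x)
  | traced_Step g c i delta : traced D K g c -> program (cstate c) = Step delta
    ->
      traced D K (rcons g i) (stepf set0 i c)
  | traced_Query g c i q1 q0 a : traced D K g c ->
      program (cstate c) = Query q1 q0 -> a = `[< D (wd c) >] ->
      (wd c, a) \in K -> traced D K (rcons g i) (branch c a).

Lemma traced_run D K g c : traced D K g c -> c = run D g (init N x).
Proof.
elim=> {g c} [|g c i delta _ -> e|g c i q1 q0 a _ -> e -> _] //.
- by rewrite run_rcons (stepf_Step D set0 _ e).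
- by rewrite run_rcons (stepf_Query _ _ e).
Qed.

Lemma traced_mono D K K' g c :
  {subset K <= K'} -> traced D K g c -> traced D K' g c.
Proof.
move=> KK'; elim=> {g c} [|g c i delta _ h e|g c i q1 q0 a _ h e ha aK].
- exact: traced_nil.
- exact: traced_Step h e.
- exact: traced_Query h e ha (KK' _ aK).
Qed.

Lemma traced_oracle D D' K g c :
  (forall q, (q, `[< D q >]) \in K -> `[< D' q >] = `[< D q >]) ->
  traced D K g c -> traced D' K g c.
Proof.
move=> DD'; elim=> {g c} [|g c i delta _ h e|g c i q1 q0 a _ h e ha aK].
- exact: traced_nil.
- exact: traced_Step h e.
- by apply: (traced_Query _ h e _ aK); rewrite DD' -?ha.
Qed.

Definition answer D (q : word) (a : bool) : language :=
  [set z | if z == q then is_true a else D z].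

Lemma answerE D q a z :
  `[< answer D q a z >] = if z == q then a else `[< D z >].
Proof.
by rewrite /answer /=; case: (z == q); rewrite ?asboolb.
Qed.

(** An assumed answer can be built into the oracle. If the earlier run asked the same query, K
    contains it with the answer received, which must be [a] because the opposite one is not in K.
    Thus a consistent path is a real path of N under some oracle, and obeys its time bound. *)
Lemma traced_answer D K g c q1 q0 i a : traced D K g c ->
  program (cstate c) = Query q1 q0 -> (wd c, ~~ a) \notin K ->
  traced (answer D (wd c) a) ((wd c, a) :: K) (rcons g i) (branch c a).
Proof.
move=> h e na; apply: traced_Query e _ _; last by rewrite mem_head.
  apply: (traced_mono (K := K)); first by move=> z zK; rewrite inE zK orbT.
  apply: traced_oracle h => q qK; rewrite answerE; case: eqP => // eq.
  move: na qK; rewrite eq; case: `[< _ >]; case: (a) => //=; by move/negP.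
by rewrite answerE eqxx.
Qed.

(** A step adds at most one cell to each stack; the final 1 accounts for the cell scanned on an
    empty tape. *)
Lemma size_content D g m (I S : finType) (E : embedding N I S) :
  size (content E (run D g (init N x)) m) <= size x + size g + 1.
Proof.
elim/last_ind: g m => [|g i IH] m.
  rewrite addn0; case: m => [[j|j]|] /=; last by rewrite addn1.
    by rewrite !ffunE; case: ifP => // _; case: (x).
  rewrite !ffunE size_map; case: ifP => // _; rewrite ?addn1 //.
  by case: (x) => //= b l; rewrite size_map.
rewrite run_rcons size_rcons; set c := run _ _ _ in IH *.
have {}IH m' : size (content E c m') < size x + (size g).+1 + 1.
  by apply: leq_ltn_trans (IH m') _; rewrite ltn_add2r ltn_add2l.
rewrite /stepf; case e: (program _) => [o|q1 q0|delta].
- exact: ltnW.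
- apply: leq_trans (ltnW (IH m)); by case: m.
- case: m => [[j|j]|] /=; last by lia.
    rewrite !ffunE !size_map; have := IH (Some (inl j)); rewrite /= size_map.
    by case: ((delta _ _).2 j).2 => /=; rewrite ?size_behead; lia.
  rewrite !ffunE size_map; have := IH (Some (inr j)); rewrite /= size_map.
  by case: ((delta _ _).2 j).2 => /=; rewrite ?size_behead; lia.
Qed.

Lemma size_wd D g :
  size (wd (run D g (init N x))) <= size x + size g + 1.
Proof.
set c := run _ _ _.
have le S (l : seq (symbol S)) : size (leading_bits l) <= size l.
  by elim: l => //= -[[b|]|] l IH /=.
(* An embedding chosen only to make [size_content] applicable. *)
have E : embedding N (mreg N) (state N + option (bool + aux N))%type.
  refine (@Embedding N (mreg N) _ id Some
    (fun q => inr (inl q)) (fun a => if a is inr (inl q) then Some q else None)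
    (fun a => inr (inr a)) (fun a => if a is inr (inr a) then a else None)
    _ _ _ _) => //.
  by move=> r m [->].
apply: leq_trans (le _ _) _.
by have := size_content D g (Some (inr ord_max)) E; rewrite /= size_map.
Qed.

(** When the choices of a traced run are prescribed and its answers are in [K2], a consistent path
    from the start is forced through [c]: the opposite answers are forbidden. With [ok_unreplay],
    questions about [c] become questions about the initial configuration, so the decider needs only
    the input, the choices and the answers. *)
Lemma ok_replay D K K2 g g2 c t : traced D K g c -> {subset K <= K2} ->
  ok t K2 (g ++ g2) (init N x) -> ok t K2 g2 c.
Proof.
move=> h KK2; elim: h g2 => {g c} [|g c i delta _ IH e|g c i q1 q0 a _ IH e ha
  aK] g2 //.
- by rewrite cat_rcons => /IH; rewrite okE e => -[i0 <-].
- rewrite cat_rcons => /IH; rewrite okE e => -[a' na' h].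
  have aa : a' = a.
    apply: contraNeq na' => ne.
    have -> : ~~ a' = a by move: ne; case: (a'); case: (a).
    exact: KK2.
  subst a'; apply: ok_eq_mem h => z; rewrite inE; case: eqP => // ->.
  by rewrite (KK2 _ aK).
Qed.

(** The replay asks the recorded queries again; the hypothesis on [K2] ensures that the recorded
    answers are then still admissible. *)
Lemma ok_unreplay D K K2 g g2 c t : traced D K g c -> {subset K <= K2} ->
  (forall q, (q, `[< D q >]) \in K -> (q, ~~ `[< D q >]) \notin K2) ->
  ok t K2 g2 c -> ok t K2 (g ++ g2) (init N x).
Proof.
move=> h KK2 con; elim: h g2 => {g c} [|g c i delta _ IH e|g c i q1 q0 a _ IH e
  ha aK] g2 h //.
- by rewrite cat_rcons; apply: IH; rewrite okE e; exists i.
- rewrite cat_rcons; apply: IH; rewrite okE e.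
  exists a; first by rewrite ha con // -ha.
  apply: ok_eq_mem h => z; rewrite inE; case: eqP => // ->.
  by rewrite (KK2 _ aK).
Qed.

Definition real D K := forall q a, (q, a) \in K -> a = `[< D q >].

Lemma real_answer D K q a :
  real D K -> (q, ~~ a) \notin K -> real (answer D q a) (rcons K (q, a)).
Proof.
move=> h na z b; rewrite mem_rcons inE answerE => /orP[/eqP[-> ->]|zK].
  by rewrite eqxx.
case: eqP => [e|_]; last exact: h.
subst z; move: na zK; case: b; case: (a) => //= na zK; by rewrite zK in na.
Qed.

(** The answers along a real path contradict neither each other nor any other true answers. A
    negative test on true answers therefore excludes the target as an outcome. *)
Lemma ok_real D K g c t : real D K -> halts (run D g c) = Some t ->
  ok t K [::] c.
Proof.
elim: g c K => [|i g IH] c K hK /=.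
  rewrite /halts => h; apply: ok_halt.
  by case: (program _) h => // o [->].
case e: (program (cstate c)) => [o|q1 q0|delta] h.
- apply: (IH _ _ hK); move: h; rewrite stepf_halts // /halts ?e //.
- apply: (ok_query (a := `[< D (wd c) >]) e).
    by apply/negP => /hK; case: `[< _ >].
  rewrite (stepf_Query _ _ e) in h; apply: IH h.
  by move=> z b; rewrite inE => /orP[/eqP[-> ->]|/hK].
- apply: (ok_step (i := i) e) => //.
  rewrite -(stepf_Step D set0 _ e); exact: IH hK h.
Qed.

End Traced.

Lemma prefix_rcons_cat (T : eqType) (v u : seq T) b :
  prefix (rcons v b) (v ++ u) = (ohead u == Some b).
Proof.
elim: v => [|a v IH] /=; last by rewrite eqxx IH.
by case: u => //= a u; rewrite prefix0s andbT (inj_eq (@Some_inj _)) eq_sym.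
Qed.

(** * The nondeterministic machine that guesses a consistent path *)

Definition name : finType := (bool * bool * bool * bool)%type.
(* gK: known queries, the bits of each followed by its answer; gL: the part *)
(* of gK that has been scanned; gQ, gP: the rest and the scanned part of    *)
(* the current query; gM: nonempty after a mismatch; gG: prescribed         *)
(* choices; gT: target.                                                     *)
Local Notation gInp := (inr (false, false, false, false)).
Local Notation gQry := (inr (false, false, false, true)).
Local Notation gTmp := (inr (false, false, true, false)).
Local Notation gX := (inr (false, false, true, true)).
Local Notation gK := (inr (false, true, false, false)).
Local Notation gL := (inr (false, true, false, true)).
Local Notation gQ := (inr (false, true, true, false)).
Local Notation gP := (inr (false, true, true, true)).
Local Notation gM := (inr (true, false, false, false)).
Local Notation gG := (inr (true, false, false, true)).
Local Notation gT := (inr (true, false, true, false)).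

Section Guesser.
Variable N : machine.

Definition gsym : finType :=
  (state N + option (bool + aux N) + (bool + choices N))%type.
Definition greg : finType := (mreg N + name)%type.
Definition gchoice : finType := (choices N * bool)%type.

Definition gemb : embedding N greg gsym.
Proof.
refine (@Embedding N greg gsym
  (fun m => inl m) (fun r => if r is inl m then Some m else None)
  (fun q => inr (inl (inl q)))
  (fun a => if a is inr (inl (inl q)) then Some q else None)
  (fun a => inr (inl (inr a)))
  (fun a => if a is inr (inl (inr a)) then a else None) _ _ _ _) => //.
by move=> [m'|] m // [->].
Defined.

Local Notation cell := (bool + gsym)%type.

Definition gst (x k l q p m g t tmp : seq cell) : regs greg gsym :=
  fun r => match r with
  | gTmp => tmp | gX => x | gK => k | gL => l | gQ => q | gP => p | gM => m
  | gG => g | gT => t | _ => [::]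
  end.

Definition kc (z : bool + bool) : cell :=
  match z with inl b => inl b | inr a => inr (inr (inl a)) end.

Variables (D : language) (o : outcome).
Local Notation det := (@det greg gsym gchoice gQry D o).
Local Notation wp := (@wp greg gsym gchoice gQry D o).
Local Notation cmd := (@cmd greg gsym gchoice).
Local Notation Ops := (@Ops greg gsym gchoice).

(** At the answer that ends an entry, the query of the entry is the current one iff there was no
    mismatch and [gQ] is used up; only then does a different answer refute the guess. Otherwise the
    scanned part in [gP] is returned to [gQ] for the next entry. *)
Definition scan1 (a : bool) : cmd := Case (fun t =>
    match t gK with
    | Some (inl b) =>
        if ~~ isSome (t gM) && (t gQ == Some (inl b)) then
          Ops (fun r => match r with
            | gK => Pop | gL => Push (inl b) | gQ => Pop | gP => Push (inl b)
            | _ => Keep end)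
        else
          Ops (fun r => match r with
            | gK => Pop | gL => Push (inl b) | gM => Put (inl true)
            | _ => Keep end)
    | Some (inr (inr (inl a'))) =>
        if [&& ~~ isSome (t gM), ~~ isSome (t gQ) & a' != a]
        then @Stop greg gsym gchoice Rej
        else
          Seq (Ops (fun r => match r with
                | gK => Pop | gL => Push (inr (inr (inl a'))) | gM => Pop
                | _ => Keep end))
              (xfer gchoice (gP : greg) xpredT
                 (fun z r => match r with gQ => [:: z] | _ => [::] end) 1)
    | _ => Skip greg gsym gchoice
    end).

Definition scan (a : bool) : cmd := While (fun t => isSome (t gK)) (scan1 a).

Variables (x g t : seq cell) (c : config N).

(** Here [v] is the part already read of the current entry, and [prefix v q] says that no mismatch
    has occurred. In that case the scanned part of [q] is [v], stored reversed in [p]; after a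
    mismatch [p] stays as it was. *)
Lemma scan_spec a (q : word) ks (v u p : word) l :
  rev p ++ u = q -> (prefix v q -> rev p = v) ->
  let s := ov gemb (gst x (map kc ks) l (map inl u) (map inl p)
     (if prefix v q then [::] else [:: inl true]) g t [::]) c in
  let T := size ks * (8 * size q + 10) + 1 in
  if (q, ~~ a) \in kparse v ks then
    forall k U, wp (scan a) k s (T + U) (Rej = o)
  else exists u' p' m', size u' + size p' = size q /\
    det (scan a) s T (ov gemb (gst x [::] (rev (map kc ks) ++ l) (map inl u')
      (map inl p') (if m' then [::] else [:: inl true]) g t [::]) c).
Proof.
elim: ks v u p l => [|[b|a'] ks IH] v u p l pu vq.
- exists u, p, (prefix v q); split; first by rewrite -pu size_cat size_rev
    addnC.
  by apply: det_WhileF; rewrite ffunE.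
- set T' := size ks * _ + 1 in IH *.
  have T'E : size (inl b :: ks : seq (bool + bool)) * (8 * size q + 10) + 1 =
    8 * size q + 10 + T'.
    by rewrite /T' /= mulSn -addnA.
  set s := ov _ _ _; move=> T; rewrite /T T'E => {T}.
  pose eqb := prefix v q && (ohead u == Some b).
  have eqbE : prefix (rcons v b) q = eqb.
    rewrite /eqb; case vq': (prefix v q); last first.
      apply: contraFF vq'; apply: prefix_trans; exact: prefix_rcons.
    by rewrite -pu vq // prefix_rcons_cat.
  pose u1 := if eqb then behead u else u.
  pose p1 := if eqb then b :: p else p.
  have pu1 : rev p1 ++ u1 = q.
    rewrite /p1 /u1; case: ifP => // /andP[_ /eqP];
      case: u pu {eqb eqbE u1 p1 s vq} => //= b' u pu [<-].
    by rewrite rev_cons cat_rcons.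
  have vq1 : prefix (rcons v b) q -> rev p1 = rcons v b.
    by rewrite eqbE /p1 => h; rewrite h rev_cons vq //; case/andP: h.
  set s1 := ov gemb (gst x (map kc ks) (inl b :: l) (map inl u1) (map inl p1)
     (if prefix (rcons v b) q then [::] else [:: inl true]) g t [::]) c.
  have st : det (scan1 a) s 3 s1.
    apply: det_Case; rewrite !ffunE /s /ov /=.
    rewrite /s1 eqbE /u1 /p1 /eqb /s1 {s1 u1 p1 eqb eqbE pu1 vq1}.
    case: (prefix v q) vq @s => [|] vq s; rewrite /= ?andbF; last first.
      by apply: det_Ops_to => -[m|[[[[] []] []] []]].
    case: u pu @s => [|b' u] pu s /=.
      by apply: det_Ops_to => -[m|[[[[] []] []] []]].
    rewrite -[Some (inl b') == _]/(b' == b) -[Some b' == _]/(b' == b).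
    case: eqP => [->|_]; by apply: det_Ops_to => -[m|[[[[] []] []] []]].
  have tK : isSome (tops s gK) by rewrite ffunE.
  move: (IH (rcons v b) u1 p1 (inl b :: l) pu1 vq1) => /=; rewrite -/s1.
  case: ifP => _.
    move=> h k U; apply: (wp_While (U := 3 + (T' + U))); first by lia.
    by rewrite tK; apply: (wp_det st); apply: h.
  case=> u' [p' [m' [sz dd]]]; exists u', p', m'; split=> //.
  apply: (@det_le _ _ _ _ _ _ _ _ (3 + T').+1); first by lia.
  apply: det_WhileT tK st _; rewrite rev_cons cat_rcons; exact: dd.
- set T' := size ks * _ + 1 in IH *.
  have T'E : size (inr a' :: ks : seq (bool + bool)) * (8 * size q + 10) + 1 =
    8 * size q + 10 + T'.
    by rewrite /T' /= mulSn -addnA.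
  set s := ov _ _ _; move=> T; rewrite /T T'E /= => {T}.
  set s1 := ov gemb (gst x (map kc ks) (inr (inr (inl a')) :: l) (map inl q)
    (map inl [::])
     (if prefix [::] q then [::] else [:: inl true]) g t [::]) c.
  have hit : ((q, ~~ a) == (v, a')) = [&& prefix v q, u == [::] & a' != a].
    rewrite xpair_eqE; case vq': (prefix v q) => /=; last first.
      by apply/negbTE/negP => /andP[/eqP e _]; rewrite -e prefix_refl in vq'.
    have -> : (~~ a == a') = (a' != a) by case: (a); case: (a').
    by congr (_ && _); rewrite -pu vq // -{2}[v]cats0 eqseq_cat // eqxx.
  have tK : isSome (tops s gK) by rewrite ffunE.
  have opM (m : seq cell) : m = (if prefix v q then [::] else [:: inl true]) ->
    behead m = [::] by move=> ->; case: ifP.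
  rewrite inE hit; case hb: [&& _, _ & _] => /=.
    move=> k U; apply: (wp_While (U := 2 + U)); first by lia.
    rewrite tK; apply: (@wp_le _ _ _ _ _ _ _ _ _ U.+1) => //.
    apply: wp_Case; rewrite !ffunE /s /ov /=.
    by case/and3P: hb => -> /eqP -> -> /=.
  have st : det (scan1 a) s (8 * size q + 4) s1; first rewrite /s1 prefix0s.
    apply: (@det_le _ _ _ _ _ _ _ _ (2 + (size p * 8 + 1)).+1).
      have : size p <= size q by rewrite -pu size_cat size_rev leq_addr.
      by lia.
    apply: det_Case; rewrite !ffunE /s /ov /=.
    have -> : [&& ~~ isSome (ohead (if prefix v q then [::] else [:: inl true :
      cell])),
       ~~ isSome (ohead [seq inl i : cell | i <- u]) & a' != a] = false.
      by rewrite -hb; case: (prefix v q); case: (u).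
    apply: (det_Seq (s2 := ov gemb (gst x (map kc ks) (inr (inr (inl a')) :: l)
       (map inl u) (map inl p) [::] g t [::]) c)).
      apply: det_Ops_to => -[m|[[[[] []] []] []]] //=.
      by rewrite (opM _ erefl).
    apply: (det_xfer_to (map inl p) [::]); rewrite ?cats0 ?all_predT ?size_map
      //.
    - by move=> z [m|[[[[] []] []] []]].
    - move=> [m|[[[[] []] []] []]] //= _; rewrite ?flatten_rev0 //.
      by rewrite flatten_rev1 map_id -map_rev -map_cat pu.
  move: (IH [::] q [::] (inr (inr (inl a')) :: l) erefl (fun _ => erefl));
    rewrite -/s1.
  case: ifP => _.
    move=> h k U; apply: (wp_While (U := 8 * size q + 4 + (T' + U)));
      first by lia.
    by rewrite tK; apply: (wp_det st); apply: h.
  case=> u' [p' [m' [sz dd]]]; exists u', p', m'; split=> //.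
  apply: (@det_le _ _ _ _ _ _ _ _ (8 * size q + 4 + T').+1); first by lia.
  apply: det_WhileT tK st _; rewrite rev_cons cat_rcons; exact: dd.
Qed.

End Guesser.

Section Guesser.
Variable N : machine.
Local Notation cell := (bool + gsym N)%type.
Local Notation cmd := (@cmd (greg N) (gsym N) (gchoice N)).
Local Notation Ops := (@Ops (greg N) (gsym N) (gchoice N)).
Local Notation Stop := (@Stop (greg N) (gsym N) (gchoice N)).
Local Notation Skip := (@Skip (greg N) (gsym N) (gchoice N)).
Local Notation gemb := (gemb N).

(** The guessed answer enters the log before the scan, which is harmless since the new entry cannot
    contradict itself. It is pushed before the bits of its query, so that the entry reads bits first
    from the top. *)
Definition check (a : bool) : cmd :=
  Seq (Ops (fun r => match r with gK => Push (inr (inr (inl a))) | _ =>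
    Keep end))
  (Seq (copy_word (gchoice N) gemb gTmp (fun _ _ => [::])
     (fun b r => match r with gQ | gK => [:: inl b] | _ => [::] end))
  (Seq (scan N a)
  (Seq (xfer (gchoice N) (gL : greg N) xpredT
          (fun z r => match r with gK => [:: z] | _ => [::] end) 1)
       (clear _ _ (fun r : greg N => match r with gQ | gP | gM => true | _ =>
         false end))))).

Definition guess1 : cmd := Choose (fun j : gchoice N => Case (fun t =>
  match omap (@program N) (cur gemb t) with
  | Some (Step _) =>
      Seq (Ops (fun r => match r with gG => Pop | _ => Keep end))
          (simstep _ gemb (if t gG is Some (inr (inr (inr i))) then i else j.1))
  | Some (Query q1 q0) =>
      Seq (Ops (fun r => match r with gG => Pop | _ => Keep end))
      (Seq (check j.2) (setst _ gemb (if j.2 then q1 else q0)))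
  | _ => Skip
  end)).

Definition target (ts : seq bool) : outcome :=
  match ts with true :: _ => Acc | false :: _ => Rej | [::] => Quest end.

Definition verdict : cmd := Case (fun t =>
  match omap (@program N) (cur gemb t), t gT with
  | Some (Halt Acc), Some (inl true) => Stop Acc
  | Some (Halt Rej), Some (inl false) => Stop Acc
  | Some (Halt Quest), None => Stop Acc
  | _, _ => Stop Rej
  end).

Variables (D : language).
Local Notation det := (@det (greg N) (gsym N) (gchoice N) gQry D Acc).
Local Notation wp := (@wp (greg N) (gsym N) (gchoice N) gQry D Acc).

Variables (X : seq cell) (ts : seq bool).

Definition ch (i : choices N) : cell := inr (inr (inr i)).

Definition gstate (ks : seq (bool + bool)) (g : seq (choices N)) (c : config N)
  :=
  ov gemb (gst X (map (@kc N) ks) [::] [::] [::] [::] (map ch g)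
             (map inl ts) [::]) c.

Definition check_cost w k :=
  2 + (16 * w + 2 + (k * (8 * w + 10) + 1 + (8 * k + 1 + (3 * w + 4)))).

Lemma check_cost_le w w' k k' : w <= w' -> k <= k' ->
  check_cost w k <= check_cost w' k'.
Proof.
move=> ww kk; have := leq_mul kk (leq_add (leq_mul (leqnn 8) ww) (leqnn 10)).
by rewrite /check_cost; lia.
Qed.

Lemma check_spec a ks g c :
  let T := check_cost (size (wd c)) (size (entry_syms (wd c, a) ++ ks)) in
  if (wd c, ~~ a) \in kparse [::] ks then
    forall k U, wp (check a) k (gstate ks g c) (T + U) False
  else det (check a) (gstate ks g c) T (gstate (entry_syms (wd c,
    a) ++ ks) g c).
Proof.
set q := wd c; set ks' := entry_syms _ ++ ks; cbv zeta.
have kpE : ((q, ~~ a) \in kparse [::] ks) = ((q, ~~ a) \in kparse [::] ks').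
  rewrite kparse_entry inE xpair_eqE /=.
  have -> : (~~ a == a) = false by case: (a).
  by rewrite andbF.
rewrite kpE.
pose s1 := ov gemb (gst X (inr (inr (inl a)) :: map (@kc N) ks) [::] [::] [::]
  [::]
    (map ch g) (map inl ts) [::]) c.
pose s2 := ov gemb (gst X (map (@kc N) ks') [::] (map inl q) [::] [::]
    (map ch g) (map inl ts) [::]) c.
have d1 : det (Ops (fun r => match r with gK => Push (inr (inr (inl a))) | _ =>
  Keep end))
    (gstate ks g c) 2 s1.
  by apply: det_Ops_to => -[m|[[[[] []] []] []]].
have d2 : det (copy_word (gchoice N) gemb gTmp (fun _ _ => [::])
     (fun b r => match r with gQ | gK => [:: inl b] | _ => [::] end)) s1 (16 *
       size q + 2) s2.
  apply: det_copy_word => //.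
  - by move=> b [m|[[[[] []] []] []]].
  - by move=> b [m|[[[[] []] []] []]].
  have f2 (T T' : Type) (f : T -> T') l : flatten [seq [:: f b] | b <- l] = map
    f l.
    by elim: l => //= b l ->.
  have f0 (T T' : Type) (l : seq T) : flatten [seq [::] | b <- l] = [::] :> seq
    T'.
    by elim: l.
  case=> [m|[[[[] []] []] []]] //= _ _; rewrite ?flatten_rev0 ?f2 ?f0 //=.
    by rewrite cats0.
  rewrite /ks' /entry_syms cat_rcons map_cat /= -map_comp.
  by [].
have sc := @scan_spec N D Acc X (map ch g) (map inl ts) c a q ks' [::] q [::]
  [::] erefl (fun _ => erefl).
move: sc; rewrite prefix0s -/s2 /=; case: ifP => _.
  move=> h k U; apply: (@wp_le _ _ _ _ _ _ _ _ _ (2 + ((16 * size q + 2) +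
      ((size ks' * (8 * size q + 10) + 1) + U)))); first by rewrite /check_cost;
        lia.
  apply: wp_Seq; apply: (wp_det d1); apply: wp_Seq; apply: (wp_det d2);
    apply: wp_Seq.
  have -> : False = (Rej = Acc) by apply/propext; split.
  exact: h.
case=> u [p [m [sz d3]]].
apply: det_Seq d1 (det_Seq d2 (det_Seq d3 _)).
pose s4 := ov gemb (gst X (map (@kc N) ks') [::] (map inl u) (map inl p)
    (if m then [::] else [:: inl true]) (map ch g) (map inl ts) [::]) c.
apply: (det_Seq (s2 := s4)).
  apply: (det_xfer_to (rev (map (@kc N) ks')) [::]);
    rewrite ?cats0 ?all_predT ?size_rev ?size_map //.
  - by move=> z [m'|[[[[] []] []] []]].
  - move=> [m'|[[[[] []] []] []]] //= _; rewrite ?flatten_rev0 //.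
    by rewrite flatten_rev1 map_id revK cats0.
  - by rewrite mulnC.
have -> : gstate ks' g c = fun r => if (match r with gQ | gP | gM => true | _ =>
  false end)
    then [::] else s4 r.
  by apply/funext => -[m'|[[[[] []] []] []]].
apply: (@det_le _ _ _ _ _ _ _ _ (3 * (size q + 1) + 1)); first by rewrite /q;
  lia.
apply: det_clear; case=> [m'|[[[[] []] []] []]] //= _; rewrite /s4 /ov /=.
- by case: (m); rewrite addn1.
- by rewrite size_map -sz; lia.
- by rewrite size_map -sz; lia.
Qed.

Variables (x : word) (n P B : nat).
Hypothesis hx : size x <= n.
Hypothesis hP : forall D' g, halts (run D' g (init N x)) = None -> size g <= P.

Definition len_bound := n + P + 1.
Definition log_bound := B + P * (len_bound + 1).
Definition round_cost := 20 + check_cost len_bound (log_bound + len_bound + 1).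

Lemma wp_verdict (k : trans _ _) ks g c o' T : halts c = Some o' ->
  wp verdict k (gstate ks g c) T.+1 (ok (target ts) (kparse [::] ks) g c).
Proof.
rewrite /halts; case e: (program _) => [o1|//|//] [oo]; subst o1.
have -> : ok (target ts) (kparse [::] ks) g c =
    ((if (match o', ts with Acc, true :: _ | Rej, false :: _ | Quest, [::] =>
      true
     | _, _ => false end) then Acc else Rej) = Acc).
  by apply/propext; rewrite okE e; case: o' {e} => //; case: ts => [|[] l].
apply: wp_Case; rewrite cur_ov /= e ffunE /gstate /ov /=.
by case: o' {e}; case: ts => [|[] l] /=; apply: wp_Stop.
Qed.

(** Induction on the number [r] of steps left. The guessed path is traced under an oracle [D'] that
    is altered at each query by [traced_answer]. Since [hP] holds for all oracles, it bounds the
    path even when the list of answers on the input tape is itself contradictory. *)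
Lemma wp_guess (k : trans _ _) r g0 D' ks g c :
  traced x D' (kparse [::] ks) g0 c -> P < size g0 + r ->
  size ks <= B + size g0 * (len_bound + 1) ->
  wp (Seq (While (live gemb) guess1) verdict) k (gstate ks g c)
    (r * round_cost + 3) (ok (target ts) (kparse [::] ks) g c).
Proof.
elim: r g0 D' ks g c => [|r IH] g0 D' ks g c tr gr szk; apply: wp_Seq.
all: case hc: (halts c) => [o'|];
  first by (apply: (wp_While (U := 2)); [by lia|rewrite live_ov hc;
    exact: wp_verdict hc]).
all: have g0P : size g0 <= P by (apply: (hP (D' := D'));
  rewrite -(traced_run tr)).
  by move: gr; rewrite addn0 ltnNge g0P.
have szw : size (wd c) <= len_bound.
  rewrite (traced_run tr); apply: leq_trans (size_wd _ _ _) _.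
  by rewrite /len_bound leq_add2r leq_add.
have szl : size ks <= log_bound.
  by apply: leq_trans szk _; rewrite leq_add2l leq_mul2r g0P orbT.
have rest g0' D1 ks' g' c' : traced x D1 (kparse [::] ks') g0' c' ->
    size g0' = (size g0).+1 -> size ks' <= size ks + (len_bound + 1) ->
    wp (While (live gemb) guess1) (wp verdict k) (gstate ks' g' c')
      (r * round_cost + 3) (ok (target ts) (kparse [::] ks') g' c').
  move=> tr' sz' szk'; apply: (IH g0' D1) => //; first by rewrite sz'; lia.
  apply: leq_trans szk' _; rewrite sz' mulSn.
  by move: szk; set v := size g0 * _; lia.
apply: (wp_While (U := (round_cost.-1 + (r * round_cost + 3)))).
  by rewrite mulSn /round_cost /=; lia.
rewrite live_ov hc /=.
have -> : round_cost.-1 + (r * round_cost + 3) =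
   (18 + check_cost len_bound (log_bound + len_bound + 1) + (r * round_cost +
     3)).+1.
  by rewrite {1}/round_cost.
set CC := check_cost _ _.
have popg c0 : det (Ops (fun r => match r with gG => Pop | _ => Keep end))
    (gstate ks g c0) 2 (gstate ks (behead g) c0).
  by apply: det_Ops_to => -[m|[[[[] []] []] []]] //=;
    rewrite /gstate /ov /= behead_map.
have topg : tops (gstate ks g c) gG = omap ch (ohead g).
  by rewrite ffunE /gstate /ov /=; case: (g).
move: hc; rewrite /halts; case e: (program _) => [//|q1 q0|delta] _.
- apply: (wp_Choose (Phi := fun j : gchoice N => (wd c, ~~ j.2) \notin kparse
    [::] ks /\
     ok (target ts) ((wd c, j.2) :: kparse [::] ks) (behead g) (branch c j.2)));
       last first.
    rewrite okE e; split=> [[a na h]|[j [na h]]]; last by exists j.2.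
    by exists (choice0 N, a).
  move=> [i a] /=.
  apply: (@wp_le _ _ _ _ _ _ _ _ _ (2 + (CC + (2 + (r * round_cost + 3)))).+1);
    first by lia.
  apply: wp_Case; rewrite cur_ov /= e.
  apply: wp_Seq; apply: (wp_det (popg _)); apply: wp_Seq.
  have := check_spec a ks (behead g) c; set T := check_cost _ _.
  have TC : T <= CC.
    apply: check_cost_le => //; rewrite size_cat /entry_syms size_rcons size_map
      /=.
    by rewrite addnC -addnA leq_add // addn1.
  case na: ((wd c, ~~ a) \in kparse [::] ks) => ch.
    have -> : (~~ true /\ ok (target ts) ((wd c, a) :: kparse [::] ks) (behead
      g) (branch c a)) = False.
      by apply/propext; split=> // -[].
    by apply: (wp_le _ (ch _ (2 + (r * round_cost + 3)))); rewrite leq_add2r.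
  apply: (wp_le (T := T + (2 + (r * round_cost + 3))));
    first by rewrite leq_add2r.
  apply: (wp_det ch); apply: (wp_det (det_setst _ _ _ _ _ _ _ _)).
  have -> : goto (if a then q1 else q0) c = branch c a by rewrite /branch e.
  have -> : (~~ false /\ ok (target ts) ((wd c, a) :: kparse [::] ks) (behead g)
    (branch c a)) =
     ok (target ts) (kparse [::] (entry_syms (wd c, a) ++ ks)) (behead g)
       (branch c a).
    by apply/propext; rewrite kparse_entry /=; split=> [[]|].
  apply: (rest (rcons g0 i) (answer D' (wd c) a)).
  + by rewrite kparse_entry; apply: traced_answer tr e _; rewrite na.
  + by rewrite size_rcons.
  + rewrite size_cat /entry_syms size_rcons size_map /=.
    by rewrite addnC leq_add2l addn1.
- apply: (wp_Choose (Phi := fun j : gchoice N =>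
     ok (target ts) (kparse [::] ks) (behead g) (stepf set0 (head j.1 g) c)));
       last first.
    rewrite okE e; split=> [[i ig h]|[j h]].
      by exists (i, true); rewrite /= ig.
    by exists (head j.1 g) => //; case: (g).
  move=> [i a] /=.
  apply: (@wp_le _ _ _ _ _ _ _ _ _ (2 + (8 + (r * round_cost + 3))).+1);
    first by lia.
  apply: wp_Case; rewrite cur_ov /= e topg.
  apply: wp_Seq; apply: (wp_det (popg _)).
  have -> : (if omap ch (ohead g) is Some (inr (inr (inr i))) then i else i) =
    head i g.
    by case: (g).
  apply: (wp_det (det_simstep _ _ _ _ _ _ _ e)).
  rewrite (stepf_Step D set0 _ e).
  apply: (rest (rcons g0 (head i g)) D') => //.
  + exact: traced_Step tr e.
  + by rewrite size_rcons.
  + exact: leq_addr.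
Qed.

End Guesser.

(** * The consistency question as an NP language of encoded logs *)

Section Language.
Variable N : machine.
Local Notation cell := (bool + gsym N)%type.

Definition logsym : finType := (bool + bool + (bool + bool) + choices N)%type.

Definition gpush (y : logsym) (r : greg N) : seq cell :=
  match y, r with
  | inl (inl (inl t)), gT => [:: inl t]
  | inl (inl (inr b)), gX => [:: inl b]
  | inl (inr z), gK => [:: kc N z]
  | inr i, gG => [:: ch i]
  | _, _ => [::]
  end.

(** A log is a stack with its newest symbol first, so all its parts are read in reverse. *)
Definition log_targets (ys : seq logsym) : seq bool :=
  rev (pmap (fun y => if y is inl (inl (inl t)) then Some t else None) ys).
Definition log_input (ys : seq logsym) : word :=
  rev (pmap (fun y => if y is inl (inl (inr b)) then Some b else None) ys).
Definition log_answers (ys : seq logsym) : seq (bool + bool) :=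
  rev (pmap (fun y => if y is inl (inr z) then Some z else None) ys).
Definition log_choices (ys : seq logsym) : seq (choices N) :=
  rev (pmap (fun y => if y is inr i then Some i else None) ys).

Definition guesser : cmd (greg N) (gsym N) (gchoice N) :=
  Seq (decode (gchoice N) (gInp : greg N) gpush)
  (Seq (load (gchoice N) (gemb N) gX gTmp)
  (Seq (While (live (gemb N)) (guess1 N)) (verdict N))).

Definition log_regs (ys : seq logsym) : regs (greg N) (gsym N) :=
  gst (map inl (log_input ys)) (map (@kc N) (log_answers ys)) [::] [::] [::]
    [::]
    (map (@ch N) (log_choices ys)) (map inl (log_targets ys)) [::].

Lemma flatten_pmap (T T1 T2 : Type) (p : T -> option T1) (h : T1 -> T2) l :
  flatten (rev [seq (if p y is Some z then [:: h z] else [::]) | y <- l]) =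
  map h (rev (pmap p l)).
Proof.
rewrite -map_rev; elim/last_ind: l => // l y IH.
rewrite rev_rcons /= IH -cats1 pmap_cat rev_cat map_cat /=.
by case: (p y).
Qed.

Lemma decoded ys w :
  with_inp (gInp : greg N) (init_regs (gsym N) (gInp : greg N) w) [::]
    (fun r => flatten (rev [seq gpush y r | y <- ys])) = log_regs ys.
Proof.
apply/funext => -[m|[[[[] []] []] []]];
  rewrite /with_inp /init_regs /log_regs /= ?cats0 -?flatten_pmap;
  try (by rewrite -[RHS](@flatten_rev0 logsym cell ys); apply: (congr1 (fun l =>
    flatten (rev l))); apply: eq_map => -[[[|]|]|]).
all: try (by apply: (congr1 (fun l => flatten (rev l))); apply: eq_map =>
  -[[[|]|]|]).
all: done.
Qed.

Definition guess_time (p : {poly nat}) (n : nat) :=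
  (3 * size (enum logsym) + 4) * n + 1 + (16 * n + 7 +
    ((p.[n]%R + 1) * round_cost n p.[n]%R n + 3)).

Lemma wp_guesser (p : {poly nat}) D (k : trans _ _) w :
  (forall D' x g, halts (run D' g (init N x)) = None -> size g <= p.[size x]%R)
    ->
  exists2 ys, (forall ys', w = codes ys' -> ys = ys') &
    wp gQry D Acc guesser k (init_regs (gsym N) (gInp : greg N) w)
      (guess_time p (size w))
      (ok (target (log_targets ys)) (kparse [::] (log_answers ys))
          (log_choices ys) (init N (log_input ys))).
Proof.
move=> hp.
have [] := @det_decode (greg N) (gsym N) (gchoice N) logsym gQry D Acc gInp
  gpush
  _ w (init_regs (gsym N) (gInp : greg N) w).
- by move=> [[[t|b]|z]|i] [m|[[[[] []] []] []]].
- rewrite -cardE; apply/card_gt0P; by exists (inr (choice0 N)).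
- by [].
move=> ys [szys dec hys]; exists ys => //.
rewrite /guess_time; apply: wp_Seq; apply: (wp_det dec).
have szp (T : Type) (f : logsym -> option T) : size (rev (pmap f ys)) <= size w.
  by rewrite size_rev size_pmap (leq_trans _ szys) // count_size.
rewrite decoded; apply: wp_Seq.
apply: (wp_le (T := 16 * size (log_input ys) + 7 +
   ((p.[size w]%R + 1) * round_cost (size w) p.[size w]%R (size w) + 3))).
  by rewrite !addnA !leq_add2r leq_mul2l szp.
have ld := @det_load (greg N) (gsym N) (gchoice N) gQry D Acc N (gemb N) gX gTmp
  erefl erefl erefl (log_regs ys) (log_input ys) erefl erefl (fun _ => erefl).
apply: (wp_det ld).
apply: (@wp_guess N D _ _ (log_input ys) (size w) _ (size w) _ _ k _ [::] set0
  (log_answers ys) (log_choices ys)).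
- exact: szp.
- move=> D' g /hp hg; apply: leq_trans hg _; exact/horner_leq/szp.
- exact: traced_nil.
- by rewrite addn1.
- by rewrite addn0 szp.
Qed.

Lemma polyb_guess_time p : polyb (guess_time p).
Proof.
rewrite /guess_time /round_cost /check_cost /log_bound /len_bound.
repeat first [exact: polyb_const | exact: polyb_id | exact: polyb_horner
  | apply: polyb_add | apply: polyb_mul].
Qed.

Lemma guess_language : polytime N -> exists2 L, classNP L &
  forall ys, L (codes ys) <->
    ok (target (log_targets ys)) (kparse [::] (log_answers ys))
       (log_choices ys) (init N (log_input ys)).
Proof.
case/polytimeP => f [p fp] hf.
have hp D' x g : halts (run D' g (init N x)) = None -> size g <= p.[size x]%R.
  by move=> /hf h; apply: leq_trans h (fp _).
have [M _ hM] := @compile (greg N) (gsym N) (gchoice N) gInp gQry (choice0 N,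
  true) guesser isT.
have pM : polytime M.
  have [q hq] := polyb_guess_time p.
  exists q => D w n c pc; apply: leq_trans (hq _).
  have [ys _ hw] := wp_guesser D (fun _ _ phi => phi = (Rej = Acc)) w hp.
  by case: (hM _ _ _ _ _ hw) => h _; apply: h pc.
exists (lang M set0).
  exists (transform noquest true M); split.
  - exact: transform_polytime.
  - by apply: transform_two_outcome; case.
  - exact: transform_oracle_free.
  apply/seteqP; split=> w.
    by move=> h; apply/transform_out; exists Acc.
  by case/transform_out => -[].
move=> ys; have [ys' eys hw] := wp_guesser set0 (fun _ _ phi =>
  phi = (Rej = Acc)) (codes ys) hp.
rewrite (eys _ erefl) in hw.
by case: (hM _ _ _ _ _ hw).
Qed.

End Language.

(** * The deterministic search *)

(* mR: log of the input and of all true answers; mH: the same log, extended *)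
(* by the answers assumed and the choices made in this round; mT: target;   *)
(* mF: result of the last test.                                             *)
Local Notation mInp := (inr (false, false, false)).
Local Notation mQry := (inr (false, false, true)).
Local Notation mTmp := (inr (false, true, false)).
Local Notation mH := (inr (false, true, true)).
Local Notation mR := (inr (true, false, false)).
Local Notation mT := (inr (true, false, true)).
Local Notation mF := (inr (true, true, false)).

Section Searcher.
Variables N M : machine.

Definition ssym : finType :=
  (state N + option (bool + aux N) + (state M + option (bool + aux M)) +
   logsym N)%type.
Definition sreg : finType := (mreg N + mreg M + (bool * bool * bool))%type.
Local Notation cell := (bool + ssym)%type.

Definition embN : embedding N sreg ssym.
Proof.
refine (@Embedding N sreg ssym
  (fun m => inl (inl m)) (fun r => if r is inl (inl m) then Some m else None)
  (fun q => inr (inl (inl (inl q))))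
  (fun a => if a is inr (inl (inl (inl q))) then Some q else None)
  (fun a => inr (inl (inl (inr a))))
  (fun a => if a is inr (inl (inl (inr a))) then a else None) _ _ _ _) => //.
by move=> [[m'|]|] m // [->].
Defined.

Definition embM : embedding M sreg ssym.
Proof.
refine (@Embedding M sreg ssym
  (fun m => inl (inr m)) (fun r => if r is inl (inr m) then Some m else None)
  (fun q => inr (inl (inr (inl q))))
  (fun a => if a is inr (inl (inr (inl q))) then Some q else None)
  (fun a => inr (inl (inr (inr a))))
  (fun a => if a is inr (inl (inr (inr a))) then a else None) _ _ _ _) => //.
by move=> [[|m']|] m // [->].
Defined.

Definition lg (y : logsym N) : cell := inr (inr y).

Definition sst (x : word) (q : seq cell) (h r : seq (logsym N)) (t f : bool) :
    regs sreg ssym :=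
  fun z => match z with
  | mInp => map inl x | mQry => q | mH => map lg h | mR => map lg r
  | mT => [:: inl t] | mF => [:: inl f] | _ => [::]
  end.

Variables (D : language) (o : outcome).
Local Notation det := (@det sreg ssym unit mQry D o).
Local Notation wp := (@wp sreg ssym unit mQry D o).
Local Notation cmd := (@cmd sreg ssym unit).
Local Notation Ops := (@Ops sreg ssym unit).
Local Notation xfer := (@xfer sreg ssym unit).

Definition code_len := (size (enum (logsym N))).+1.

Definition encode (a : cell) : seq cell :=
  if a is inr (inr y) then
    [seq sy embM (Some (inl b)) | b <- code_in (enum (logsym N)) y]
  else [::].

(** The log travels to [mTmp] and back, and its code is laid on the input tape of M on the way back.
    The registers of M are emptied at the end so that the test can be repeated. *)
Definition test : cmd :=
  Seq (xfer mH xpredT (fun a r => match r with mTmp => [:: a] | _ =>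
    [::] end) 1)
  (Seq (xfer mTmp xpredT (fun a r =>
      match r with
      | mH => [:: a]
      | inl (inr (Some (inr j))) => if j == ord0 then encode a else [::]
      | _ => [::]
      end) code_len)
  (Seq (start_sim unit embM)
  (Seq (While (live embM) (simstep unit embM (choice0 M)))
  (Seq (Case (fun t =>
      let b := if omap (@program M) (cur embM t) is Some (Halt Acc) then true
               else false in
      Ops (fun r => match r with mF => Put (inl b) | _ => Keep end)))
    (clear _ _ (fun r : sreg => if r is inl (inr _) then true else false)))))).

Hypotheses (oM : oracle_free M) (dM : deterministic M).
Variable p : {poly nat}.
Hypothesis hp :
  forall D x g, halts (run D g (init M x)) = None -> size g <= p.[size x]%R.

Definition code_bound n := code_len * n.

Definition test_cost n :=
  n * 8 + 1 + (n * (2 * code_len + 6) + 1 + (5 +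
  (9 * (p.[code_bound n]%R + 1) + 1 + (3 +
  (3 * (code_bound n + (p.[code_bound n]%R + 1) + 1) + 1))))).

Lemma size_codes_le (ys : seq (logsym N)) : size (codes ys) <= code_bound (size
  ys).
Proof.
rewrite /code_bound; elim: ys => [|y ys IH] //=.
rewrite /codes /= size_cat mulnS leq_add // size_rcons size_nseq ltnS.
by apply: leq_trans (index_size _ _) _.
Qed.

Lemma iter_run E (c : config M) n :
  iter n (stepf E (choice0 M)) c = run E (nseq n (choice0 M)) c.
Proof.
by elim: n c => //= n IH c; rewrite -IH -iterSr.
Qed.

Lemma det_test s ys f :
  s mTmp = [::] -> (forall m, s (inl (inr m)) = [::]) ->
  s mH = map lg ys -> s mF = [:: inl f] ->
  det test s (test_cost (size ys))
    (fun r => match r with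
     | mF => [:: inl `[< lang M set0 (codes ys) >]] | _ => s r end).
Proof.
move=> sT sM sH sF.
pose w := codes ys; pose c0 := init M w.
pose n := p.[code_bound (size ys)]%R + 1.
pose cf := iter n (stepf D (choice0 M)) c0.
have hcf : isSome (halts cf).
  case e: (halts cf) => //; move: e; rewrite /cf iter_run => /hp.
  rewrite size_nseq /n leqNgt => /negP[]; rewrite addn1 ltnS.
  exact/horner_leq/size_codes_le.
pose s1 : regs sreg ssym := fun r => match r with
  | mH => [::] | mTmp => rev (map lg ys) | _ => s r end.
pose s2 : regs sreg ssym := fun r => match r with
  | inl (inr (Some (inr j))) =>
      if j == ord0 then [seq sy embM (Some (inl b)) | b <- w] else [::]
  | _ => s r end.
have d1 : det (xfer mH xpredT (fun a r => match r with mTmp => [:: a] | _ =>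
  [::] end) 1)
    s (size ys * 8 + 1) s1.
  apply: (det_xfer_to (map lg ys) [::]);
    rewrite ?cats0 ?all_predT ?size_map //.
  - by move=> a [[m|m]|[[[] []] []]].
  - move=> [[m|m]|[[[] []] []]] //= _; rewrite ?flatten_rev0 //.
    by rewrite flatten_rev1 map_id sT cats0.
apply: det_Seq d1 _.
have d2 : det (xfer mTmp xpredT (fun a r =>
      match r with
      | mH => [:: a]
      | inl (inr (Some (inr j))) => if j == ord0 then encode a else [::]
      | _ => [::]
      end) code_len) s1
    (size ys * (2 * code_len + 6) + 1) s2.
  apply: (det_xfer_to (rev (map lg ys)) [::]);
    rewrite ?cats0 ?all_predT ?size_rev ?size_map //.
  - move=> a [[m|[[j|j]|]]|[[[] []] []]] //=; case: ifP => // _.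
    case: a => [b|[[z|z]|y]] //=.
    rewrite size_map size_rcons size_nseq ltnS; exact: index_size.
  - move=> [[m|[[j|j]|]]|[[[] []] []]] //= _; rewrite ?flatten_rev0 //.
      case: ifP => _; last by rewrite flatten_rev0 sM.
      rewrite sM cats0 -map_rev revK -map_comp.
      rewrite /w /codes map_flatten -map_comp.
      by congr flatten; apply: eq_map.
    by rewrite flatten_rev1 map_id revK cats0.
apply: det_Seq d2 _.
have d3 : det (start_sim unit embM) s2 5 (ov embM s2 c0).
  apply: det_start_sim => m; rewrite /s2 /=.
  by case: m => [[j|j]|].
apply: det_Seq d3 _.
have d4 := @det_run sreg ssym unit mQry D o M embM (choice0 M) s2 c0 n oM hcf.
apply: det_Seq d4 _.
rewrite -/cf.
set b := `[< _ >].
pose s3 : regs sreg ssym := fun r => match r with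
  | mF => [:: inl b] | _ => s2 r end.
have d5 : det (Case (fun t =>
      let b := if omap (@program M) (cur embM t) is Some (Halt Acc) then true
               else false in
      Ops (fun r => match r with mF => Put (inl b) | _ => Keep end)))
    (ov embM s2 cf) 3 (ov embM s3 cf).
  apply: det_Case; rewrite cur_ov /=; apply: det_Ops_to.
  have -> : match program (cstate cf) with Halt Acc => true | _ =>
    false end = b.
    move: hcf; rewrite /halts; case e: (program _) => [o'|//|//] _.
    have ho : out M set0 w o'.
      rewrite -(out_oracle_free D) //; apply/out_run;
        exists (nseq n (choice0 M)).
      by rewrite -iter_run -/c0 -/cf /halts e.
    rewrite /b; apply/esym; case: o' {e} ho => ho; first exact/asboolP.
      by apply/asboolP => h; have := deterministic_out dM ho h.
    by apply/asboolP => h; have := deterministic_out dM ho h.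
  by move=> [[m|[[j|j]|]]|[[[] []] []]] //=; rewrite /ov /= sF.
apply: det_Seq d5 _.
have -> : (fun r : sreg => match r with mF => [:: inl b] | _ => s r end) =
  fun r => if (if r is inl (inr _) then true else false) then [::] else ov embM
    s3 cf r.
  by apply/funext => -[[m|m]|[[[] []] []]] //=.
apply: det_clear => -[[m|m]|//] //= _.
rewrite /ov /= /cf iter_run; apply: leq_trans (size_content _ _ _ _ _) _.
by rewrite size_nseq /n !leq_add2r size_codes_le.
Qed.

End Searcher.

Local Notation LT t := (inl (inl (inl t))).
Local Notation LX b := (inl (inl (inr b))).
Local Notation LQ b := (inl (inr (inl b))).
Local Notation LA a := (inl (inr (inr a))).

(** * How the logs grow, and one step of the guided search *)

Section Logs.
Variables (N : machine) (x : word).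
Implicit Types (ys : seq (logsym N)) (es : seq (word * bool)) (g : seq (choices
  N)).

Definition query_log (q : word) a ys : seq (logsym N) :=
  LA a :: rev [seq LQ b | b <- q] ++ ys.

Definition logs ys (t : seq bool) es g :=
  [/\ log_targets ys = t, log_input ys = x,
      log_answers ys = flatten [seq entry_syms e | e <- es] & log_choices ys =
        g].

Lemma logs_choice ys t es g i : logs ys t es g -> logs (inr i :: ys) t es (rcons
  g i).
Proof.
by case=> h1 h2 h3 h4; split=> //; rewrite -?h4 /log_choices /= rev_cons.
Qed.

Lemma logs_target ys t es g : logs ys [::] es g -> logs (LT t :: ys) [:: t] es
  g.
Proof. by case=> h1 h2 h3 h4; split=> //; rewrite /log_targets /= rev_cons
  -/(log_targets ys) h1. Qed.

Lemma logs_query ys t es g q a : logs ys t es g ->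
  logs (query_log q a ys) t (rcons es (q, a)) g.
Proof.
have skip (T : Type) (p : logsym N -> option T) : (forall b, p (LQ b) = None) ->
    pmap p (rev [seq LQ b | b <- q] ++ ys) = pmap p ys.
  move=> hp; rewrite pmap_cat -map_rev; elim: (rev q) => //= b l.
  by rewrite hp.
case=> h1 h2 h3 h4; split.
- by rewrite /log_targets /= skip.
- by rewrite /log_input /= skip.
- rewrite /log_answers /= rev_cons pmap_cat rev_cat -/(log_answers ys) h3.
  rewrite map_rcons flatten_rcons /entry_syms rcons_cat; congr (_ ++ rcons _ _).
  rewrite -map_rev; elim: (q) => // b l IH.
  by rewrite rev_cons map_rcons -cats1 pmap_cat rev_cat IH.
- by rewrite /log_choices /= skip.
Qed.

Lemma logs_input : logs (rev [seq LX b | b <- x]) [::] [::] [::].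
Proof.
split; rewrite ?/log_targets ?/log_answers ?/log_choices.
- by elim: (x) => //= b l; rewrite rev_cons -cats1 pmap_cat rev_cat.
- rewrite /log_input; elim: (x) => //= b l IH.
  by rewrite rev_cons -cats1 pmap_cat rev_cat IH.
- by elim: (x) => //= b l; rewrite rev_cons -cats1 pmap_cat rev_cat.
- by elim: (x) => //= b l; rewrite rev_cons -cats1 pmap_cat rev_cat.
Qed.

End Logs.

Lemma lead_bits (S : finType) (w : word) : lead [seq inl b : bool + S | b <- w]
  = w.
Proof. by rewrite /lead; elim: w => //= b w ->. Qed.

Section Search.
Variables N M : machine.
Variables (D : language) (o : outcome).
Local Notation sreg := (sreg N M).
Local Notation ssym := (ssym N M).
Local Notation embN := (embN N M).
Local Notation embM := (embM N M).
Local Notation det := (@det sreg ssym unit mQry D o).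
Local Notation wp := (@wp sreg ssym unit mQry D o).
Local Notation cmd := (@cmd sreg ssym unit).
Local Notation Ops := (@Ops sreg ssym unit).
Local Notation Skip := (@Skip sreg ssym unit).
Local Notation test := (test N M).
Local Notation lg := (@lg N M).

Hypotheses (oM : oracle_free M) (dM : deterministic M).
Variable p : {poly nat}.
Hypothesis hp :
  forall D x g, halts (run D g (init M x)) = None -> size g <= p.[size x]%R.
Local Notation test_cost := (test_cost N p).
Local Notation query_log := (@query_log N).

Definition opH (f : stack_op (bool + ssym)) : cmd :=
  Ops (fun r => match r with mH => f | _ => Keep end).
Definition opR (f : stack_op (bool + ssym)) : cmd :=
  Ops (fun r => match r with mR => f | _ => Keep end).

Definition success (t : {ffun sreg -> symbol ssym}) : bool :=
  if t mF is Some (inl true) then true else false.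

Fixpoint try (js : seq (choices N)) : cmd :=
  if js is i :: js' then
    Seq (opH (Push (lg (inr i))))
    (Seq test
      (Case (fun t => if success t then simstep unit embN i
                      else Seq (opH Pop) (try js'))))
  else Skip.

Definition copy_query : cmd :=
  copy_word unit embN mTmp
    (fun b r => match r with mH | mR => [:: lg (LQ b)] | _ => [::] end)
    (fun b r => match r with mQry => [:: inl b] | _ => [::] end).

(** The search continues with an assumed answer, true if the test permits it and false otherwise,
    while the true answer is only recorded in [mR] for later rounds. The choice [choice0 N] is a
    dummy, because query steps also consume a prescribed choice. *)
Definition answer_query (q1 q0 : state N) : cmd :=
  Seq copy_query
  (Seq (opH (Push (lg (LA true))))
  (Seq test
  (Seq (Case (fun t => if success t then Skip else opH (Put (lg (LA false)))))
  (Seq (opH (Push (lg (inr (choice0 N)))))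
  (Seq (Ask (opR (Push (lg (LA true)))) (opR (Push (lg (LA false)))))
  (Seq (clear _ _ (fun r : sreg => match r with mQry => true | _ => false end))
       (Case (fun t => setst unit embN (if success t then q1 else q0))))))))).

Variable x : word.

Definition nst h r t f c := ov embN (@sst N M x [::] h r t f) c.

Lemma success_nst h r t f c : success (tops (nst h r t f c)) = f.
Proof. by rewrite /success ffunE /nst /ov /=; case: f. Qed.

Lemma det_test_nst h r t f c :
  det test (nst h r t f c) (test_cost (size h))
    (nst h r t `[< lang M set0 (codes h) >] c).
Proof.
have -> : nst h r t `[< lang M set0 (codes h) >] c = fun z => match z with
     | mF => [:: inl `[< lang M set0 (codes h) >]] | _ => nst h r t f c z end.
  by apply/funext => -[[m|m]|[[[] []] []]].
by apply: (det_test D o oM dM hp).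
Qed.

Lemma test_cost_le m n : m <= n -> test_cost m <= test_cost n.
Proof.
move=> mn.
have cn : code_bound N m <= code_bound N n by rewrite /code_bound leq_mul2l mn
  orbT.
have := horner_leq p cn.
have : m * (2 * code_len N + 6) <= n * (2 * code_len N + 6) by rewrite leq_mul2r
  mn orbT.
rewrite /test_cost; set a := m * _; set b := n * _.
move: cn; set cm := code_bound _ _; set cn := code_bound _ _; lia.
Qed.

Lemma det_try js (h r : seq (logsym N)) t f c delta : program (cstate c) = Step
  delta ->
  (exists2 i, i \in js & lang M set0 (codes (inr i :: h))) ->
  exists2 i, lang M set0 (codes (inr i :: h)) & exists f',
    det (try js) (nst h r t f c) (size js * (test_cost (size h).+1 + 15))
      (nst (inr i :: h) r t f' (stepf set0 i c)).
Proof.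
move=> e; elim: js f => [|i js IH] f; first by case.
case=> j jjs hj.
have d1 : det (opH (Push (lg (inr i)))) (nst h r t f c) 2 (nst (inr i :: h) r t
  f c).
  by apply: det_Ops_to => -[[m|m]|[[[] []] []]].
have d2 := det_test_nst (inr i :: h) r t f c.
case hi: (`[< lang M set0 (codes (inr i :: h)) >]) d2 => d2.
  exists i; first exact/asboolP.
  exists true; rewrite mulSn.
  apply: (@det_le _ _ _ _ _ _ _ _ (2 + (test_cost (size h).+1 + 8.+1))).
    by rewrite /=; lia.
  apply: (det_Seq d1 (det_Seq d2 _)); apply: det_Case; rewrite success_nst.
  rewrite -(stepf_Step D set0 _ e); exact: det_simstep e.
have [|i' hi' [f' d3]] := IH false.
  exists j => //; move: jjs; rewrite inE => /orP[/eqP ji|//].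
  by move: hi => /asboolP[]; rewrite -ji.
exists i' => //; exists f'; rewrite mulSn.
set rest := size js * _ in d3 *.
apply: (@det_le _ _ _ _ _ _ _ _ (2 + (test_cost (size h).+1 + (2 + rest).+1))).
  by lia.
apply: (det_Seq d1 (det_Seq d2 _)); apply: det_Case; rewrite success_nst.
apply: det_Seq d3.
by apply: det_Ops_to => -[[m|m]|[[[] []] []]].
Qed.

Definition query_cost w n := 16 * w + 2 + (2 + (test_cost n + (3 + (2 + (3 +
  (3 * w + 1 + 3)))))).

Lemma det_answer_query q1 q0 (h r : seq (logsym N)) t f c : program (cstate c) =
  Query q1 q0 ->
  let b := `[< lang M set0 (codes (query_log (wd c) true h)) >] in
  det (answer_query q1 q0) (nst h r t f c)
    (query_cost (size (wd c)) (size (query_log (wd c) true h)))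
    (nst (inr (choice0 N) :: query_log (wd c) b h)
         (query_log (wd c) `[< D (wd c) >] r) t b (branch c b)).
Proof.
move=> e b; set q := wd c.
pose s1 hd rd f c' := ov embN (@sst N M x (map inl q) hd rd t f) c'.
pose h1 := rev [seq LQ b | b <- q] ++ h.
pose r1 := rev [seq LQ b | b <- q] ++ r.
have f2 (T T' : Type) (f0 : T -> T') l : flatten [seq [:: f0 b] | b <- l] = map
  f0 l.
  by elim: l => //= z l ->.
have f0 (T T' : Type) (l : seq T) : flatten [seq [::] | b <- l] = [::] :> seq
  T'.
  by elim: l.
have d1 : det copy_query (nst h r t f c) (16 * size q + 2) (s1 h1 r1 f c).
  apply: det_copy_word => //.
  - by move=> z [[m|m]|[[[] []] []]].
  - by move=> z [[m|m]|[[[] []] []]].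
  - by move=> z [[m|m]|[[[] []] []]].
  - by move=> z [[m|m]|[[[] []] []]].
  case=> [[m|m]|[[[] []] []]] //= _ _; rewrite ?flatten_rev0 ?f2 ?f0 ?cats0
    ?flatten_rev1 //.
    by rewrite /r1 map_cat map_rev -map_comp.
  by rewrite /h1 map_cat map_rev -map_comp.
have d2 : det (opH (Push (lg (LA true)))) (s1 h1 r1 f c) 2 (s1 (LA true :: h1)
  r1 f c).
  by apply: det_Ops_to => -[[m|m]|[[[] []] []]].
have d3 : det test (s1 (LA true :: h1) r1 f c) (test_cost (size (LA true ::
  h1)))
    (s1 (LA true :: h1) r1 b c).
  have -> : s1 (LA true :: h1) r1 b c = fun z => match z with
     | mF => [:: inl b] | _ => s1 (LA true :: h1) r1 f c z end.
    by apply/funext => -[[m|m]|[[[] []] []]].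
  by apply: (det_test D o oM dM hp).
have succ hd rd c' : success (tops (s1 hd rd b c')) = b.
  by rewrite /success ffunE /s1 /ov /=; case: (b).
have d4 : det (Case (fun t => if success t then Skip else opH (Put (lg (LA
  false)))))
    (s1 (LA true :: h1) r1 b c) 3 (s1 (LA b :: h1) r1 b c).
  apply: det_Case; rewrite succ; case: (b); first exact: det_Skip.
  by apply: det_Ops_to => -[[m|m]|[[[] []] []]].
have d5 : det (opH (Push (lg (inr (choice0 N))))) (s1 (LA b :: h1) r1 b c) 2
    (s1 (inr (choice0 N) :: LA b :: h1) r1 b c).
  by apply: det_Ops_to => -[[m|m]|[[[] []] []]].
set h2 := inr _ :: _ in d5.
have d6 : det (Ask (opR (Push (lg (LA true)))) (opR (Push (lg (LA false)))))
    (s1 h2 r1 b c) 3 (s1 h2 (LA `[< D q >] :: r1) b c).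
  apply: det_Ask.
  have -> : lead (s1 h2 r1 b c mQry) = q by exact: lead_bits.
  by case: `[< D q >]; apply: det_Ops_to => -[[m|m]|[[[] []] []]].
have d7 : det (clear _ _ (fun r : sreg => match r with mQry => true | _ =>
  false end))
    (s1 h2 (LA `[< D q >] :: r1) b c) (3 * size q + 1)
    (nst h2 (LA `[< D q >] :: r1) t b c).
  have -> : nst h2 (LA `[< D q >] :: r1) t b c = fun z =>
      if (match z with mQry => true | _ => false end) then [::]
      else s1 h2 (LA `[< D q >] :: r1) b c z.
    by apply/funext => -[[m|m]|[[[] []] []]].
  by apply: det_clear => -[[m|m]|[[[] []] []]] //= _;
    rewrite /s1 /ov /= size_map.
have d8 : det (Case (fun t => setst unit embN (if success t then q1 else q0)))
    (nst h2 (LA `[< D q >] :: r1) t b c) 3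
    (nst h2 (LA `[< D q >] :: r1) t b (branch c b)).
  apply: det_Case; rewrite success_nst /branch e; exact: det_setst.
exact: det_Seq d1 (det_Seq d2 (det_Seq d3 (det_Seq d4 (det_Seq d5 (det_Seq d6
  (det_Seq d7 d8)))))).
Qed.

End Search.

Definition tout (t : bool) : outcome := if t then Acc else Rej.

Section Search.
Variables N M : machine.
Variables (D : language) (o : outcome).
Local Notation sreg := (sreg N M).
Local Notation ssym := (ssym N M).
Local Notation embN := (embN N M).
Local Notation embM := (embM N M).
Local Notation det := (@det sreg ssym unit mQry D o).
Local Notation wp := (@wp sreg ssym unit mQry D o).
Local Notation cmd := (@cmd sreg ssym unit).
Local Notation Ops := (@Ops sreg ssym unit).
Local Notation Skip := (@Skip sreg ssym unit).
Local Notation test := (test N M).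
Local Notation lg := (@lg N M).

Hypotheses (oM : oracle_free M) (dM : deterministic M).
Variable p : {poly nat}.
Hypothesis hp :
  forall D x g, halts (run D g (init M x)) = None -> size g <= p.[size x]%R.
Hypothesis hL : forall ys : seq (logsym N), lang M set0 (codes ys) <->
  ok (target (log_targets ys)) (kparse [::] (log_answers ys))
     (log_choices ys) (init N (log_input ys)).
Local Notation test_cost := (test_cost N p).
Local Notation query_cost := (query_cost N p).
Local Notation query_log := (@query_log N).

Local Notation nst := (@nst N M).

Definition guided : cmd := Case (fun t =>
  match omap (@program N) (cur embN t) with
  | Some (Step _) => try M (enum (choices N))
  | Some (Query q1 q0) => answer_query M q1 q0
  | _ => Skip
  end).

Lemma query_cost_le w w' k k' : w <= w' -> k <= k' ->
  query_cost w k <= query_cost w' k'.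
Proof.
by move=> ww kk; have := test_cost_le N p kk; rewrite /query_cost; lia.
Qed.

Variables (x : word) (n P : nat).
Hypothesis hx : size x <= n.
Hypothesis hP : forall D' g, halts (run D' g (init N x)) = None -> size g <= P.

Lemma logs_lang ys t es g : logs x ys [:: t] es g ->
  lang M set0 (codes ys) <-> ok (tout t) es g (init N x).
Proof.
case=> e1 e2 e3 e4; rewrite hL e1 e2 e3 e4 kparse_entries.
by rewrite (_ : target _ = tout t) //; case: t {e1}.
Qed.

(* The log h (with assumed answers esF) describes a run that leads to c;   *)
(* the log r contains the true answers es2 to the same new queries.        *)
Record searching t es (h r : seq (logsym N)) es2 esF DF g (c : config N) : Prop
  :=
  Searching {
    s_assumed : logs x h [:: t] (es ++ esF) g;
    s_true : logs x r [::] (es ++ es2) [::];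
    s_queries : map fst esF = map fst es2;
    s_real : real D (es ++ es2);
    s_oracle : real DF (es ++ esF);
    s_run : traced x DF (es ++ esF) g c;
    s_ok : ok (tout t) (es ++ esF) [::] c }.

Definition word_bound := n + P + 1.
Definition steps_bound h0 := h0 + P.+1 * (word_bound + 2).
Definition step_cost h0 := 3 +
  size (enum (choices N)) * (test_cost (steps_bound h0 + word_bound + 2) + 15) +
  query_cost word_bound (steps_bound h0 + word_bound + 2).

Lemma size_query_log q a h : size (query_log q a h) = (size q + size h).+1.
Proof. by rewrite /= size_cat size_rev size_map. Qed.

(** [s_ok] promises a choice after which the target is still reachable. By [ok_unreplay] the test
    succeeds for it, and by [ok_replay] any successful test re-establishes [s_ok]. *)
Lemma search_Step t es h r es2 esF DF g c delta f :
  searching t es h r es2 esF DF g c -> program (cstate c) = Step delta ->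
  exists i f', searching t es (inr i :: h) r es2 esF DF (rcons g i) (stepf set0
    i c) /\
    det guided (nst x h r t f c)
      (2 + size (enum (choices N)) * (test_cost (size h).+1 + 15))
      (nst x (inr i :: h) r t f' (stepf set0 i c)).
Proof.
case=> l1 l2 q re rF tr okc e.
have langE i : lang M set0 (codes (inr i :: h)) <-> ok (tout t) (es ++ esF)
  (rcons g i) (init N x).
  by apply: logs_lang; apply: logs_choice.
have tri i := traced_Step i tr e.
have con z : (z, `[< DF z >]) \in es ++ esF -> (z, ~~ `[< DF z >]) \notin es ++
  esF.
  by move=> _; apply/negP => /rF; case: `[< _ >].
have [|i hi [f' dd]] := @det_try N M D o oM dM p hp x (enum (choices N)) h r t f
  c delta e.
  move: okc; rewrite okE e => -[i _ oki].
  exists i; first by rewrite mem_enum.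
  apply/langE; rewrite -[rcons g i]cats0.
  exact: (ok_unreplay (tri i)).
exists i, f'; split.
  split=> //; first exact: logs_choice.
  move/langE: hi; rewrite -[rcons g i]cats0 => hi.
  exact: (ok_replay (tri i)) hi.
apply: (@det_le _ _ _ _ _ _ _ _
  (size (enum (choices N)) * (test_cost (size h).+1 + 15)).+1); first by lia.
by apply: det_Case; rewrite cur_ov /= e.
Qed.

(** One test suffices: if true cannot be assumed, the continuation promised by [s_ok] answers false.
    The assumed oracle is then changed at this query only. *)
Lemma search_Query t es h r es2 esF DF g c q1 q0 f :
  searching t es h r es2 esF DF g c -> program (cstate c) = Query q1 q0 ->
  exists b DF',
    searching t es (inr (choice0 N) :: query_log (wd c) b h)
      (query_log (wd c) `[< D (wd c) >] r)
      (rcons es2 (wd c, `[< D (wd c) >])) (rcons esF (wd c, b)) DF'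
      (rcons g (choice0 N)) (branch c b) /\
    det guided (nst x h r t f c)
      (2 + query_cost (size (wd c)) (size (query_log (wd c) true h)))
      (nst x (inr (choice0 N) :: query_log (wd c) b h)
         (query_log (wd c) `[< D (wd c) >] r) t b (branch c b)).
Proof.
case=> l1 l2 q re rF tr okc e.
set w := wd c; set K := es ++ esF in l1 rF tr okc *.
have := @det_answer_query N M D o oM dM p hp x q1 q0 h r t f c e.
set b := `[< _ >] => dd.
have bE : b <-> ok (tout t) (rcons K (w, true)) g (init N x).
  by rewrite -(logs_lang (logs_query w true l1)); split=> [/asboolP|h'];
    last exact/asboolP.
have memK a : (w, a) :: K =i rcons K (w, a) by move=> z; rewrite mem_rcons.
have KK a : {subset K <= rcons K (w, a)} by move=> z zK;
  rewrite mem_rcons inE zK orbT.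
have [nb okb] : (w, ~~ b) \notin K /\ ok (tout t) (rcons K (w, b)) [::] (branch
  c b).
  case hb: b.
    have {}hb : ok (tout t) (rcons K (w, true)) [::] c.
      by apply: (ok_replay tr (KK true)); rewrite cats0; apply/bE; rewrite hb.
    move: hb; rewrite okE e => -[a na oka].
    have ea : a = true.
      by case: a na {oka} => //=; rewrite -/w mem_rcons mem_head.
    subst a; split.
      by apply: contra na => /= h'; rewrite mem_rcons inE h' orbT.
    apply: ok_eq_mem oka => z; rewrite inE; case: eqP => // ->.
    by rewrite mem_rcons mem_head.
  move: okc; rewrite okE e => -[[] na oka]; last first.
    by split=> //; apply: ok_eq_mem (memK false) oka.
  (* The promised continuation answers true although the test for true has failed: a contradiction,
     as replaying the run would have made the test succeed. *)
  have nK : (w, false) \notin rcons K (w, true).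
    by rewrite mem_rcons inE negb_or; apply/andP; split=> //; apply/eqP => -[].
  case/negP: (negbT hb); apply/bE; rewrite -[g]cats0.
  apply: (ok_unreplay tr (KK true)).
    move=> z zK; rewrite mem_rcons inE negb_or; apply/andP; split.
      apply/eqP => -[ez eb]; move: zK; rewrite ez in eb *.
      by rewrite -(negbK `[< _ >]) eb /= (negbTE na).
    by apply/negP => /rF; case: `[< _ >].
  rewrite okE e; exists true => //=.
  apply: ok_eq_mem oka => z; rewrite !inE mem_rcons inE.
  by case: (z == _).
exists b, (answer DF w b); split; last first.
  apply: (@det_le _ _ _ _ _ _ _ _
    (query_cost (size w) (size (query_log w true h))).+1); first by lia.
  by apply: det_Case; rewrite cur_ov /= e.
split.
- by rewrite -rcons_cat; apply/logs_choice/logs_query.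
- by rewrite -rcons_cat; apply: logs_query.
- by rewrite !map_rcons q.
- rewrite -rcons_cat => z a; rewrite mem_rcons inE => /orP[/eqP[-> ->] //|].
  exact: re.
- by rewrite -rcons_cat; apply: real_answer.
- rewrite -rcons_cat; apply: (traced_mono (K := (w, b) :: K)).
    by move=> z; rewrite memK.
  exact: traced_answer tr e nb.
- by rewrite -rcons_cat.
Qed.

(** The time bound concerns runs that have not halted, hence all but the last step. *)
Lemma traced_size DF K (g : seq (choices N)) (c : config N) : traced x DF K g c
  -> size g <= P.+1.
Proof.
have le K' (g' : seq (choices N)) c' : traced x DF K' g' c' -> halts c' = None
  -> size g' <= P.
  by move=> /traced_run -> h; apply: hP h.
case=> [|g' c' i delta h e|g' c' i q1 q0 a h e _ _] //;
  by rewrite size_rcons ltnS (le _ _ _ h) // /halts e.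
Qed.

Lemma search_run h0 t es m : forall h r es2 esF DF g c f,
  searching t es h r es2 esF DF g c -> P < size g + m ->
  size h <= h0 + size g * (word_bound + 2) ->
  size r <= h0 + size g * (word_bound + 2) ->
  exists h' r' es2' esF' DF' g' c' f',
    [/\ searching t es h' r' es2' esF' DF' g' c', isSome (halts c'),
      size h' <= steps_bound h0, size r' <= steps_bound h0 &
      det (While (live embN) guided) (nst x h r t f c)
        (m * step_cost h0 + 1) (nst x h' r' t f' c')].
Proof.
elim: m => [|m IH] h r es2 esF DF g c f s gm sh sr.
all: have run_g := traced_run (s_run s).
all: case hc: (halts c) => [o'|]; last have gP : size g <= P by
    (apply: (hP (D' := DF)); rewrite -run_g).
all: try (exists h, r, es2, esF, DF, g, c, f; split=> //;
  [by rewrite hc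
  |by apply: leq_trans sh _; rewrite leq_add2l leq_mul2r (traced_size (s_run s))
    orbT
  |by apply: leq_trans sr _; rewrite leq_add2l leq_mul2r (traced_size (s_run s))
    orbT
  |apply: (@det_le _ _ _ _ _ _ _ _ 1); [by lia|by apply: det_WhileF;
    rewrite live_ov hc]]).
  by move: gm; rewrite addn0 ltnNge gP.
have szw : size (wd c) <= word_bound.
  rewrite run_g; apply: leq_trans (size_wd _ _ _) _.
  by rewrite /word_bound leq_add2r leq_add.
have szh : size h <= steps_bound h0.
  by apply: leq_trans sh _; rewrite leq_add2l leq_mul2r (leqW gP) orbT.
have next h1 r1 es21 esF1 DF1 g1 c1 f1 T : searching t es h1 r1 es21 esF1 DF1 g1
  c1 ->
    size g1 = (size g).+1 -> size h1 <= size h + (word_bound + 2) ->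
    size r1 <= size r + (word_bound + 2) -> T < step_cost h0 ->
    det guided (nst x h r t f c) T (nst x h1 r1 t f1 c1) ->
    exists h' r' es2' esF' DF' g' c' f',
    [/\ searching t es h' r' es2' esF' DF' g' c', isSome (halts c'),
      size h' <= steps_bound h0, size r' <= steps_bound h0 &
      det (While (live embN) guided) (nst x h r t f c)
        (m.+1 * step_cost h0 + 1) (nst x h' r' t f' c')].
  move=> s1 sg sh1 sr1 hT d1.
  have [||| h' [r' [es2' [esF' [DF' [g' [c' [f' [s' c'h sh' sr' d']]]]]]]]] :=
     IH _ _ _ _ _ _ _ f1 s1.
  - by rewrite sg; lia.
  - by rewrite sg mulSn; apply: leq_trans sh1 _; move: sh; set v := size g * _;
      lia.
  - by rewrite sg mulSn; apply: leq_trans sr1 _; move: sr; set v := size g * _;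
      lia.
  exists h', r', es2', esF', DF', g', c', f'; split=> //.
  apply: (@det_le _ _ _ _ _ _ _ _ (T + (m * step_cost h0 + 1)).+1).
    by rewrite mulSn; lia.
  by apply: det_WhileT d1 d'; rewrite live_ov hc.
move: hc; rewrite /halts; case e: (program _) => [//|q1 q0|delta] _.
- have [b [DF1 [s1 d1]]] := search_Query f s e.
  apply: next s1 _ _ _ _ d1; rewrite ?size_rcons //.
  + apply: (@leq_trans (size (query_log (wd c) b h)).+1) => //.
    by rewrite size_query_log; lia.
  + by rewrite size_query_log; lia.
  + rewrite /step_cost size_query_log.
    have : query_cost (size (wd c)) (size (wd c) + size h).+1 <=
       query_cost word_bound (steps_bound h0 + word_bound + 2).
      by apply: query_cost_le => //; lia.
    by lia.
- have [i [f1 [s1 d1]]] := search_Step f s e.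
  apply: next s1 _ _ _ _ d1; rewrite ?size_rcons //=.
  + by lia.
  + by lia.
  + rewrite /step_cost.
    have tc : test_cost (size h).+1 <= test_cost (steps_bound h0 + word_bound +
      2).
      by apply: test_cost_le; lia.
    apply: leq_trans (leq_addr _ _).
    rewrite -[(2 + _).+1]/(3 + _) leq_add2l.
    exact: leq_mul (leqnn _) (leq_add tc (leqnn 15)).
Qed.

End Search.

(** * Why a round with the wrong target makes progress *)

Lemma count_lt (T : eqType) (a b : pred T) (l : seq T) z :
  subpred a b -> z \in l -> b z -> ~~ a z -> count a l < count b l.
Proof.
move=> ab zl bz az; elim: l zl => //= y l IH; rewrite inE.
case: eqP => [<- _|_ /= /IH lt].
  by rewrite (negbTE az) bz add0n add1n ltnS; apply: sub_count.
by rewrite -addnS leq_add //; case: (a y) (ab y) => // ->.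
Qed.

Section Progress.
Variables (N : machine) (x : word) (D : language).
Hypothesis under : forall D', underproductive N D' x.
Variables (v : bool) (gR : seq (choices N)).
Hypothesis hR : halts (run D gR (init N x)) = Some (tout v).

Definition on_path j := run D (take j gR) (init N x).

Definition unknown (es : seq (word * bool)) : pred nat := fun j =>
  (if program (cstate (on_path j)) is Query _ _ then true else false) &&
  ((wd (on_path j), `[< D (wd (on_path j)) >]) \notin es).

Definition measure es := count (unknown es) (iota 0 (size gR)).

Lemma measure_le es es2 : measure (es ++ es2) <= measure es.
Proof.
apply: sub_count => j /andP[q]; rewrite mem_cat negb_or => /andP[ne _].
by rewrite /unknown q.
Qed.

Lemma run_agree D' (g : seq (choices N)) c :
  (forall j q1 q0, j < size g -> program (cstate (run D (take j g) c)) = Query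
    q1 q0 ->
     `[< D' (wd (run D (take j g) c)) >] = `[< D (wd (run D (take j g) c)) >])
       ->
  run D' g c = run D g c.
Proof.
elim: g c => //= i g IH c h.
have -> : stepf D' i c = stepf D i c.
  case e: (program (cstate c)) => [o|q1 q0|delta].
  - by rewrite !stepf_halts // /halts e.
  - by rewrite !(stepf_Query _ _ e) (h 0 _ _ _ e).
  - exact: stepf_Step e.
by apply: IH => j q1 q0 jg e; apply: (h j.+1 q1 q0).
Qed.

(* A run with the wrong outcome would be compatible with the true run if   *)
(* they shared no query that is answered differently: some oracle would    *)
(* make the machine both accept and reject.                                *)
Lemma measure_lt es es2 esF DF g (c : config N) :
  map fst esF = map fst es2 -> real D (es ++ es2) -> real DF (es ++ esF) ->
  traced x DF (es ++ esF) g c -> halts c = Some (tout (~~ v)) ->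
  measure (es ++ es2) < measure es.
Proof.
move=> qE re rF tr hc.
(* If the search met a query of the true path whose true answer was unknown, that position leaves
   the count. Otherwise two outcomes appear under one oracle. *)
pose fresh j := unknown es j && (wd (on_path j) \in map fst es2).
have [[j jg /andP[uj qj]]|no] := pselect (exists2 j, j < size gR & fresh j).
  apply: (count_lt (z := j)) uj _; last 1 first.
  - have [[w a] waes e] := mapP qj; rewrite /unknown negb_and negbK; apply/orP;
      right.
    move: waes => /= wa; rewrite -[wd _]/(wd (on_path j)) e /= mem_cat.
    have -> : `[< D w >] = a by rewrite -(re w a) // mem_cat wa orbT.
    by rewrite wa orbT.
  - move=> k /andP[q]; rewrite mem_cat negb_or => /andP[ne _].
    by rewrite /unknown q.
  - by rewrite mem_iota.
(* The glued oracle: the assumed one on recorded queries, the true one elsewhere. The true path does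
   not notice, because without a fresh query it meets a recorded query only if [es] already holds
   its true answer, on which both oracles agree. *)
pose D' : language := [set z | if z \in map fst (es ++ esF) then DF z else D z].
have D'E z : `[< D' z >] = if z \in map fst (es ++ esF) then `[< DF z >] else
  `[< D z >].
  by rewrite /D' /=; case: ifP.
have runF : run D' g (init N x) = c.
  apply/esym; apply: traced_run (traced_oracle _ tr) => q qK.
  by rewrite D'E (map_f fst qK).
have runR : run D' gR (init N x) = run D gR (init N x).
  apply: run_agree => j q1 q0 jg e; rewrite D'E; case: ifP => //.
  rewrite map_cat mem_cat => /orP[/mapP[[w a] wa ->] /=|].
    have wa1 : (w, a) \in es ++ es2 by rewrite mem_cat wa.
    have wa2 : (w, a) \in es ++ esF by rewrite mem_cat wa.
    by rewrite -(re _ _ wa1) -(rF _ _ wa2).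
  rewrite qE => q2.
  have wa : (wd (on_path j), `[< D (wd (on_path j)) >]) \in es.
    apply/negPn/negP => ne; apply: no; exists j => //.
    by rewrite /fresh /unknown /on_path e ne q2.
  have wa2 : (wd (on_path j), `[< D (wd (on_path j)) >]) \in es ++ esF.
    by rewrite mem_cat wa.
  by rewrite -(rF _ _ wa2).
have oR : out N D' x (tout v) by apply/out_run; exists gR; rewrite runR.
have oF : out N D' x (tout (~~ v)) by apply/out_run; exists g; rewrite runF.
case: (under (D' := D')) => z [] ->; by case: (v) oR oF.
Qed.

End Progress.

(** * One round of the search *)

Section Rounds.
Variables N M : machine.
Variables (D : language) (o : outcome).
Local Notation sreg := (sreg N M).
Local Notation ssym := (ssym N M).
Local Notation embN := (embN N M).
Local Notation embM := (embM N M).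
Local Notation det := (@det sreg ssym unit mQry D o).
Local Notation wp := (@wp sreg ssym unit mQry D o).
Local Notation cmd := (@cmd sreg ssym unit).
Local Notation Ops := (@Ops sreg ssym unit).
Local Notation Stop := (@Stop sreg ssym unit).
Local Notation xfer := (@xfer sreg ssym unit).
Local Notation test := (test N M).
Local Notation lg := (@lg N M).
Local Notation nst := (@nst N M).

Definition aim (t : {ffun sreg -> symbol ssym}) : bool :=
  if t mT is Some (inl true) then true else false.

(** A negative test ends the computation with the opposite of the target. Otherwise a path is found,
    its assumed answers and choices in [mH] are discarded, the true answers remain in [mR], and the
    other target is tried next. *)
Definition round : cmd :=
  Seq (xfer mR xpredT (fun a r => match r with mTmp => [:: a] | _ =>
    [::] end) 1)
  (Seq (xfer mTmp xpredT (fun a r => match r with mR | mH => [:: a] | _ =>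
    [::] end) 1)
  (Seq (Case (fun t => @opH N M (Push (lg (LT (aim t))))))
  (Seq test
  (Case (fun t => if success t then
     Seq (load unit embN mInp mTmp)
     (Seq (While (live embN) (guided N M))
     (Seq (clear _ _ (fun r : sreg => match r with mH | inl (inl _) =>
       true | _ => false end))
          (Case (fun t => Ops (fun r => match r with mT => Put (inl (~~ aim t))
            | _ => Keep end)))))
   else Stop (tout (~~ aim t))))))).

Hypotheses (oM : oracle_free M) (dM : deterministic M).
Variable p : {poly nat}.
Hypothesis hp :
  forall D x g, halts (run D g (init M x)) = None -> size g <= p.[size x]%R.
Hypothesis hL : forall ys : seq (logsym N), lang M set0 (codes ys) <->
  ok (target (log_targets ys)) (kparse [::] (log_answers ys))
     (log_choices ys) (init N (log_input ys)).
Local Notation test_cost := (test_cost N p).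
Local Notation step_cost := (step_cost N p).

Variables (x : word) (n P : nat).
Hypothesis hx : size x <= n.
Hypothesis hP : forall D' g, halts (run D' g (init N x)) = None -> size g <= P.

Local Notation sst := (@sst N M x [::]).

Lemma aim_sst h r t f : aim (tops (sst h r t f)) = t.
Proof. by rewrite /aim ffunE /=; case: t. Qed.

Definition searching_cost h0 := h0 * 8 + 1 + (h0 * 8 + 1 + (3 + (test_cost h0 +
  (1 +
  (16 * n + 7 + (P.+1 * step_cost n P h0 + 1 +
   (3 * (steps_bound n P h0 + n + P + 3) + 1 + 3))))))).

Lemma step_cost_le a b : a <= b -> step_cost n P a <= step_cost n P b.
Proof.
move=> ab; rewrite /step_cost.
have le : steps_bound n P a + word_bound n P + 2 <= steps_bound n P b +
  word_bound n P + 2.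
  by rewrite !leq_add2r.
apply: leq_add; last exact: query_cost_le.
by rewrite leq_add2l leq_mul2l leq_add2r (test_cost_le N p le) orbT.
Qed.

Lemma round_spec es r t f h0 : real D es -> logs x r [::] es [::] ->
  (size r).+1 <= h0 ->
  (~ ok (tout t) es [::] (init N x) /\ forall k T,
      wp round k (sst [::] r t f) (searching_cost h0 + T) (tout (~~ t) = o)) \/
  exists h' r' es2 esF DF g c f', [/\ searching D x t es h' r' es2 esF DF g c,
      isSome (halts c), size r' <= steps_bound n P (size r).+1 &
      det round (sst [::] r t f) (searching_cost h0) (sst [::] r' (~~ t) f')].
Proof.
move=> re lr szr.
pose s1 : regs sreg ssym := fun z => match z with
  | mR => [::] | mTmp => rev (map lg r) | _ => sst [::] r t f z end.
have d1 : det (xfer mR xpredT (fun a r => match r with mTmp => [:: a] | _ =>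
  [::] end) 1)
   (sst [::] r t f) (h0 * 8 + 1) s1.
  apply: (det_xfer_to (map lg r) [::]);
    rewrite ?cats0 ?all_predT ?size_map //; last by lia.
  - by move=> a [[m|m]|[[[] []] []]].
  - move=> [[m|m]|[[[] []] []]] //= _; rewrite ?flatten_rev0 //.
    by rewrite flatten_rev1 map_id cats0.
have d2 : det (xfer mTmp xpredT (fun a r => match r with mR | mH =>
  [:: a] | _ => [::] end) 1)
   s1 (h0 * 8 + 1) (sst r r t f).
  apply: (det_xfer_to (rev (map lg r)) [::]);
    rewrite ?cats0 ?all_predT ?size_rev ?size_map //; last by lia.
  - by move=> a [[m|m]|[[[] []] []]].
  - by move=> [[m|m]|[[[] []] []]] //= _; rewrite ?flatten_rev0 //
      flatten_rev1 map_id revK cats0.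
have d3 : det (Case (fun t => @opH N M (Push (lg (LT (aim t))))))
   (sst r r t f) 3 (sst (LT t :: r) r t f).
  apply: det_Case; rewrite aim_sst; apply: det_Ops_to.
  by move=> [[m|m]|[[[] []] []]].
set b := `[< lang M set0 (codes (LT t :: r : seq (logsym N))) >].
have lh : logs x (LT t :: r) [:: t] (es ++ [::]) [::].
  by rewrite cats0; apply: logs_target.
have bE : b <-> ok (tout t) es [::] (init N x).
  have h := logs_lang hL lh; rewrite cats0 in h.
  by rewrite -h; split=> [/asboolP|h']; last exact/asboolP.
have d4 : det test (sst (LT t :: r) r t f) (test_cost h0) (sst (LT t :: r) r t
  b).
  apply: (@det_le _ _ _ _ _ _ _ _ (test_cost (size (LT t :: r : seq (logsym
    N))))).
    exact: test_cost_le.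
  have -> : sst (LT t :: r) r t b = fun z => match z with
     | mF => [:: inl b] | _ => sst (LT t :: r) r t f z end.
    by apply/funext => -[[m|m]|[[[] []] []]].
  by apply: (det_test D o oM dM hp).
have succ h : success (tops (sst h r t b)) = b.
  by rewrite /success ffunE /=; case: (b).
case hb: b; last first.
  left; split=> [/bE|k T]; first by rewrite hb.
  apply: (@wp_le _ _ _ _ _ _ _ _ _ (h0 * 8 + 1 + ((h0 * 8 + 1) + (3 + (test_cost
    h0 + 1))))).
    by rewrite /searching_cost; lia.
  apply: wp_Seq; apply: (wp_det d1); apply: wp_Seq; apply: (wp_det d2).
  apply: wp_Seq; apply: (wp_det d3); apply: wp_Seq; apply: (wp_det d4).
  apply: wp_Case; rewrite succ hb aim_sst; exact: wp_Stop.
right.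
have okb : ok (tout t) es [::] (init N x) by apply/bE; rewrite hb.
have s0 : searching D x t es (LT t :: r) r [::] [::] D [::] (init N x).
  by split; rewrite ?cats0 //; [rewrite -[es]cats0|apply: traced_nil].
have [|||h' [r' [es2 [esF [DF [g [c [f' [s' hc szh szr' d6]]]]]]]]] :=
   @search_run N M D o oM dM p hp hL x n P hx hP (size r).+1 t es P.+1 _ _ _ _ _
     _ _ b s0.
- by [].
- by rewrite addn0.
- by rewrite addn0.
exists h', r', es2, esF, DF, g, c, f'; split=> //.
have stepsM a a' : a <= a' -> steps_bound n P a <= steps_bound n P a'.
  by move=> aa; rewrite leq_add2r.
have d5 : det (load unit embN mInp mTmp) (sst (LT t :: r) r t b) (16 * n + 7)
    (nst x (LT t :: r) r t b (init N x)).
  apply: (@det_le _ _ _ _ _ _ _ _ (16 * size x + 7)); first by lia.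
  by apply: det_load.
have d6' : det (While (live embN) (guided N M)) (nst x (LT t :: r) r t b (init N
  x))
    (P.+1 * step_cost n P h0 + 1) (nst x h' r' t f' c).
  by apply: det_le d6; rewrite leq_add2r leq_mul2l /= step_cost_le.
have d7 : det (clear _ _ (fun r : sreg => match r with mH | inl (inl _) =>
  true | _ => false end))
    (nst x h' r' t f' c) (3 * (steps_bound n P h0 + n + P + 3) + 1) (sst [::] r'
      t f').
  have -> : sst [::] r' t f' = fun z => if (match z with mH | inl (inl _) =>
    true | _ => false end)
      then [::] else nst x h' r' t f' c z.
    by apply/funext => -[[m|m]|[[[] []] []]].
  have sb := stepsM _ _ szr.
  apply: det_clear => -[[m|m]|[[[] []] []]] //= _; rewrite /nst /ov /=.
    rewrite (traced_run (s_run s')); apply: leq_trans (size_content _ _ _ _ _)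
      _.
    by have := traced_size hP (s_run s'); lia.
  rewrite size_map; apply: leq_trans szh _; apply: leq_trans sb _; by lia.
have d8 : det (Case (fun t => Ops (fun r => match r with mT => Put (inl (~~ aim
  t)) | _ => Keep end)))
    (sst [::] r' t f') 3 (sst [::] r' (~~ t) f').
  apply: det_Case; rewrite aim_sst; apply: det_Ops_to.
  by move=> [[m|m]|[[[] []] []]].
apply: (det_Seq d1 (det_Seq d2 (det_Seq d3 (det_Seq d4 _)))).
rewrite [1 + (16 * n + 7 + _)]add1n; apply: det_Case; rewrite succ {1}hb;
  cbv iota.
exact: det_Seq d5 (det_Seq d6' (det_Seq d7 d8)).
Qed.

End Rounds.

(** * The deterministic simulation and its time bound *)

Section Main.
Variables N M : machine.
Local Notation sreg := (sreg N M).
Local Notation ssym := (ssym N M).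
Local Notation cmd := (@cmd sreg ssym unit).
Local Notation Ops := (@Ops sreg ssym unit).
Local Notation xfer := (@xfer sreg ssym unit).
Local Notation lg := (@lg N M).

Definition searcher : cmd :=
  Seq (xfer mInp xpredT (fun a r => match r with
         | mTmp => [:: a]
         | mR => [:: lg (LX (if a is inl b then b else false))]
         | _ => [::] end) 1)
  (Seq (xfer mTmp xpredT (fun a r => match r with mInp => [:: a] | _ =>
    [::] end) 1)
  (Seq (Ops (fun r => match r with
          | mT => Push (inl true) | mF => Push (inl false) | _ => Keep end))
       (While (fun=> true) (round N M)))).

Hypotheses (oM : oracle_free M) (dM : deterministic M).
Variable p : {poly nat}.
Hypothesis hp :
  forall D x g, halts (run D g (init M x)) = None -> size g <= p.[size x]%R.
Hypothesis hL : forall ys : seq (logsym N), lang M set0 (codes ys) <->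
  ok (target (log_targets ys)) (kparse [::] (log_answers ys))
     (log_choices ys) (init N (log_input ys)).

Definition growth n P := 1 + P.+1 * (word_bound n P + 2).
(** The measure is at most [P.+1] at the start, so the potential of [wp_rounds] is at most
    [2 * P.+1 + 1]; that lemma asks for a strictly larger number. *)
Definition rounds P := 2 * P.+1 + 2.
Definition log_limit n P := n + rounds P * growth n P + 1.
Definition searcher_time n P := n * 8 + 1 + (n * 8 + 1 + (2 +
  rounds P * (searching_cost N p n P (log_limit n P)).+1)).

Section Run.
Variables (D : language) (o : outcome) (x : word) (n P : nat).
Local Notation det := (@det sreg ssym unit mQry D o).
Local Notation wp := (@wp sreg ssym unit mQry D o).
Local Notation sst := (@sst N M x [::]).
Hypothesis hx : size x <= n.
Hypothesis hP : forall D' g, halts (run D' g (init N x)) = None -> size g <= P.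
Hypothesis under : forall D', underproductive N D' x.
Variables (v : bool) (gR : seq (choices N)).
Hypothesis hR : halts (run D gR (init N x)) = Some (tout v).

(** The potential is [2 * measure + (t == v)]. A round that aims at the true outcome lowers it by at
    least one, since the target then becomes wrong. A round that aims at the wrong outcome and finds
    a path lowers the measure, which outweighs the one gained by turning to the right target. *)
Lemma wp_rounds (k : trans _ _) H rho : forall es r (t f : bool),
  real D es -> logs x r [::] es [::] ->
  2 * measure x D gR es + (t == v) < rho ->
  size r + rho * growth n P + 1 <= H ->
  wp (While (fun=> true) (round N M)) k (sst [::] r t f)
    (rho * (searching_cost N p n P H).+1) (tout v = o).
Proof.
elim: rho => // rho IH es r t f re lr lt szr.
set SC := searching_cost _ _ _ _ _ in IH *.
apply: (wp_While (U := SC + rho * SC.+1)); first by rewrite mulSn addSn.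
have rH : (size r).+1 <= H.
  by apply: leq_trans szr; rewrite addn1 ltnS leq_addr.
have [[nok wr]|[h' [r' [es2 [esF [DF [g [c [f' [s hc szr' dr]]]]]]]]]] :=
  @round_spec N M D o oM dM p hp hL x n P hx hP es r t f H re lr rH.
  (* The test cannot fail for the true outcome, since the true path is consistent with true
     answers. *)
  have tv : t = ~~ v.
    have : t != v by apply/eqP => tv; apply: nok; rewrite tv;
      apply: ok_real re hR.
    by case: (t); case: (v).
  by rewrite -[v in tout v]negbK -tv; apply: wr.
apply: (wp_det dr); apply: (IH (es ++ es2)).
- exact: s_real s.
- exact: s_true s.
- have le := @measure_le N x D gR es es2.
  have [tv|tv] := eqVneq t v.
    have -> : (~~ t == v) = false by rewrite tv; case: (v).
    by move: lt; rewrite tv eqxx; lia.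
  have tv' : t = ~~ v by move: tv; case: (t); case: (v).
  have : measure x D gR (es ++ es2) < measure x D gR es.
    apply: (measure_lt under hR (s_queries s) (s_real s) (s_oracle s) (s_run
      s)).
    move: hc (s_ok s); rewrite okE /halts tv'.
    by case: (program _) => // o' _ ->.
  by move: lt; case: (t == v); case: (~~ t == v); lia.
- move: szr szr'; rewrite /steps_bound mulSn {1}/growth.
  set a := P.+1 * _; set b := rho * _; lia.
Qed.

Hypothesis szR : size gR <= P.+1.

Lemma wp_searcher (k : trans _ _) :
  wp searcher k (init_regs ssym (mInp : sreg) x) (searcher_time n P) (tout v =
    o).
Proof.
pose s1 : regs sreg ssym := fun z => match z with
  | mTmp => rev (map inl x) | mR => map lg (rev [seq LX b | b <- x]) | _ =>
    [::] end.
pose s2 : regs sreg ssym := fun z => match z with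
  | mInp => map inl x | mR => map lg (rev [seq LX b | b <- x]) | _ => [::] end.
have sz8 : size x * 8 + 1 <= n * 8 + 1 by rewrite leq_add2r leq_mul2r hx.
have d1 : det (xfer mInp xpredT (fun a r => match r with
         | mTmp => [:: a]
         | mR => [:: lg (LX (if a is inl b then b else false))]
         | _ => [::] end) 1) (init_regs ssym (mInp : sreg) x) (n * 8 + 1) s1.
  apply: (det_xfer_to [seq inl b | b <- x] [::]);
    rewrite ?cats0 ?all_predT ?size_map //.
  - by move=> a [[m|m]|[[[] []] []]].
  - move=> [[m|m]|[[[] []] []]] //= _; rewrite ?flatten_rev0 // flatten_rev1
      cats0 ?map_id //.
    by rewrite -map_comp map_rev -map_comp.
have d2 : det (xfer mTmp xpredT (fun a r => match r with mInp => [:: a] | _ =>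
  [::] end) 1)
    s1 (n * 8 + 1) s2.
  apply: (det_xfer_to (rev [seq inl b | b <- x]) [::]);
    rewrite ?cats0 ?all_predT ?size_rev ?size_map //.
  - by move=> a [[m|m]|[[[] []] []]].
  - move=> [[m|m]|[[[] []] []]] //= _; rewrite ?flatten_rev0 //.
    by rewrite flatten_rev1 map_id revK cats0.
have d3 : det (Ops (fun r => match r with
          | mT => Push (inl true) | mF => Push (inl false) | _ =>
            Keep end)) s2 2
    (sst [::] (rev [seq LX b | b <- x]) true false).
  by apply: det_Ops_to => -[[m|m]|[[[] []] []]].
rewrite /searcher_time; apply: wp_Seq; apply: (wp_det d1).
apply: wp_Seq; apply: (wp_det d2); apply: wp_Seq; apply: (wp_det d3).
apply: (wp_rounds (es := [::])) => //.
- exact: logs_input.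
- have : measure x D gR [::] <= P.+1.
    by apply: leq_trans szR; rewrite -[X in _ <= X](size_iota 0) count_size.
  by rewrite /rounds; case: (_ == _); lia.
- by rewrite size_rev size_map /log_limit leq_add2r leq_add2r.
Qed.

End Run.

Lemma polyb_S f : polyb f -> polyb (fun n => (f n).+1).
Proof.
move=> h; apply: (polyb_le (g := fun n => f n + 1)); first by move=> n;
  rewrite addn1.
by apply: polyb_add h (polyb_const 1).
Qed.

Lemma polyb_searcher_time (q : {poly nat}) : polyb (fun n => searcher_time n
  q.[n]%R).
Proof.
rewrite /searcher_time /searching_cost /step_cost /query_cost /test_cost
  /steps_bound
  /code_bound /log_limit /rounds /growth /word_bound.
repeat first [exact: polyb_const | exact: polyb_id | exact: polyb_horner
  | apply: polyb_add | apply: polyb_mul | apply: polyb_S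
  | apply: (@polyb_comp (fun m => p.[m]%R))].
Qed.

(** Robust overproductivity provides the outcome [v] of the true path, acc or rej, and robust
    underproductivity makes it the only one of these two. *)
Lemma searcher_machine : polytime N -> robustly_overproductive N ->
  robustly_underproductive N -> exists K : machine,
  [/\ polytime K, deterministic K & forall D, lang K D = lang N D].
Proof.
move=> pN overN underN; have [f [q fq] hf] := proj1 (polytimeP N) pN.
have hq D x g : halts (run D g (init N x)) = None -> size g <= q.[size x]%R.
  by move=> /hf h; apply: leq_trans h (fq _).
have [K cK hK] := @compile sreg ssym unit mInp mQry tt searcher isT.
have key D x : (forall n (d : config K), path_to D x n d ->
      n <= searcher_time (size x) q.[size x]%R) /\
    (out K D x Acc <-> out N D x Acc).
  have [v ov_] : exists v, out N D x (tout v).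
    have [o ho] := polytime_out D x pN.
    case: (pselect (out N D x Acc)) => [ha|na]; first by exists true.
    case: (pselect (out N D x Rej)) => [hr|nr]; first by exists false.
    case: (overN D x); apply/seteqP; split=> [[] //|_ ->].
    by case: o ho.
  have [g hg] := proj1 (out_run N D x _) ov_.
  (* By the time bound the run has halted after this many choices, so cutting the string keeps its
     outcome and bounds the initial measure. *)
  pose gR := take (q.[size x]%R).+1 g.
  have hR : halts (run D gR (init N x)) = Some (tout v).
    have [lt|le] := ltnP (size g) (q.[size x]%R).+1.
      by rewrite /gR take_oversize // ltnW.
    have hs : isSome (halts (run D gR (init N x))).
      case e: (halts _) => //; have := hq _ _ _ e.
      by rewrite size_take_min (minn_idPl le) ltnn.
    by move: hg; rewrite -{1}(cat_take_drop (q.[size x]%R).+1 g) run_cat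
      run_halts.
  have szR : size gR <= (q.[size x]%R).+1 by rewrite size_take_min geq_minl.
  have w := @wp_searcher D Acc x (size x) q.[size x]%R (leqnn _)
    (fun D' g => @hq D' x g) (fun D' => underN D' x) v gR hR szR
    (fun _ _ phi => phi = (Rej = Acc)).
  have [h1 h2] := hK _ _ _ _ _ w; split=> //.
  rewrite h2; split=> [|ha]; first by case: v ov_ {hg hR w h2}.
  case: v ov_ {hg hR w h2} => //= hr.
  by case: (underN D x) => o [] ->.
exists K; split.
- have [r hr] := polyb_searcher_time q.
  by exists r => D x n d pd; apply: leq_trans (hr _);
    apply: (proj1 (key D x)) pd.
- by rewrite /deterministic cK card_unit.
- by move=> D; apply/seteqP; split=> x; rewrite /lang /= => h;
    apply/(proj2 (key D x)).
Qed.

End Main.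

(** * Conclusion *)

Lemma le_pT_RS : le_pT `<=` le_RS.
Proof.
move=> [A B] [M [pM tM dM eA]]; exists M; split=> //.
  move=> D x e; have [o ho] := polytime_out D x pM.
  have oQ : o = Quest by move: ho; rewrite e.
  by case: ho => n [c [_]]; rewrite oQ => /tM.
move=> D x h.
by have := deterministic_out dM (h Acc (or_introl erefl)) (h Rej (or_intror
  erefl)).
Qed.

Lemma P_eq_NP_RS_eq_T : classP = classNP -> le_RS = le_pT.
Proof.
move=> PNP; apply/seteqP; split=> [[A B]|]; last exact: le_pT_RS.
case=> N [pN overN underN /= ->].
have [L] := guess_language pN; rewrite -PNP => -[M [pM _ oM dM ->]] hL.
have [f [p fp] hf] := proj1 (polytimeP M) pM.
have hp D x g : halts (run D g (init M x)) = None -> size g <= p.[size x]%R.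
  by move=> /hf h; apply: leq_trans h (fp _).
have [K [pK dK langK]] := searcher_machine oM dM hp hL pN overN underN.
exists (transform noquest false K); split=> //=.
- exact: transform_polytime.
- by apply: transform_two_outcome; case.
rewrite -langK; apply/seteqP; split=> x.
  by move=> h; apply/transform_out; exists Acc.
by case/transform_out => -[].
Qed.

Theorem theorem4p12 :
  (le_RS <> le_pT -> classP <> classNP) /\
  (le_RS = le_pT -> classP = classNP `&` class_coNP).
Proof.
split; last exact: RS_eq_T_P_eq.
by move=> ne e; apply: ne; apply: P_eq_NP_RS_eq_T.
Qed.
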